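(* Let $X$ be a generalized Raynaud surface over a pre-Tango curve $C$, as constructed in the context, with polarization $\mathcal Z=\mathcal O_X(\tilde E)\otimes\phi^*\mathcal N_\ell$. If $p=2$ or $p=3$, then $H^1(X,\mathcal Z^n)=0$ for every integer $n<-\big(\ell-\lceil\frac{2\ell}{p+1}\rceil\big)$.
   Context: Construction of the generalized Raynaud surface. Let $k$ be an algebraically closed field of characteristic $p>0$ and $C$ a smooth projective curve over $k$ of genus $g\ge 2$ with function field $K(C)$. A pre-Tango structure on $C$ is an invertible sheaf $\mathcal L=\mathcal O_C(D)$, with $D$ an ample divisor (i.e. $\deg D>0$), such that $(df)\ge pD$ for some $f\in K(C)\setminus K(C)^p$; $C$ is a pre-Tango curve if it has such a structure. Fix such $\mathcal L=\mathcal O_C(D)$ and $f_0\in K(C)\setminus K(C)^p$ with $(df_0)\ge pD$. Fix an integer $e\ge 2$ prime to $p$ with $e\mid\deg\mathcal L$, and an ample invertible sheaf $\mathcal N$ on $C$ with $\mathcal L=\mathcal N^{e}$. Fix an integer $\ell\ge 2$ with $\ell\mid p+1$ and $\ell\mid e$, and put $\mathcal N_\ell:=\mathcal N^{e/\ell}$ (so $\mathcal N_\ell^{\ell}=\mathcal L$). Let $F$ be the Frobenius morphism of $C$ and $\mathcal B^1$ the image of $F_*d:F_*\mathcal O_C\to F_*\Omega^1_C$, so $0\to\mathcal O_C\to F_*\mathcal O_C\to\mathcal B^1\to0$ is exact. Then $H^0(C,\mathcal B^1\otimes\mathcal L^{-1})=\{df: (df)\ge pD\}$, and the connecting map $\eta:H^0(C,\mathcal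 B^1\otimes\mathcal L^{-1})\to H^1(C,\mathcal L^{-1})$ is injective with image the kernel of $F^*:H^1(C,\mathcal L^{-1})\to H^1(C,\mathcal L^{-p})$. The class $\eta(df_0)\neq0$ defines a non-split extension $0\to\mathcal O_C\to\mathcal E\to\mathcal L\to0$ with $\mathcal E$ locally free of rank 2, while $0\to\mathcal O_C\to F^*\mathcal E\to\mathcal L^{p}\to0$ splits (uniquely). Let $\pi:P=\mathbb P(\mathcal E)=\mathrm{Proj}\,S(\mathcal E)\to C$ ($\pi_*\mathcal O_P(1)=\mathcal E$), and let $E\subset P$ be the section of $\pi$ which is the zero divisor of the section $s\in H^0(P,\mathcal O_P(1))=H^0(C,\mathcal E)$ that is the image of $1\in H^0(C,\mathcal O_C)$; so $\mathcal O_P(E)\cong\mathcal O_P(1)$. The splitting gives an exact sequence $0\to\mathcal O_C\to F^*\mathcal E\otimes\mathcal L^{-p}\to\mathcal L^{-p}\to 0$; the image of $1$ in $H^0(C,F^*\mathcal E\otimes\mathcal L^{-p})$ defines a section curve $\Gamma'$ of $P'=\mathbb P(F^*\mathcal E\otimes \mathcal L^{-p})\cong\mathbb P(F^*\mathcal E)\to C$. Let $C''\subset P$ be the preimage of $\Gamma'$ under the relative Frobenius $P\to P'$ over $C$ ($p$-th power on the fibre coordinates). Then $\mathcal O_P(C'')\cong\mathcal O_P(p)\otimes\pi^*\mathcal L^{-p}$ and $E\cap C''=\emptyset$. Put $\mathcal M:=\mathcal O_P\big(-\tfrac{p+1}{\ell}\big)\otimes\pi^*\mathcal N_\ell^{\,p}$,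 so $\mathcal M^{-\ell}=\mathcal O_P(E+C'')$. Let $\psi:X:=\mathcal{S}pec\big(\bigoplus_{i=0}^{\ell-1}\mathcal M^i\big)\to P$ be the cyclic cover of degree $\ell$ ramified at $E+C''$, the algebra structure being tensor product followed, when $i+j\ge\ell$, by multiplication with the section of $\mathcal M^{-\ell}$ defining $E+C''$. Put $\phi=\pi\circ\psi:X\to C$ and $\tilde E=\psi^{-1}(E)$ (the reduced preimage), so $\ell\tilde E=\psi^*E$. $\lceil\cdot\rceil$ denotes round up. *)

(* Defs.v *)
From HB Require Import structures.
From mathcomp Require Export all_boot all_order all_algebra.
From mathcomp Require Export boolp classical_sets functions cardinality fsbigop.

Set Implicit Arguments.
Unset Strict Implicit.
Unset Printing Implicit Defensive.
Import Order.TTheory GRing.Theory Num.Theory.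

#[global] Open Scope ring_scope.
#[global] Open Scope classical_set_scope.

(* Integral separated schemes are represented in the style of Zariski and
   Chevalley: such a scheme is the set of its local rings, seen as subrings
   of a field containing its function field; the local ring at a point IS the
   point. Only integral schemes and torsion-free sheaves occur. A
   sheaf of modules F is given by its stalks F R, seen inside the stalk at the
   generic point, and its sections over an open set U are the elements lying in
   F R for every R in U. A morphism X -> Y compatible with the inclusion of
   function fields sends a local ring of X to the local ring of Y it dominates. *)

Definition is_subring (F : fieldType) (A : set F) : Prop :=
  GRing.subring_closed [in A].

Definition gen_subring (F : fieldType) (S : set F) : set F :=
  smallest (@is_subring F) S.

Definition prime_ideal_of (F : fieldType) (A q : set F) : Prop :=
  [/\ q `<=` A, q 0, (forall a b, q a -> q b -> q (a + b)),
      (forall a b, A a -> q b -> q (a * b)) &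
      ~ q 1 /\ forall a b, A a -> A b -> q (a * b) -> q a \/ q b].

Definition localization (F : fieldType) (A q : set F) : set F :=
  [set x | exists a b, [/\ A a, A b, ~ q b & x = a / b]].

Definition spec (F : fieldType) (A : set F) : set (set F) :=
  [set R | exists2 q, prime_ideal_of A q & R = localization A q].

Definition max_ideal (F : fieldType) (R : set F) : set F :=
  [set x | R x /\ (x = 0 \/ ~ R x^-1)].

(* If X is a union of affine opens Spec A_i with A_i of finite type, then
   Spec A_i = {R in X | A_i is contained in R} by separatedness, so the Zariski
   topology of X has the sets {R in X | f in R}, f in the function field, as a
   subbasis. *)
Definition zariski_open (F : fieldType) (X U : set (set F)) : Prop :=
  U `<=` X /\
  forall R, U R -> exists fs : seq F,
    {in fs, forall f, R f} /\
    forall R', X R' -> {in fs, forall f, R' f} -> U R'.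

(* The members of a cover are required to be nonempty because the sections
   over the empty set, as defined by [sections], would not be zero. *)
Definition open_cover (F : fieldType) (X : set (set F)) (I : Type)
    (U : I -> set (set F)) : Prop :=
  (forall i, zariski_open X (U i) /\ U i !=set0) /\ X = \bigcup_i U i.

Definition sections (P F : Type) (U : set P) (S : P -> set F) : set F :=
  [set a | forall R, U R -> S R a].

(* H^1 is the first Cech cohomology group, i.e. the direct limit over all open
   covers and refinements, which is the sheaf cohomology group in degree 1 on
   every topological space. It vanishes when each cocycle becomes a coboundary
   after a refinement. *)
Definition H1_vanishes (F : fieldType) (X : set (set F))
    (S : set F -> set F) : Prop :=
  forall (I : Type) (U : I -> set (set F)) (a : I -> I -> F),
    open_cover X U ->
    (forall i j, sections (U i `&` U j) S (a i j)) ->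
    (forall i j l, a i j + a j l = a i l) ->
    exists (J : Type) (V : J -> set (set F)) (r : J -> I) (b : J -> F),
      [/\ open_cover X V, (forall i, V i `<=` U (r i)),
          (forall i, sections (V i) S (b i)) &
          forall i j, a (r i) (r j) = b j - b i].

Definition is_submodule (F : fieldType) (R M : set F) : Prop :=
  [/\ M 0, (forall a b, M a -> M b -> M (a + b)) &
      forall r a, R r -> M a -> M (r * a)].

Definition span (F : fieldType) (R S : set F) : set F :=
  smallest (is_submodule R) S.

(* For rank one modules inside a field the tensor product is the product. *)
Definition tensor (F : fieldType) (R M N : set F) : set F :=
  span R [set c | exists a b, [/\ M a, N b & c = a * b]].

(* The n-th tensor power (n may be negative) of a free module R g of rank one
   is R g^n; it does not depend on the generator. *)
Definition tpow (F : fieldType) (R M : set F) (n : int) : set F :=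
  [set x | exists g, [/\ g != 0, M = [set r * g | r in R] &
             exists2 r, R r & x = r * g ^ n]].

Definition alg_indep2 (k K : fieldType) (iota : {rmorphism k -> K}) (u v : K) :
    Prop :=
  forall q : {poly {poly k}}, q != 0 ->
    (map_poly (fun c => (map_poly iota c).[u]) q).[v] != 0.

Definition trdeg_one (k K : fieldType) (iota : {rmorphism k -> K}) : Prop :=
  (exists t, ~ algebraicOver iota t) /\
  forall u v : K, ~ alg_indep2 iota u v.

(* The subvariety of projective space whose homogeneous coordinates are
   x_0 : ... : x_m (those vanishing identically being omitted) has the affine
   charts Spec k[x_0/x_i, ..., x_m/x_i]. Its function field is K when K is one
   of its local rings. *)
Definition projective_variety (k K : fieldType) (iota : {rmorphism k -> K})
    (C : set (set K)) : Prop :=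
  C setT /\
  exists (m : nat) (x : 'I_m.+1 -> K), (forall i, x i != 0) /\
    C = \bigcup_i spec (gen_subring (range iota `|` range (fun j => x j / x i))).

(* Regularity of a local ring of dimension at most one: the maximal ideal is
   principal (and it is 0 at the generic point). *)
Definition smooth_projective_curve (k K : fieldType)
    (iota : {rmorphism k -> K}) (C : set (set K)) : Prop :=
  [/\ trdeg_one iota, projective_variety iota C &
      forall R, C R -> exists t, max_ideal R = [set r * t | r in R]].

Definition closed_points (K : fieldType) (C : set (set K)) : set (set K) :=
  [set R | C R /\ R <> setT].

Definition uniformizer (K : fieldType) (R : set K) (t : K) : Prop :=
  t != 0 /\ max_ideal R = [set r * t | r in R].

Definition is_divisor (K : fieldType) (C : set (set K)) (D : set K -> int) :
    Prop :=
  finite_set [set R | closed_points C R /\ D R != 0].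

(* All residue fields are k, which is algebraically closed. *)
Definition degree (K : fieldType) (C : set (set K)) (D : set K -> int) : int :=
  \sum_(R \in closed_points C) D R.

(* The stalk of O_C(D); it is K at the generic point. *)
Definition O_ (K : fieldType) (D : set K -> int) (R : set K) : set K :=
  [set a | R = setT \/
     exists t r, [/\ uniformizer R t, R r & a = r * t ^ (- D R)]].

Definition derivation (k K : fieldType) (iota : {rmorphism k -> K})
    (d : K -> K) : Prop :=
  [/\ (forall a b, d (a + b) = d a + d b),
      (forall a b, d (a * b) = a * d b + b * d a) &
      forall c, d (iota c) = 0].

(* Omega_{K/k} is finite dimensional over K with dual the space of
   k-derivations of K, so that its elements are represented by functionals on
   derivations. *)
Definition form (K : fieldType) := (K -> K) -> K.

Definition eq_form (k K : fieldType) (iota : {rmorphism k -> K})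
    (w w' : form K) : Prop :=
  forall d, derivation iota d -> w d = w' d.

Definition adb (K : fieldType) (a b : K) : form K := fun d => a * d b.

(* The order of w at the closed point R is at least n: w = a dt with t a
   uniformizer at R and a of order at least n. *)
Definition order_ge (k K : fieldType) (iota : {rmorphism k -> K})
    (R : set K) (n : int) (w : form K) : Prop :=
  exists t r, [/\ uniformizer R t, R r & eq_form iota w (adb (r * t ^ n) t)].

Definition regular_form (k K : fieldType) (iota : {rmorphism k -> K})
    (C : set (set K)) (w : form K) : Prop :=
  forall R, closed_points C R -> order_ge iota R 0 w.

Definition has_genus (k K : fieldType) (iota : {rmorphism k -> K})
    (C : set (set K)) (g : nat) : Prop :=
  exists w : 'I_g -> form K,
    [/\ (forall i, regular_form iota C (w i)),
        (forall c : 'I_g -> k,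
           eq_form iota (fun d => \sum_i iota (c i) * w i d) (fun=> 0) ->
           forall i, c i = 0) &
        forall u, regular_form iota C u -> exists c : 'I_g -> k,
           eq_form iota u (fun d => \sum_i iota (c i) * w i d)].

Definition pre_tango (k K : fieldType) (iota : {rmorphism k -> K})
    (C : set (set K)) (p : nat) (D : set K -> int) (f0 : K) : Prop :=
  [/\ is_divisor C D, 0 < degree C D, (forall u, f0 <> u ^+ p) &
      forall R, closed_points C R -> order_ge iota R (p%:Z * D R) (adb 1 f0)].

(* The cocycle x represents eta(df0) in H^1(C, L^-1): over U i, the section df0
   of B^1 (x) L^-1 lifts to a section g i of F_*O_C (x) L^-1 = F_*(L^-p), and
   L^-1 is embedded in F_*(L^-p) by the p-th power map. *)
Definition represents_eta (k K : fieldType) (iota : {rmorphism k -> K})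
    (p : nat) (D : set K -> int) (f0 : K)
    (I : Type) (U : I -> set (set K)) (x : I -> I -> K) : Prop :=
  exists g : I -> K,
    [/\ (forall i, sections (U i) (fun R => tpow R (O_ D R) (- p%:Z)) (g i)),
        (forall i, eq_form iota (adb 1 (g i)) (adb 1 f0)) &
        forall i i', x i i' ^+ p = g i' - g i].

(* The generic stalk of E is the K-space with basis s (the image of 1) and y (a
   lift of 1 in K, the generic stalk of L = O_C(D)), embedded in the field Om,
   where s and y will be algebraically independent over K, so that Om contains
   the symmetric algebra of this stalk. Over U i the sequence
   0 -> O_C -> E -> L -> 0 is split by the lift y + a i s of 1, whence
   E = O_C s + L (y + a i s); the class of the extension is represented by the
   differences of these splittings. *)
Definition represents_extension (K Om : fieldType) (j : {rmorphism K -> Om})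
    (s y : Om) (D : set K -> int) (E : set K -> set Om)
    (I : Type) (U : I -> set (set K)) (x : I -> I -> K) : Prop :=
  exists a : I -> K,
    (forall i R, U i R ->
       E R = [set w | exists u v, [/\ R u, O_ D R v &
                        w = j u * s + j v * (y + j (a i) * s)]]) /\
    (forall i i', x i i' = a i' - a i).

Definition tango_extension (k K Om : fieldType) (iota : {rmorphism k -> K})
    (j : {rmorphism K -> Om}) (C : set (set K)) (p : nat) (D : set K -> int)
    (f0 : K) (s y : Om) (E : set K -> set Om) : Prop :=
  exists (I : Type) (U : I -> set (set K)) (x : I -> I -> K),
    [/\ open_cover C U, represents_eta iota p D f0 U x &
        represents_extension j s y D E U x].

(* Over the local scheme of R, P is covered by the open sets D_+(e) for e in
   E R, with coordinate ring generated over R by the w / e, w in E R. *)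
Definition proj_bundle (K Om : fieldType) (j : {rmorphism K -> Om})
    (C : set (set K)) (E : set K -> set Om) : set (set Om) :=
  [set Q | exists R e, [/\ C R, E R e, e != 0 &
     spec (gen_subring ((j @` R) `|` [set w / e | w in E R])) Q]].

Definition proj_pt (K Om : fieldType) (j : {rmorphism K -> Om}) (Q : set Om) :
    set K := j @^-1` Q.

Definition pullback (K Om : fieldType) (j : {rmorphism K -> Om})
    (N : set K -> set K) (Q : set Om) : set Om :=
  span Q (j @` N (proj_pt j Q)).

(* The sheaf O(1), homogeneous of degree 1: the image of the pullback of E. For
   a point Q of the cover X of P the same formula gives the pullback of O_P(1)
   to X. *)
Definition O1 (K Om : fieldType) (j : {rmorphism K -> Om})
    (E : set K -> set Om) (Q : set Om) : set Om :=
  span Q (E (proj_pt j Q)).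

(* F^*E is identified with its image in the p-th symmetric power of E by
   1 (x) w |-> w^p. *)
Definition frobenius_pullback (K Om : fieldType) (j : {rmorphism K -> Om})
    (p : nat) (E : set K -> set Om) (R : set K) : set Om :=
  span (j @` R) [set w ^+ p | w in E R].

(* theta is the image of 1 under a splitting L^p -> F^*E of
   0 -> O_C -> F^*E -> L^p -> 0, equivalently under the resulting map
   O_C -> F^*E (x) L^-p. As 1 (x) w is mapped to w^p, which is also the
   relative Frobenius on fibre coordinates, theta, seen as a section of
   O_P(p) (x) L^-p, is the equation of C''. *)
Definition frobenius_splitting (K Om : fieldType) (j : {rmorphism K -> Om})
    (C : set (set K)) (p : nat) (D : set K -> int) (E : set K -> set Om)
    (s y theta : Om) : Prop :=
  (exists a : K, theta = y ^+ p + j a * s ^+ p) /\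
  forall R, C R -> forall b, tpow R (O_ D R) p%:Z b ->
    frobenius_pullback j p E R (j b * theta).

(* N_l = N^(e/l), with N = O_C(B). *)
Definition N_ell (K : fieldType) (B : set K -> int) (e l : nat) (R : set K) :
    set K :=
  tpow R (O_ B R) (e %/ l)%N%:Z.

(* M = O_P(-(p+1)/l) (x) pi^* N_l^p *)
Definition M_sheaf (K Om : fieldType) (j : {rmorphism K -> Om})
    (p e l : nat) (B : set K -> int) (E : set K -> set Om) (Q : set Om) :
    set Om :=
  tensor Q (tpow Q (O1 j E Q) (- (p.+1 %/ l)%N%:Z))
           (pullback j (fun R => tpow R (N_ell B e l R) p%:Z) Q).

(* The stalk at Q of the algebra (+)_(i < l) M^i, m in M^i being written
   m zeta^i. When zeta^l is the section of M^-l defining E + C'', the product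
   in Om is that of this algebra; the sum is direct, E + C'' being reduced. *)
Definition cover_algebra (K Om : fieldType) (j : {rmorphism K -> Om})
    (p e l : nat) (B : set K -> int) (E : set K -> set Om) (zeta : Om)
    (Q : set Om) : set Om :=
  [set x | exists m : 'I_l -> Om,
     (forall i : 'I_l, tpow Q (M_sheaf j p e l B E Q) (i : nat)%:Z (m i)) /\
     x = \sum_(i < l) m i * zeta ^+ i].

Definition raynaud_surface (K Om : fieldType) (j : {rmorphism K -> Om})
    (C : set (set K)) (p e l : nat) (B : set K -> int) (E : set K -> set Om)
    (zeta : Om) : set (set Om) :=
  [set R | exists2 Q, proj_bundle j C E Q &
                      spec (cover_algebra j p e l B E zeta Q) R].

(* The divisor of the section s of O_P(1) is E, so s O_P(-1) is its ideal, and
   the radical of the ideal it generates on X is the ideal of the reduced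
   preimage of E. *)
Definition Etilde_ideal (K Om : fieldType) (j : {rmorphism K -> Om})
    (E : set K -> set Om) (s : Om) (R : set Om) : set Om :=
  [set a | R a /\
     exists n : nat, [set s * b | b in tpow R (O1 j E R) (-1)] (a ^+ n)].

(* Z = O_X(Etilde) (x) phi^* N_l *)
Definition polarization (K Om : fieldType) (j : {rmorphism K -> Om})
    (e l : nat) (B : set K -> int) (E : set K -> set Om) (s : Om)
    (R : set Om) : set Om :=
  tensor R (tpow R (Etilde_ideal j E s R) (-1)) (pullback j (N_ell B e l) R).

(* Main.v *)
Require Import Defs.
From mathcomp Require Import ring lra zify.

(* A 1-cocycle for Z^-m (m > 0) is a family c_i in the function field of X whose
   differences are sections of Z^-m. Over the local ring R of a point of C, X is
   the union of the affine chart R[v, w] with w^l = v^p + beta, the complement of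
   the section E~ at infinity, and the local ring at the point of E~. Vanishing on
   affine schemes reduces the cocycle to a Laurent tail along E~. Its leading
   coefficient in order n can be removed by a monomial of R[v, w] when -n lies in
   the semigroup generated by p and l; otherwise it is a global section of
   N_l^-(m + n) on C, hence zero when m + n > 0. For p = 2, 3 this leaves only
   p = 3, l = 4, n = -5, where a nonzero coefficient would make the splitting
   constant a cube and hence df0 = 0. Once the tail is gone, the local corrections
   agree, because K[v, w] has no nonzero element of positive order along E~.
   Negative sheaves on C have no sections because multiplication by a function
   embeds one space L(A) in another, which bounds the degree of its divisor. *)

Set Implicit Arguments.
Unset Strict Implicit.
Unset Printing Implicit Defensive.
Import Order.TTheory GRing.Theory Num.Theory.

(** * Subrings of a field and spectra *)

(** With n = -m, the numerical bound says m >= 2 for (p, l) = (2, 3), (3, 2) and m >= 3 for (3, 4).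
    The gaps of the semigroup are {1}, {1} and {1, 2, 5}, so 5 is the only gap that m may fail to
    exceed.

    At order -5 one coefficient alone is not a section of a negative sheaf. Another choice of local
    splitting alpha multiplies the parameter along E~ by a constant and by a unit that is 1 up to
    order l = 4. So it changes the coefficient in order -1 by 5 h alpha times the one in order -5.
    In characteristic 3 the cube of the former plus h^3 a times the cube of the latter, a being the
    splitting constant, no longer depends on alpha. It is a section of a negative power of N, hence
    zero, and this makes a a cube as soon as the coefficient in order -5 is nonzero.

    Coefficients found over different points of C are compared in K, so every local chart is
    embedded in the chart over the generic point. No completion is used: each order is split off
    exactly, as a constant plus a multiple of the parameter. Forms being functionals on derivations,
    df0 <> 0 requires an actual derivation that does not kill f0. *)

Section Subrings.
Variables (F : fieldType).
Implicit Types (A B Q S q I : set F).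

Lemma is_subringP A : is_subring A <->
  [/\ A 1, forall x y, A x -> A y -> A (x - y) &
      forall x y, A x -> A y -> A (x * y)].
Proof.
split=> [[/set_mem h1 hB hM]|[h1 hB hM]]; split=> //.
- by move=> x y /mem_set hx /mem_set hy; apply/set_mem/hB.
- by move=> x y /mem_set hx /mem_set hy; apply/set_mem/hM.
- exact/mem_set.
- by move=> x y /set_mem hx /set_mem hy; apply/mem_set/hB.
- by move=> x y /set_mem hx /set_mem hy; apply/mem_set/hM.
Qed.

Section SubringTheory.
Variables (A : set F) (hA : is_subring A).

Lemma subring1 : A 1. Proof. by case/is_subringP: hA. Qed.
Lemma subringB x y : A x -> A y -> A (x - y).
Proof. by case/is_subringP: hA => _ + _; exact. Qed.
Lemma subringM x y : A x -> A y -> A (x * y).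
Proof. by case/is_subringP: hA => _ _; exact. Qed.
Lemma subring0 : A 0.
Proof. by rewrite -(subrr 1); apply: subringB subring1 subring1. Qed.
Lemma subringN x : A x -> A (- x).
Proof. by move=> hx; rewrite -sub0r; apply: subringB subring0 hx. Qed.
Lemma subringD x y : A x -> A y -> A (x + y).
Proof. by move=> hx hy; rewrite -(opprK y); apply/subringB/subringN. Qed.
Lemma subringX x n : A x -> A (x ^+ n).
Proof.
move=> hx; elim: n => [|n IH]; first exact: subring1.
by rewrite exprS; apply: subringM.
Qed.
Lemma subring_sum (I : Type) (r : seq I) (P : pred I) (f : I -> F) :
  (forall i, P i -> A (f i)) -> A (\sum_(i <- r | P i) f i).
Proof. by move=> h; elim/big_ind: _ => //; [exact: subring0|exact: subringD]. Qed.
Lemma subring_nat n : A n%:R.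
Proof.
elim: n => [|n IH]; first exact: subring0.
by rewrite -natr1; apply: subringD IH subring1.
Qed.

(** By Zorn's lemma there is an ideal maximal among those that contain I and no power of s. It is
    prime: if a and b lie outside, a power of s lies in the ideal enlarged by a and another in the
    ideal enlarged by b, and their product falls back into the ideal when ab does. *)
Lemma prime_ideal_avoiding I s : is_submodule A I -> I `<=` A -> A s ->
  (forall n, ~ I (s ^+ n)) ->
  exists q, [/\ prime_ideal_of A q, I `<=` q & ~ q s].
Proof.
move=> [I0 ID IM] IA As Is.
(* The union with I makes the empty chain harmless: its union stands for I itself. *)
pose P X := [/\ is_submodule A (X `|` I), X `|` I `<=` A &
                forall n, ~ (X `|` I) (s ^+ n)].
have [F0 FP Ftot|X [[[X0 XD XM] XA Xs] Xmax]] := @Zorn_bigcup F P.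
  split; first split.
  - by right.
  - move=> a b [[X FX Xa]|Ia] [[Y FY Yb]|Ib].
    + have [XY|YX] := Ftot _ _ FX FY.
        have [[_ YD _] _ _] := FP _ FY.
        have [h|h] := YD a b (or_introl (XY _ Xa)) (or_introl Yb);
          [by left; exists Y|by right].
      have [[_ XD _] _ _] := FP _ FX.
      have [h|h] := XD a b (or_introl Xa) (or_introl (YX _ Yb));
        [by left; exists X|by right].
    + have [[_ XD _] _ _] := FP _ FX.
      have [h|h] := XD a b (or_introl Xa) (or_intror Ib);
        [by left; exists X|by right].
    + have [[_ XD _] _ _] := FP _ FY.
      have [h|h] := XD a b (or_intror Ia) (or_introl Yb);
        [by left; exists Y|by right].
    + by right; apply: ID.
  - move=> r a Ar [[X FX Xa]|Ia]; last by right; apply: IM.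
    have [[_ _ XM] _ _] := FP _ FX.
    have [h|h] := XM r a Ar (or_introl Xa); [by left; exists X|by right].
  - move=> a [[X FX Xa]|Ia]; last exact: IA.
    by have [_ h _] := FP _ FX; apply: h; left.
  - move=> n [[X FX Xa]|Ia]; last exact: (Is n).
    by have [_ _ h] := FP _ FX; apply: (h n); left.
have key a : A a -> ~ (X `|` I) a ->
    exists n x c, [/\ (X `|` I) x, A c & s ^+ n = x + a * c].
  move=> Aa Xa; apply: contrapT => hn.
  pose B := [set z | exists x c, [/\ (X `|` I) x, A c & z = x + a * c]].
  have XB : X `|` I `<=` B.
    move=> x Xx; exists x, 0; split=> //; first exact: subring0.
    by rewrite mulr0 addr0.
  have Ba : B a.
    by exists 0, 1; split=> //; [exact: subring1|rewrite add0r mulr1].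
  have BI : B `|` I = B.
    by apply/seteqP; split=> x; [case=> // Ix; apply: XB; right|left].
  apply: (Xmax B).
    split=> [x Xx|BX]; first by apply: XB; left.
    by apply: Xa; left; apply: BX.
  rewrite /P BI; split; first split.
  - exact: XB.
  - move=> _ _ [x [c [hx hc ->]]] [y [d [hy hd ->]]].
    exists (x + y), (c + d); split; [exact: XD|exact: subringD|ring].
  - move=> r _ hr [x [c [hx hc ->]]]; exists (r * x), (r * c).
    split; [exact: XM|exact: subringM|ring].
  - move=> _ [x [c [hx hc ->]]].
    by apply: subringD (subringM Aa hc); apply: XA.
  - by move=> n [x [c [hx hc e]]]; apply: hn; exists n, x, c.
exists (X `|` I); split; last 2 first.
- by move=> x; right.
- by have := Xs 1%N; rewrite expr1.
split=> //; split; first by have := Xs 0%N; rewrite expr0.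
move=> a b Aa Ab hab; apply: contrapT => /not_orP[na nb].
have [n [x [c [hx hc en]]]] := key _ Aa na.
have [m [y [d [hy hd em]]]] := key _ Ab nb.
apply: (Xs (n + m)%N); rewrite exprD en em.
have -> : (x + a * c) * (y + b * d) =
  (y + b * d) * x + (a * c * y + c * d * (a * b)) by ring.
have Ay := XA _ hy; apply: (XD); first apply: (XM) => //.
  by apply: subringD => //; apply: subringM.
by apply: (XD); apply: (XM) => //; apply: subringM.
Qed.

Lemma prime_ideal_containing I : is_submodule A I -> I `<=` A -> ~ I 1 ->
  exists2 q, prime_ideal_of A q & I `<=` q.
Proof.
move=> hI IA I1; have [|q [hq Iq _]] := prime_ideal_avoiding hI IA subring1.
  by move=> n; rewrite expr1n.
by exists q.
Qed.

End SubringTheory.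

Lemma gen_subring_subring S : is_subring (gen_subring S).
Proof.
apply/is_subringP; split.
- by move=> B [/is_subringP[]].
- move=> x y hx hy B hB; have [/is_subringP[_ h _] _] := hB.
  by apply: h; [exact: hx|exact: hy].
- move=> x y hx hy B hB; have [/is_subringP[_ _ h] _] := hB.
  by apply: h; [exact: hx|exact: hy].
Qed.

Lemma gen_subring_sub S : S `<=` gen_subring S.
Proof. by move=> x Sx B [_]; exact. Qed.

Lemma gen_subring_min S B : is_subring B -> S `<=` B -> gen_subring S `<=` B.
Proof. by move=> hB SB x; exact. Qed.

(* An intrinsic description of the members of [spec A] that does not mention the
   prime ideal, which is the trace on [A] of the maximal ideal. *)
Definition local_over A Q := [/\ is_subring Q,
  forall x y, max_ideal Q x -> max_ideal Q y -> max_ideal Q (x + y),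
  A `<=` Q &
  forall z, Q z -> exists a b, [/\ A a, A b, b != 0, Q b^-1 & z = a / b]].

Lemma spec_local_over A Q : is_subring A -> spec A Q -> local_over A Q.
Proof.
move=> hA [q [qA q0 qD qM [q1 qP]] ->].
have nz b : ~ q b -> b != 0 by apply: contra_notN => /eqP->.
have A1 := subring1 hA.
have inv b : A b -> ~ q b -> localization A q b^-1.
  by move=> Ab nb; exists 1, b; split=> //; rewrite div1r.
have nM a b : A a -> A b -> ~ q a -> ~ q b -> ~ q (a * b).
  by move=> Aa Ab na nb /qP[].
have maxE x : max_ideal (localization A q) x <->
   exists a b, [/\ q a, A b, ~ q b & x = a / b].
  split=> [[[a [b [Aa Ab nb ->]]]]|[a [b [qa Ab nb ->]]]].
    case=> [/eqP|hn].
      rewrite mulf_eq0 invr_eq0 (negPf (nz _ nb)) orbF => /eqP->.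
      by exists 0, b; split.
    exists a, b; split=> //; apply: contrapT => na; apply: hn.
    by exists b, a; split=> //; rewrite invf_div.
  split; first by exists a, b; split=> //; exact: qA.
  have [->|a0] := eqVneq a 0; [by left; rewrite mul0r|right].
  move=> [c [d [Ac Ad nd]]]; rewrite invf_div => /eqP.
  rewrite eqr_div ?a0 ?(nz d) // => /eqP e.
  suff: q (d * b) by case/qP.
  by rewrite mulrC e; apply: qM.
split.
- apply/is_subringP; split.
  + by exists 1, 1; split=> //; rewrite divr1.
  + move=> _ _ [a [b [Aa Ab nb ->]]] [c [d [Ac Ad nd ->]]].
    exists (a * d - c * b), (b * d); split; last by field; rewrite !nz.
    * by apply: subringB => //; apply: subringM.
    * exact: subringM.
    * exact: nM.
  + move=> _ _ [a [b [Aa Ab nb ->]]] [c [d [Ac Ad nd ->]]].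
    exists (a * c), (b * d); split; last by field; rewrite !nz.
    * exact: subringM.
    * exact: subringM.
    * exact: nM.
- move=> _ _ /maxE[a [b [qa Ab nb ->]]] /maxE[c [d [qc Ad nd ->]]].
  apply/maxE; exists (d * a + b * c), (b * d); split; last by field; rewrite !nz.
  + by apply: qD; apply: qM.
  + exact: subringM.
  + exact: nM.
- by move=> a Aa; exists a, 1; split=> //; rewrite divr1.
- by move=> _ [a [b [Aa Ab nb ->]]]; exists a, b; split; rewrite ?nz //; exact: inv.
Qed.

Section LocalRings.
Variables (Q : set F) (hQ : is_subring Q)
  (hloc : forall x y, max_ideal Q x -> max_ideal Q y -> max_ideal Q (x + y)).

Lemma max_ideal0 : max_ideal Q 0.
Proof. by split; [exact: subring0|left]. Qed.

Lemma max_idealM a x : Q a -> max_ideal Q x -> max_ideal Q (a * x).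
Proof.
move=> Qa [Qx hx]; split; first exact: subringM.
have [->|x0] := eqVneq x 0; [by left; rewrite mulr0|].
have [->|a0] := eqVneq a 0; [by left; rewrite mul0r|right].
case: hx => [/eqP|hx h]; first by rewrite (negPf x0).
apply: hx; have -> : x^-1 = a * (a * x)^-1 by field; rewrite a0 x0.
exact: subringM.
Qed.

Lemma max_idealN x : max_ideal Q x -> max_ideal Q (- x).
Proof.
by rewrite -mulN1r; apply: max_idealM; apply: subringN => //; exact: subring1.
Qed.

Lemma max_ideal1 : ~ max_ideal Q 1.
Proof.
by case=> _ [/eqP|]; [rewrite oner_eq0|rewrite invr1; case; exact: subring1].
Qed.

Lemma not_max_idealP x : Q x -> ~ max_ideal Q x <-> x != 0 /\ Q x^-1.
Proof.
move=> Qx; split=> [h|[x0 Qi] [_ [/eqP|//]]]; last by rewrite (negPf x0).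
split; first by apply: contra_notN h => /eqP->; exact: max_ideal0.
by apply: contrapT => hi; apply: h; split=> //; right.
Qed.

Lemma unit_add_max x y : x != 0 -> Q x -> Q x^-1 -> max_ideal Q y ->
  x + y != 0 /\ Q (x + y)^-1.
Proof.
move=> x0 Qx Qi hy; apply/not_max_idealP; first by apply: subringD => //; case: hy.
move=> h; suff : max_ideal Q x by case=> _ [/eqP|//]; rewrite (negPf x0).
by rewrite -(addrK y x); apply: hloc => //; exact: max_idealN.
Qed.

Lemma max_ideal_primeM x y : Q x -> Q y -> max_ideal Q (x * y) ->
  max_ideal Q x \/ max_ideal Q y.
Proof.
move=> Qx Qy h; apply: contrapT => /not_orP[].
move=> /not_max_idealP[]// x0 Qxi /not_max_idealP[]// y0 Qyi.
by move: h; apply/not_max_idealP; [exact: subringM|split];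
  rewrite ?mulf_neq0 // invfM; exact: subringM.
Qed.

Lemma max_ideal_rootX x n : Q x -> max_ideal Q (x ^+ n) -> max_ideal Q x.
Proof.
move=> Qx; elim: n => [|n IH]; first by rewrite expr0 => /max_ideal1.
rewrite exprS => /max_ideal_primeM[]//; exact: subringX.
Qed.

End LocalRings.

Lemma local_over_spec A Q : is_subring A -> local_over A Q -> spec A Q.
Proof.
move=> hA [hQ hloc AQ hf]; exists (A `&` max_ideal Q).
  split.
  - by move=> x [].
  - by split; [exact: subring0|exact: max_ideal0].
  - by move=> a b [Aa ma] [Ab mb]; split; [exact: subringD|exact: hloc].
  - by move=> a b Aa [Ab mb]; split; [exact: subringM|apply: max_idealM => //; exact: AQ].
  - split; first by move=> [_ /max_ideal1].
    move=> a b Aa Ab [_ hab].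
    by have [||ma|mb] := max_ideal_primeM hQ _ _ hab;
      [exact: AQ|exact: AQ|left|right].
apply/seteqP; split=> z.
  move=> /hf[a [b [Aa Ab b0 Qb ->]]]; exists a, b; split=> //; case=> _.
  by apply/(not_max_idealP hQ (AQ _ Ab)).
move=> [a [b [Aa Ab nb ->]]].
apply: (subringM hQ); first exact: AQ.
have [|b0 //] := (not_max_idealP hQ (AQ _ Ab)).1.
by move=> h; apply: nb.
Qed.

(** For Q local and containing A, this is the localization of A at the trace of the maximal ideal of
    Q, that is, the image of the point Q in Spec A. *)
Definition fractions_at A Q :=
  [set z | exists a b, [/\ A a, A b, b != 0, Q b^-1 & z = a / b]].

Lemma fractions_at_subring A Q : is_subring A -> is_subring Q ->
  is_subring (fractions_at A Q).
Proof.
move=> hA hQ; apply/is_subringP; split.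
- by exists 1, 1; rewrite divr1 invr1 oner_neq0; split=> //; exact: subring1.
- move=> _ _ [a [b [Aa Ab b0 Qb ->]]] [c [d [Ac Ad d0 Qd ->]]].
  exists (a * d - c * b), (b * d); split; last by field; rewrite b0 d0.
  + by apply: subringB => //; apply: subringM.
  + exact: subringM.
  + exact: mulf_neq0.
  + by rewrite invfM; exact: subringM.
- move=> _ _ [a [b [Aa Ab b0 Qb ->]]] [c [d [Ac Ad d0 Qd ->]]].
  exists (a * c), (b * d); split; last by field; rewrite b0 d0.
  + exact: subringM.
  + exact: subringM.
  + exact: mulf_neq0.
  + by rewrite invfM; exact: subringM.
Qed.

Lemma fractions_at_sub A Q : is_subring Q -> A 1 -> A `<=` fractions_at A Q.
Proof.
move=> hQ A1 a Aa; exists a, 1; rewrite divr1 invr1 oner_neq0.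
by split=> //; exact: subring1.
Qed.

Lemma fractions_at_div A Q a b : A a -> A b -> b != 0 -> Q b^-1 ->
  fractions_at A Q (a / b).
Proof. by move=> Aa Ab b0 Qb; exists a, b. Qed.

(** A fraction of elements of B becomes one of elements of A after clearing two denominators, both
    invertible in Q. Every passage of a point from one chart to another goes through this lemma. *)
Lemma local_over_change A B Q : is_subring A -> A `<=` Q -> local_over B Q ->
  B `<=` fractions_at A Q -> local_over A Q.
Proof.
move=> hA AQ [hQ hloc _ hf] BA; split=> // z /hf[a [b [Ba Bb b0 Qb ->]]].
have [a1 [a2 [Aa1 Aa2 a20 Qa2 ea]]] := BA _ Ba.
have [b1 [b2 [Ab1 Ab2 b20 Qb2 eb]]] := BA _ Bb.
have b10 : b1 != 0 by apply: contraNneq b0; rewrite eb => ->; rewrite mul0r.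
exists (a1 * b2), (a2 * b1); split.
- exact: subringM.
- exact: subringM.
- exact: mulf_neq0.
- have -> : (a2 * b1)^-1 = a2^-1 * (b2^-1 * b^-1).
    by rewrite eb; field; rewrite a20 b20 b10.
  by apply: subringM => //; apply: subringM.
- by rewrite ea eb; field; rewrite a20 b20 b10.
Qed.

Lemma fractions_at_local A Q : is_subring A -> is_subring Q ->
  (forall x y, max_ideal Q x -> max_ideal Q y -> max_ideal Q (x + y)) ->
  A `<=` Q -> local_over A (fractions_at A Q).
Proof.
move=> hA hQ hloc AQ.
have hf := fractions_at_subring hA hQ.
have AF := fractions_at_sub hQ (subring1 hA).
have FQ : fractions_at A Q `<=` Q.
  by move=> _ [a [b [Aa Ab b0 Qb ->]]]; apply: subringM => //; exact: AQ.
have maxE x : max_ideal (fractions_at A Q) x <->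
    fractions_at A Q x /\ max_ideal Q x.
  split=> [[Fx hx]|[Fx [Qx hx]]]; split=> //.
    split; first exact: FQ.
    case: hx => [->|hx]; [by left|].
    have [->|x0] := eqVneq x 0; [by left|right] => Qi; apply: hx.
    move: Fx => [a [b [Aa Ab b0 Qb e]]]; rewrite e invf_div.
    have a0 : a != 0 by apply: contraNneq x0; rewrite e => ->; rewrite mul0r.
    apply: fractions_at_div => //.
    have -> : a^-1 = b^-1 * x^-1 by rewrite e; field; rewrite a0 b0.
    exact: subringM.
  by case: hx => [->|hx]; [left|right => /FQ].
split=> //.
- move=> x y /maxE[Fx mx] /maxE[Fy my]; apply/maxE.
  by split; [exact: subringD|exact: hloc].
- move=> z [a [b [Aa Ab b0 Qb ->]]]; exists a, b; split=> //.
  by rewrite -div1r; exact: (fractions_at_div (subring1 hA)).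
Qed.

End Subrings.

(** * Affine vanishing *)

Section Affine.
Variables (F : fieldType) (A : set F) (hA : is_subring A).

Lemma spec_localization q : prime_ideal_of A q -> spec A (localization A q).
Proof. by move=> hq; exists q. Qed.

Lemma localization_inv q b : prime_ideal_of A q -> A b -> ~ q b ->
  localization A q b^-1.
Proof. by move=> hq Ab qb; exists 1, b; rewrite div1r; split=> //; exact: subring1. Qed.

Lemma prime_ideal_neq0 q b : prime_ideal_of A q -> ~ q b -> b != 0.
Proof. by move=> [_ q0 _ _ _]; apply: contra_notN => /eqP->. Qed.

(** If the ideal of denominators of f contained no power of a, it would lie in a prime ideal
    avoiding a, and f would have a denominator outside that prime ideal. *)
Lemma sections_basic_open a f : A a -> a != 0 ->
  (forall Q, spec A Q -> Q a^-1 -> Q f) -> exists N, A (a ^+ N * f).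
Proof.
move=> Aa a0 hf; apply: contrapT => hN.
pose I b := A b /\ A (b * f).
have [|b []//||n|q [hq Iq qa]] := @prime_ideal_avoiding _ _ hA I a.
- split.
  + by split; rewrite ?mul0r; exact: subring0.
  + by move=> x y [Ax Ix] [Ay Iy]; split; rewrite ?mulrDl; exact: subringD.
  + by move=> r x Ar [Ax Ix]; split; rewrite -?mulrA; exact: subringM.
- exact: Aa.
- by case=> _ h; apply: hN; exists n.
have [c [d [Ac Ad qd e]]] :=
  hf _ (spec_localization hq) (localization_inv hq Aa qa).
apply: (qd); apply: Iq; split=> //.
by rewrite e mulrC divfK // (prime_ideal_neq0 hq).
Qed.

Lemma sections_affine f : (forall Q, spec A Q -> Q f) -> A f.
Proof.
move=> hf; have [||N] := @sections_basic_open 1 f (subring1 hA).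
- exact: oner_neq0.
- by move=> Q hQ _; exact: hf.
- by rewrite expr1n mul1r.
Qed.

(** In each term of the binomial expansion one of the two exponents is at least N. This replaces a
    partition of unity when data on the basic open sets of a and b are glued on that of a + b. *)
Lemma expD_mem_pair a b N : A a -> A b ->
  exists c d, [/\ A c, A d & (a + b) ^+ (N + N) = c * a ^+ N + d * b ^+ N].
Proof.
move=> Aa Ab; rewrite exprDn; elim/big_ind: _ => [||i _].
- by exists 0, 0; rewrite !mul0r addr0; split=> //; exact: subring0.
- move=> _ _ [c [d [Ac Ad ->]]] [c' [d' [Ac' Ad' ->]]].
  by exists (c + c'), (d + d'); split; [exact: subringD|exact: subringD|ring].
- have [hi|hi] := leqP N i.
  + exists 0, (a ^+ (N + N - i) * b ^+ (i - N) * 'C(N + N, i)%:R); split.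
    * exact: subring0.
    * by do !apply: subringM => //; [exact: subringX|exact: subringX|exact: subring_nat].
    * by rewrite mul0r add0r -mulr_natr -{2}(subnK hi) exprD; ring.
  + have hi' : (N <= N + N - i)%N by lia.
    exists (a ^+ (N + N - i - N) * b ^+ i * 'C(N + N, i)%:R), 0; split.
    * by do !apply: subringM => //; [exact: subringX|exact: subringX|exact: subring_nat].
    * exact: subring0.
    * by rewrite mul0r addr0 -mulr_natr -{1}(subnK hi') exprD; ring.
Qed.

(* The elements of [A] over whose basic open set the local data [c i] glue form
   an ideal, which lies in no prime ideal. *)
Lemma affine_H1_vanishes (I : Type) (U : I -> set (set F)) (c : I -> F) :
  (forall Q, spec A Q -> exists i, U i Q) ->
  (forall i Q, spec A Q -> U i Q -> exists fs : seq F,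
     {in fs, forall f, Q f} /\
     forall Q', spec A Q' -> {in fs, forall f, Q' f} -> U i Q') ->
  (forall i i' Q, spec A Q -> U i Q -> U i' Q -> Q (c i - c i')) ->
  exists c0, forall i Q, spec A Q -> U i Q -> Q (c0 - c i).
Proof.
move=> hcov hop hc.
have sQ Q : spec A Q -> is_subring Q by move=> /(spec_local_over hA)[].
have AQ Q : spec A Q -> A `<=` Q by move=> /(spec_local_over hA)[].
(* The guard [a != 0] is there because [0^-1 = 0] lies in every subring. *)
pose S a := A a /\ exists c0, forall i Q, spec A Q -> a != 0 -> Q a^-1 ->
  U i Q -> Q (c0 - c i).
suff S1 : S 1.
  have [_ [c0 h0]] := S1; exists c0 => i Q hQ; apply: h0 => //.
    exact: oner_neq0.
  by rewrite invr1; apply: subring1 (sQ _ hQ).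
apply: contrapT => nS1.
have [|a []//|//|q hq Sq] := @prime_ideal_containing _ _ hA S.
  split.
  - split; first exact: subring0.
    by exists 0 => i Q _; rewrite eqxx.
  - move=> a b [Aa [ca ha]] [Ab [cb hb]]; split; first exact: subringD.
    have [->|a0] := eqVneq a 0; first by exists cb; rewrite add0r.
    have [->|b0] := eqVneq b 0; first by exists ca; rewrite addr0.
    have [ab0|ab0] := eqVneq (a + b) 0.
      by exists 0.
    have [N hN] : exists N, A ((a * b) ^+ N * (ca - cb)).
      apply: sections_basic_open; [exact: subringM|exact: mulf_neq0|].
      move=> Q hQ Qab; have [i UiQ] := hcov _ hQ.
      have Qa : Q a^-1.
        have -> : a^-1 = b * (a * b)^-1 by field; rewrite a0 b0.
        by apply: subringM => //; [exact: sQ|exact: AQ].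
      have Qb : Q b^-1.
        have -> : b^-1 = a * (a * b)^-1 by field; rewrite a0 b0.
        by apply: subringM => //; [exact: sQ|exact: AQ].
      have -> : ca - cb = (ca - c i) - (cb - c i) by ring.
      by apply: subringB; [exact: sQ|exact: ha|exact: hb].
    have [u [v [Au Av e]]] := expD_mem_pair N Aa Ab.
    set f := (a * b) ^+ N * (ca - cb) in hN.
    (* Since f = (ab)^N (ca - cb) and (u a^N + v b^N) / (a + b)^(2N) = 1, this correction of [ca],
       with denominators a and a + b, is also a correction of [cb] with denominators b and a + b. *)
    exists (ca - f * v * ((a + b)^-1 ^+ (N + N) * a^-1 ^+ N)) => i Q hQ _ Qs UiQ.
    have hs := sQ _ hQ; have As := AQ _ hQ.
    have [_ hloc _ _] := spec_local_over hA hQ.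
    have QX x k : Q x -> Q (x ^+ k) by exact: subringX.
    have QM x y : Q x -> Q y -> Q (x * y) by exact: subringM.
    have [Qa|nQa] := pselect (Q a^-1).
      have -> : forall x y, x - y - c i = (x - c i) - y by move=> *; ring.
      apply: (subringB hs); first exact: ha.
      by apply: (QM); [apply: QM|apply: QM; apply: QX] => //; exact: As.
    (* Where a is not invertible b is, because a + b is; there the second expression is used. *)
    have ma : max_ideal Q a by split; [exact: As|right].
    have [_ Qb] : b != 0 /\ Q b^-1.
      have -> : b = (a + b) + (- a) by ring.
      apply: (unit_add_max hs hloc) => //; last exact: max_idealN.
      by apply: As; apply: subringD.
    have -> : ca - f * v * ((a + b)^-1 ^+ (N + N) * a^-1 ^+ N) =
              cb + f * u * ((a + b)^-1 ^+ (N + N) * b^-1 ^+ N).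
      have hab : (a + b)^-1 ^+ (N + N) * (u * a ^+ N + v * b ^+ N) = 1.
        by rewrite -e -exprMn mulVf // expr1n.
      apply/eqP; rewrite -subr_eq0; apply/eqP.
      transitivity (ca - cb - f * (a^-1 ^+ N * b^-1 ^+ N) *
        ((a + b)^-1 ^+ (N + N) * (u * a ^+ N + v * b ^+ N))).
        set z := (a + b)^-1 ^+ (N + N); rewrite !exprVn; field.
        by rewrite !expf_neq0.
      rewrite hab /f exprMn !exprVn; field; by rewrite !expf_neq0.
    have -> : forall x y, x + y - c i = (x - c i) + y by move=> *; ring.
    apply: (subringD hs); first exact: hb.
    by apply: (QM); [apply: QM|apply: QM; apply: QX] => //; exact: As.
  - move=> r a Ar [Aa [ca ha]]; split; first exact: subringM.
    exists ca => i Q hQ ra0 Qra UiQ.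
    have [r0 a0] : r != 0 /\ a != 0 by move: ra0; rewrite mulf_eq0 negb_or => /andP[].
    apply: ha => //; have -> : a^-1 = r * (r * a)^-1 by field; rewrite r0 a0.
    by apply: subringM => //; [exact: sQ|exact: AQ].
have hQ := spec_localization hq.
have [i UiQ] := hcov _ hQ.
have [fs [fsQ fsU]] := hop _ _ hQ UiQ.
(* A common denominator, outside q, of functions cutting out a neighbourhood inside [U i]. Over its
   basic open set [c i] itself is a gluing, so g lies in [S], against the choice of q. *)
have [g [Ag qg gfs]] : exists g, [/\ A g, ~ q g &
    forall Q', spec A Q' -> Q' g^-1 -> {in fs, forall f, Q' f}].
  elim: (fs) fsQ => [|f fs' IH] fsQ.
    by exists 1; split; [exact: subring1|case: hq => _ _ _ _ []|].
  have [|g [Ag qg gfs]] := IH.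
    by move=> f' hf'; apply: fsQ; rewrite inE hf' orbT.
  have [|a [b [Aa Ab qb ef]]] := fsQ f; first by rewrite inE eqxx.
  exists (g * b); split; first exact: subringM.
    by case: hq => _ _ _ _ [_ qP] /qP[].
  move=> Q' hQ' Qgb f'.
  have g0 := prime_ideal_neq0 hq qg; have b0 := prime_ideal_neq0 hq qb.
  have Qg : Q' g^-1.
    have -> : g^-1 = b * (g * b)^-1 by field; rewrite g0 b0.
    by apply: subringM => //; [exact: sQ|exact: AQ].
  have Qb : Q' b^-1.
    have -> : b^-1 = g * (g * b)^-1 by field; rewrite g0 b0.
    by apply: subringM => //; [exact: sQ|exact: AQ].
  rewrite inE => /predU1P[->|]; last exact: gfs.
  by rewrite ef; apply: subringM => //; [exact: sQ|exact: AQ].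
apply: qg; apply: Sq; split=> //; exists (c i) => i' Q' hQ' _ Qg Ui'Q'.
by apply: hc => //; apply: fsU => //; exact: gfs.
Qed.

End Affine.

(** * Smooth projective curves *)

Section Curve.
Variables (k : closedFieldType) (K : fieldType) (iota : {rmorphism k -> K}).

Lemma subring_horner (S : set K) (g : {poly k}) u : is_subring S ->
  range iota `<=` S -> S u -> S (map_poly iota g).[u].
Proof.
move=> hS kS Su; rewrite horner_coef; apply: subring_sum => // i _.
apply: subringM => //; last exact: subringX.
by rewrite coef_map; apply: kS; exists g`_i.
Qed.

(** Divide a relation between u and v by the highest power of v and take the constant term in v: a
    nonzero polynomial in u that v divides in k[u, v]. This is the only use of transcendence degree
    one; it bounds orders, makes residues constant and makes zeros finite in number. *)
Lemma algebraic_dependence u v : trdeg_one iota -> v != 0 ->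
  exists2 g : {poly k}, g != 0 &
    forall S, is_subring S -> range iota `<=` S -> S u -> S v ->
      exists2 r, S r & (map_poly iota g).[u] = v * r.
Proof.
move=> [_ /(_ u v)/existsNP[q /not_implyP[q0 /negP]]].
rewrite negbK => /eqP hq v0.
pose ev : {rmorphism {poly k} -> K} := horner_eval u \o map_poly iota.
have {}hq : (map_poly ev q).[v] = 0 by exact: hq.
have [m [q' + eq]] := multiplicity_XsubC q 0.
rewrite q0 /= => r0.
have /eqP : (map_poly ev q').[v] * v ^+ m = 0.
  by rewrite -hq eq polyC0 subr0 rmorphM rmorphXn /= map_polyX hornerM hornerXn.
rewrite mulf_eq0 expf_eq0 (negPf v0) andbF orbF => /eqP.
rewrite (@horner_coef_wide _ (size q').+1); last first.
  by rewrite (leq_trans (size_poly _ _)).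
rewrite big_ord_recl expr0 mulr1 => /eqP; rewrite addr_eq0 => /eqP e.
exists q'`_0; first by rewrite -horner_coef0.
move=> S hS kS Su Sv.
exists (- \sum_(i < size q') (map_poly ev q')`_(lift ord0 i) * v ^+ i).
  apply: subringN => //; apply: subring_sum => // i _.
  by apply: subringM => //; [rewrite coef_map; exact: subring_horner|exact: subringX].
move: e; rewrite coef_map /= => e; rewrite -[LHS]/(horner_eval u _).
rewrite e mulrN mulr_sumr; congr (- _); apply: eq_bigr => i _.
by rewrite /bump /= exprS; ring.
Qed.

(** Euclid's argument: a root of X times the product of the X - z, plus 1, is none of the z. *)
Lemma closed_field_avoid (s : seq k) : exists c, c \notin s.
Proof.
have [c hc] : exists c, root (\prod_(z <- s) ('X - z%:P) * 'X + 1) c.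
  apply/closed_rootP.
  have [s0|s0] := eqVneq (size (\prod_(z <- s) ('X - z%:P) * 'X : {poly k})) 0%N.
    move/eqP: s0; rewrite size_poly_eq0 mulf_eq0 polyX_eq0 orbF.
    by rewrite (negPf (monic_neq0 (monic_prod_XsubC _ _ _))).
  have p0 : \prod_(z <- s) ('X - z%:P) != 0 :> {poly k}.
    exact: monic_neq0 (monic_prod_XsubC _ _ _).
  rewrite size_polyDl size_mulX // ?size_polyC ?oner_eq0 ?size_poly1 //.
    by rewrite size_prod_XsubC.
  by rewrite size_prod_XsubC.
exists c; apply/negP => cs; move: hc.
rewrite rootE !hornerE horner_prod.
by rewrite (big_rem c) //= hornerXsubC subrr !mul0r add0r oner_eq0.
Qed.

Variables (C : set (set K)) (hC : smooth_projective_curve iota C).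

(** Beyond the definition, every chart has fraction field K. The generic point is given in one chart
    i0 only, and the nonzero element x_i0 / x_i of the chart i carries its fractions over. *)
Lemma curve_chart : exists (m : nat) (x : 'I_m.+1 -> K), [/\ forall i, x i != 0,
  C = \bigcup_i spec (gen_subring (range iota `|` range (fun j => x j / x i))) &
  forall i f, exists a b,
   [/\ gen_subring (range iota `|` range (fun j => x j / x i)) a,
       gen_subring (range iota `|` range (fun j => x j / x i)) b,
       b != 0 & f = a / b]].
Proof.
have [_ [CT [m [x [x0 eC]]]] _] := hC; exists m, x; split=> // i f.
have [i0 _ hT] : (\bigcup_i spec (gen_subring (range iota `|`
   range (fun j => x j / x i)))) setT by rewrite -eC.
pose A i := gen_subring (range iota `|` range (fun j => x j / x i)).
rewrite -/(A i) -/(A i0) in hT *.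
have hA j : is_subring (A j) by exact: gen_subring_subring.
have [_ _ _ hf] := spec_local_over (hA i0) hT.
have [a [b [Aa Ab b0 _ ->]]] := hf f I.
pose B := fractions_at (A i) setT.
have hTs : is_subring (setT : set K) by apply/is_subringP.
have hB : is_subring B by exact: fractions_at_subring.
have AB : A i0 `<=` B.
  apply: gen_subring_min => // z [kz|[j _ <-]].
    by apply: fractions_at_sub => //; [exact: subring1|apply: gen_subring_sub; left].
  exists (x j / x i), (x i0 / x i); split=> //.
  - by apply: gen_subring_sub; right; exists j.
  - by apply: gen_subring_sub; right; exists i0.
  - by rewrite mulf_neq0 // invr_eq0.
  - by field; rewrite !x0.
have [a1 [a2 [Aa1 Aa2 a20 _ ea]]] := AB _ Aa.
have [b1 [b2 [Ab1 Ab2 b20 _ eb]]] := AB _ Ab.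
have b10 : b1 != 0 by apply: contraNneq b0; rewrite eb => ->; rewrite mul0r.
exists (a1 * b2), (a2 * b1); split; [exact: (subringM (hA i))|exact: (subringM (hA i))|exact:
  mulf_neq0|].
by rewrite ea eb; field; rewrite a20 b20 b10.
Qed.

Lemma curve_point_facts R : C R -> [/\ is_subring R,
  forall x y, max_ideal R x -> max_ideal R y -> max_ideal R (x + y),
  range iota `<=` R & forall f, exists a b, [/\ R a, R b, b != 0 & f = a / b]].
Proof.
have [m [x [x0 -> fr]]] := curve_chart => -[i _ hR].
have [hs hl AR _] := spec_local_over (gen_subring_subring _) hR.
split=> //; first by move=> z kz; apply: AR; apply: gen_subring_sub; left.
by move=> f; have [a [b [Aa Ab b0 ->]]] := fr i f; exists a, b; split=> //; exact: AR.
Qed.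

Lemma curve_subring R : C R -> is_subring R.
Proof. by case/curve_point_facts. Qed.
Lemma curve_local R : C R ->
  forall x y, max_ideal R x -> max_ideal R y -> max_ideal R (x + y).
Proof. by case/curve_point_facts. Qed.
Lemma curve_const R c : C R -> R (iota c).
Proof. by case/curve_point_facts => _ _ h _; apply: h; exists c. Qed.
Lemma curve_generic : C setT. Proof. by have [_ []] := hC. Qed.

Lemma curve_uniformizer R : closed_points C R -> exists t, uniformizer R t.
Proof.
move=> [CR RT]; have [_ _ /(_ _ CR)[t ht]] := hC; exists t; split=> //.
apply/eqP => t0; apply: RT; apply/seteqP; split=> // f _.
have [hs hl _ hf] := curve_point_facts CR.
have [a [b [Ra Rb b0 ->]]] := hf f; apply: subringM => //.
apply: contrapT => nb.
suff : max_ideal R b by rewrite ht t0 => -[r _ /eqP]; rewrite mulr0 eq_sym (negPf b0).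
by split=> //; right.
Qed.

Definition unif R : K := xget 0 (uniformizer R).

Lemma unifP R : closed_points C R -> uniformizer R (unif R).
Proof. by move=> /curve_uniformizer[t ht]; apply: xgetPex; exists t. Qed.

Definition ordge R (n : int) : set K := [set f | exists2 r, R r & f = r * unif R ^ n].

Section Point.
Variables (R : set K) (hR : closed_points C R).
Let CR : C R := hR.1.
Let hs : is_subring R := curve_subring CR.
Let hl := curve_local CR.
Local Notation t := (unif R).

Lemma unif_neq0 : t != 0. Proof. by case: (unifP hR). Qed.

Lemma max_idealE x : max_ideal R x <-> exists2 r, R r & x = r * t.
Proof.
have [_ ->] := unifP hR.
by split=> [[r Rr <-]|[r Rr ->]]; exists r.
Qed.

Lemma unif_mem : R t.
Proof.
suff [] : max_ideal R t by [].
by apply/max_idealE; exists 1; rewrite ?mul1r //; exact: subring1.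
Qed.

Lemma ordge0 : ordge R 0 = R.
Proof.
apply/seteqP; split=> f; first by move=> [r Rr ->]; rewrite expr0z mulr1.
by move=> Rf; exists f => //; rewrite expr0z mulr1.
Qed.

Lemma ordge_weaken m n f : m <= n -> ordge R n f -> ordge R m f.
Proof.
move=> mn [r Rr ->]; exists (r * t ^ (n - m)).
  have -> : n - m = `|n - m|%N%:Z by lia.
  by apply: subringM => //; apply: subringX => //; exact: unif_mem.
by rewrite -mulrA -expfzDr ?unif_neq0 // subrK.
Qed.

Lemma ordgeM m n f g : ordge R m f -> ordge R n g -> ordge R (m + n) (f * g).
Proof.
move=> [r Rr ->] [r' Rr' ->]; exists (r * r'); first exact: subringM.
by rewrite expfzDr ?unif_neq0 //; ring.
Qed.

Lemma ordgeD n f g : ordge R n f -> ordge R n g -> ordge R n (f + g).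
Proof.
move=> [r Rr ->] [r' Rr' ->]; exists (r + r'); first exact: subringD.
by rewrite mulrDl.
Qed.

Lemma ordgeMl n f g : R f -> ordge R n g -> ordge R n (f * g).
Proof. by move=> Rf hg; rewrite -[n]add0r; apply: ordgeM; rewrite ?ordge0. Qed.

Lemma ordgeN n f : ordge R n f -> ordge R n (- f).
Proof.
by move=> h; rewrite -mulN1r; apply: ordgeMl => //; apply: subringN => //; exact: subring1.
Qed.

Lemma ordgeB n f g : ordge R n f -> ordge R n g -> ordge R n (f - g).
Proof. by move=> hf hg; apply: ordgeD hf (ordgeN hg). Qed.

Lemma ordge_0 n : ordge R n 0.
Proof. by exists 0; rewrite ?mul0r //; exact: subring0. Qed.

Lemma ordge_unif n : ordge R n (t ^ n).
Proof. by exists 1; rewrite ?mul1r //; exact: subring1. Qed.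

Lemma ordgeX n f m : ordge R n f -> ordge R (n *+ m) (f ^+ m).
Proof.
move=> h; elim: m => [|m IH]; first by rewrite mulr0n expr0 ordge0; exact: subring1.
by rewrite mulrS exprS; exact: ordgeM.
Qed.

Lemma ordge1E x : ordge R 1 x <-> max_ideal R x.
Proof. by rewrite max_idealE. Qed.

Lemma unit_not_max x : x != 0 -> R x^-1 -> ~ max_ideal R x.
Proof. by move=> x0 Rx [_ [/eqP|//]]; rewrite (negPf x0). Qed.

Lemma not_ordge_unit n r : R r -> r != 0 -> R r^-1 -> ~ ordge R (n + 1) (r * t ^ n).
Proof.
move=> Rr r0 Ri [r' Rr']; rewrite expfzDr ?unif_neq0 // mulrCA [r * _]mulrC expr1z.
move/(mulfI (expfz_neq0 _ unif_neq0)) => e.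
by apply: (unit_not_max r0 Ri); apply/max_idealE; exists r'.
Qed.

(** The element f divides some g(t) with g a nonzero polynomial over k, and g(t) is a unit times
    t^a. So the powers of t dividing f are bounded, and the largest one leaves a unit. *)
Lemma ordge_exact_nat f : f != 0 -> R f ->
  exists (n : nat) r, [/\ R r, r != 0, R r^-1 & f = r * t ^+ n].
Proof.
move=> f0 Rf.
have [trd _ _] := hC.
have [g g0 hg] := algebraic_dependence t trd f0.
have [r Rr er] := hg R hs (fun z '(ex_intro2 c _ e) => eq_ind _ R (curve_const c CR) _ e)
  unif_mem Rf.
have [a [g' + eg]] := multiplicity_XsubC g 0.
rewrite g0 /= => gr0.
have [u [u0 Ru Rui] eu] : exists2 u, [/\ u != 0, R u & R u^-1] &
    (map_poly iota g).[t] = u * t ^+ a.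
  exists (map_poly iota g').[t]; last first.
    by rewrite eg polyC0 subr0 rmorphM rmorphXn /= map_polyX hornerM hornerXn.
  have h : (map_poly iota g').[t] = iota g'.[0] +
     t * (\sum_(i < size g') iota g'`_i.+1 * t ^+ i).
    rewrite (@horner_coef_wide _ (size g').+1) ?(leq_trans (size_poly _ _)) //.
    rewrite big_ord_recl expr0 mulr1 coef_map horner_coef0 mulr_sumr; congr (_ + _).
    by apply: eq_bigr => i _; rewrite coef_map /bump /= exprS; ring.
  have Rg : R (map_poly iota g').[t].
    by apply: subring_horner => //; [move=> z [c _ <-]; exact: curve_const|exact: unif_mem].
  have c0 : iota g'.[0] != 0 by rewrite fmorph_eq0.
  rewrite h in Rg *.
  have [] // := @unit_add_max _ R hs hl (iota g'.[0])
     (t * (\sum_(i < size g') iota g'`_i.+1 * t ^+ i)) c0.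
  - exact: curve_const.
  - by rewrite -fmorphV; exact: curve_const.
  - apply/max_idealE; exists (\sum_(i < size g') iota g'`_i.+1 * t ^+ i).
      apply: subring_sum => // i _; apply: subringM => //; first exact: curve_const.
      by apply: subringX => //; exact: unif_mem.
    by rewrite mulrC.
pose P n := `[< exists2 r, R r & f = r * t ^+ n >].
have P0 : exists n, P n by exists 0%N; apply/asboolP; exists f; rewrite ?mulr1.
have Pb n : P n -> (n <= a)%N.
  move=> /asboolP[r' Rr' ef]; rewrite leqNgt; apply/negP => na.
  apply: (unit_not_max u0 Rui); apply/max_idealE.
  exists (r' * r * t ^+ (n - a.+1)).
    by do ![apply: subringM => //]; apply: subringX => //; exact: unif_mem.
  apply: (mulIf (expf_neq0 a unif_neq0)).
  rewrite -eu er ef -[in LHS](subnK na) exprD exprS; ring.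
case: (ex_maxnP P0 Pb) => n /asboolP[r' Rr' ef] nmax.
have r0 : r' != 0 by apply: contraNneq f0; rewrite ef => ->; rewrite mul0r.
exists n, r'; split=> //; apply: contrapT => nri.
have /max_idealE[r'' Rr'' er''] : max_ideal R r' by split=> //; right.
have /nmax : P n.+1.
  by apply/asboolP; exists r'' => //; rewrite ef er'' exprS mulrA.
by rewrite ltnn.
Qed.

Lemma ordge_exact f : f != 0 ->
  exists (n : int) r, [/\ R r, r != 0, R r^-1 & f = r * t ^ n].
Proof.
have [_ _ _ hf] := curve_point_facts CR.
have [a [b [Ra Rb b0 ->]]] := hf f => ab0.
have a0 : a != 0 by apply: contraNneq ab0 => ->; rewrite mul0r.
have [n [r [Rr r0 Rri ea]]] := ordge_exact_nat a0 Ra.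
have [m [r' [Rr' r0' Rri' eb]]] := ordge_exact_nat b0 Rb.
exists (n%:Z - m%:Z), (r * r'^-1); split.
- exact: subringM.
- by rewrite mulf_neq0 ?invr_eq0.
- by rewrite invfM invrK; exact: subringM.
- rewrite ea eb expfzDr ?unif_neq0 // -invr_expz -!exprnP; field.
  by rewrite expf_neq0 ?unif_neq0.
Qed.

Lemma ordge_some f : exists n, ordge R n f.
Proof.
have [->|f0] := eqVneq f 0; first by exists 0; exact: ordge_0.
by have [n [r [Rr _ _ ->]]] := ordge_exact f0; exists n, r.
Qed.

Lemma not_mem_inv f : ~ R f -> f != 0 /\ max_ideal R f^-1.
Proof.
move=> nf; have f0 : f != 0 by apply: contra_notN nf => /eqP->; exact: subring0.
split=> //; have [n [r [Rr r0 Rri ef]]] := ordge_exact f0.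
have n0 : n < 0.
  rewrite ltNge; apply/negP => n0; apply: nf; rewrite -ordge0.
  by apply: (@ordge_weaken 0 n) => //; exists r.
apply/ordge1E; apply: (@ordge_weaken 1 (- n)); first lia.
by exists r^-1 => //; rewrite ef invfM invr_expz.
Qed.

Lemma residue_root r (g : {poly k}) : g != 0 -> R r ->
  max_ideal R (map_poly iota g).[r] -> exists2 c, root g c & max_ideal R (r - iota c).
Proof.
move=> g0 Rr; have [s es] := closed_field_poly_normal g.
have lg : lead_coef g != 0 by rewrite lead_coef_eq0.
have gs c : c \in s -> root g c.
  by move=> cs; rewrite es rootZ // root_prod_XsubC.
rewrite {1}es map_polyZ hornerZ rmorph_prod horner_prod /= => mg.
have {mg} : max_ideal R (\prod_(z <- s) (r - iota z)).
  have -> : \prod_(z <- s) (r - iota z) = iota (lead_coef g)^-1 * (iota (lead_coef g) *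
      \prod_(i <- s) (map_poly iota ('X - i%:P)).[r]).
    rewrite mulrA -rmorphM mulVf // rmorph1 mul1r.
    by apply: eq_bigr => z _; rewrite map_polyXsubC hornerXsubC.
  by apply: max_idealM => //; exact: curve_const.
elim: s gs {es} => [|z s IH] gs; first by rewrite big_nil => /max_ideal1; case.
rewrite big_cons => /(max_ideal_primeM hs)[||h|/IH[]].
- by apply: subringB => //; exact: curve_const.
- elim/big_ind: _ => [|x y hx hy|z' _]; [exact: subring1|exact: subringM|].
  by apply: subringB => //; exact: curve_const.
- by exists z => //; apply: gs; rewrite inE eqxx.
- by move=> c cs; apply: gs; rewrite inE cs orbT.
- by move=> c rc hc; exists c.
Qed.

(** The residue field is k: the uniformizer divides some g(r), the closed field splits g, and a
    linear factor then falls in the maximal ideal. *)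
Lemma residue r : R r -> exists c, max_ideal R (r - iota c).
Proof.
move=> Rr; have [trd _ _] := hC.
have [g g0 hg] := algebraic_dependence r trd unif_neq0.
have kR : range iota `<=` R by move=> z [c _ <-]; exact: curve_const.
have [w Rw ew] := hg R hs kR Rr unif_mem.
have [|c _ hc] := residue_root g0 Rr; last by exists c.
by apply/max_idealE; exists w; rewrite // ew mulrC.
Qed.

Lemma ordge_step n f g : ordge R n f -> ordge R n g -> ~ ordge R (n + 1) g ->
  exists c, ordge R (n + 1) (f - iota c * g).
Proof.
move=> [r Rr ->] [r' Rr' ->] ng.
have nr' : ~ max_ideal R r'.
  move=> /max_idealE[w Rw ew]; apply: ng; exists w => //.
  by rewrite expfzDr ?unif_neq0 // expr1z ew; ring.
have [r0 Rri] := (not_max_idealP hs Rr').1 nr'.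
have [c /max_idealE[w Rw ew]] := residue (subringM hs Rr Rri).
exists c, (w * r'); first exact: subringM.
rewrite expfzDr ?unif_neq0 // expr1z.
have -> : w * r' * (t ^ n * t) = w * t * r' * t ^ n by ring.
by rewrite -ew; field.
Qed.

End Point.

End Curve.

(** * Weak approximation and finiteness of poles on the curve *)

Section Degree.
Variables (k : closedFieldType) (K : fieldType) (iota : {rmorphism k -> K}).
Variables (C : set (set K)) (hC : smooth_projective_curve iota C).
Local Notation closed := (closed_points C).
Let sR R (hR : closed R) : is_subring R := curve_subring hC hR.1.

(** An element outside R is a unit times a negative power of the uniformizer, so adjoining it
    inverts the uniformizer. *)
Lemma curve_maximal R (S : set K) f : closed R -> is_subring S -> R `<=` S ->
  S f -> ~ R f -> S = setT.
Proof.
move=> hR hS RS Sf nf; apply/seteqP; split=> // g _.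
have [f0 mf] := not_mem_inv hC hR nf.
have t0 := unif_neq0 hC hR; have Rt := unif_mem hC hR.
have [n [r [Rr r0 Rri ef]]] := ordge_exact hC hR f0.
have n0 : n < 0.
  rewrite ltNge; apply/negP => n0; apply: nf; rewrite -(ordge0 R).
  by apply: (@ordge_weaken _ _ _ _ hC _ hR 0 n) => //; exists r.
have [m em] : exists m : nat, n = - m.+1%:Z by exists (`|n|.-1)%N; lia.
have St : S (unif R)^-1.
  have -> : (unif R)^-1 = r^-1 * unif R ^+ m * f.
    rewrite ef em -invr_expz -exprnP exprS; field.
    by rewrite t0 r0 expf_neq0.
  apply: subringM => //; apply: subringM => //; first exact: RS.
  by apply: subringX => //; exact: RS.
have [[m'|m'] [r' Rr' ->]] := ordge_some hC hR g.
  by apply: subringM => //; [exact: RS|apply: subringX => //; exact: RS].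
rewrite NegzE -invr_expz -exprnP -exprVn.
by apply: subringM => //; [exact: RS|apply: subringX].
Qed.

Lemma separate_points P P' : closed P -> closed P' -> P <> P' ->
  exists psi, [/\ psi != 0, max_ideal P' psi & max_ideal P psi^-1].
Proof.
move=> hP hP' PP'.
have [f Pf nPf] : exists2 f, P' f & ~ P f.
  apply: contrapT => h; apply: PP'.
  have sub : P' `<=` P by move=> f Pf; apply: contrapT => nPf; apply: h; exists f.
  apply/seteqP; split=> // g Pg; apply: contrapT => nPg.
  exact: hP.2 (curve_maximal hP' (sR hP) sub Pg nPg).
have [g Pg nPg] : exists2 g, P g & ~ P' g.
  apply: contrapT => h; apply: PP'.
  have sub : P `<=` P' by move=> g Pg; apply: contrapT => nPg; apply: h; exists g.
  apply/seteqP; split=> // f' Pf'; apply: contrapT => nPf'.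
  exact: hP'.2 (curve_maximal hP (sR hP') sub Pf' nPf').
have [f0 mf] := not_mem_inv hC hP nPf.
have [g0 mg] := not_mem_inv hC hP' nPg.
exists (f / g); split; first by rewrite mulf_neq0 ?invr_eq0.
  by apply: max_idealM => //; exact: sR.
by rewrite invf_div; apply: max_idealM => //; exact: sR.
Qed.

(** Take psi with a pole at P and a zero at P'. Then psi / (psi - c) is 1 modulo the maximal ideal
    at P and still vanishes at P'; it is regular on s once the nonzero constant c avoids the
    finitely many values of psi there, poles of psi being harmless. *)
Lemma separate_points_regular P P' (s : seq (set K)) : closed P -> closed P' ->
  P <> P' -> {in s, forall R, closed R} ->
  exists phi, [/\ phi != 0, max_ideal P' phi, P phi, P phi^-1 &
    {in s, forall R, R phi}].
Proof.
move=> hP hP' PP' hs.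
have [psi [psi0 m' m]] := separate_points hP hP' PP'.
have bad : exists s' : seq k, {in s, forall (R : set K) c, c \notin s' -> c != 0 ->
    psi - iota c != 0 /\ R (psi - iota c)^-1}.
  elim: s hs => [|R s IH] hs; first by exists [::].
  have [|s' hs'] := IH; first by move=> R' hR'; apply: hs; rewrite inE hR' orbT.
  have hR : closed R by apply: hs; rewrite inE eqxx.
  have hRl := curve_local hC hR.1.
  have [Rpsi|nRpsi] := pselect (R psi).
    have [c0 hc0] := residue hC hR Rpsi.
    exists (c0 :: s') => R'; rewrite inE => /predU1P[->|R's] c.
      rewrite inE negb_or => /andP[cc0 _] _.
      have -> : psi - iota c = iota (c0 - c) + (psi - iota c0).
        by rewrite rmorphB /=; ring.
      apply: (unit_add_max (sR hR) hRl) => //.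
      - by rewrite fmorph_eq0 subr_eq0 eq_sym.
      - exact: (curve_const hC _ hR.1).
      - by rewrite -fmorphV; exact: (curve_const hC _ hR.1).
    by rewrite inE negb_or => /andP[_ cs']; exact: hs'.
  exists s' => R'; rewrite inE => /predU1P[->|R's] c; last exact: hs'.
  move=> _ c0; have [_ mR] := not_mem_inv hC hR nRpsi.
  have [u0 Ru] := @unit_add_max _ R (sR hR) hRl 1 (- (iota c * psi^-1))
    (oner_neq0 _) (subring1 (sR hR)) (eq_ind_r R (subring1 (sR hR)) (invr1 _))
    (max_idealN (sR hR) (max_idealM (sR hR) (curve_const hC c hR.1) mR)).
  have e : psi - iota c = psi * (1 - iota c * psi^-1) by field.
  rewrite e mulf_neq0 // invfM; split=> //.
  by apply: (subringM (sR hR)) => //; case: mR.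
have [s' hs'] := bad.
have [c] := closed_field_avoid (0 :: s'); rewrite inE negb_or => /andP[c0 cs'].
have ic0 : iota c != 0 by rewrite fmorph_eq0.
have [u'0 Pu'] : psi - iota c != 0 /\ P' (psi - iota c)^-1.
  rewrite addrC; apply: (unit_add_max (sR hP') (curve_local hC hP'.1)) => //.
  - by rewrite oppr_eq0.
  - by apply: (subringN (sR hP')); exact: (curve_const hC _ hP'.1).
  - by rewrite invrN -fmorphV; apply: (subringN (sR hP')); exact: (curve_const hC _ hP'.1).
have [u0 Pu] : 1 - iota c * psi^-1 != 0 /\ P (1 - iota c * psi^-1)^-1.
  apply: (unit_add_max (sR hP) (curve_local hC hP.1)) => //.
  - exact: oner_neq0.
  - exact: (subring1 (sR hP)).
  - by rewrite invr1; exact: (subring1 (sR hP)).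
  - apply: (max_idealN (sR hP)); apply: (max_idealM (sR hP)) => //.
    exact: (curve_const hC _ hP.1).
have e : psi / (psi - iota c) = (1 - iota c * psi^-1)^-1.
  have -> : 1 - iota c * psi^-1 = (psi - iota c) / psi by field.
  by rewrite invf_div.
exists (psi / (psi - iota c)); split.
- by rewrite mulf_neq0 // invr_eq0.
- by rewrite mulrC; apply: (max_idealM (sR hP')).
- by rewrite e.
- rewrite e invrK; apply: (subringB (sR hP)); first exact: (subring1 (sR hP)).
  by apply: (subringM (sR hP)); [exact: (curve_const hC _ hP.1)|case: m].
- move=> R Rs; have hR := hs _ Rs; have [_ Ri] := hs' _ Rs _ cs' c0.
  have -> : psi / (psi - iota c) = 1 + iota c * (psi - iota c)^-1 by field.
  apply: (subringD (sR hR)); first exact: (subring1 (sR hR)).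
  by apply: (subringM (sR hR)) => //; exact: (curve_const hC _ hR.1).
Qed.

(** Each new point is served by a high power of a function that vanishes there, is a unit at P and
    does no harm at the points already treated. *)
Lemma weak_approximation P (b N : int) (s : seq (set K)) : closed P ->
  {in s, forall R, closed R} ->
  exists u, [/\ ordge P b u, ~ ordge P (b + 1) u &
    {in s, forall R, R <> P -> ordge R N u}].
Proof.
move=> hP; elim: s => [|R s IH] hs.
  exists (unif P ^ b); split=> //; first exact: (ordge_unif hC).
  rewrite -(mul1r (_ ^ _)); apply: (not_ordge_unit hC) => //.
  - exact: (subring1 (sR hP)).
  - exact: oner_neq0.
  - by rewrite invr1; exact: (subring1 (sR hP)).
have hs1 : {in s, forall R, closed R} by move=> R' h; apply: hs; rewrite inE h orbT.
have hR : closed R by apply: hs; rewrite inE eqxx.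
have [u [u1 u2 us]] := IH hs1.
have [RP|RP] := pselect (R = P).
  by exists u; split=> // R'; rewrite inE => /predU1P[->|/us//] /(_ RP).
have PR : P <> R by move=> e; apply: RP.
have [phi [phi0 mR Pphi Pphi' phis]] := separate_points_regular hP hR PR hs1.
have [n un] := ordge_some hC hR u.
pose M := `|N - n|%N; exists (u * phi ^+ M); split.
- by rewrite mulrC; apply: (ordgeMl hC) => //; apply: (subringX (sR hP)).
- move=> h; apply: u2.
  rewrite -(mulfK (expf_neq0 M phi0) u) mulrC.
  by apply: (ordgeMl hC) => //; rewrite -exprVn; apply: (subringX (sR hP)).
- move=> R'; rewrite inE => /predU1P[->|R's] R'P.
    apply: (@ordge_weaken _ _ _ _ hC _ hR N (n + 1 *+ M)).
      by rewrite natz /M; lia.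
    by apply: (ordgeM hC hR) => //; apply: (ordgeX hC hR); apply/(ordge1E hC hR).
  rewrite mulrC; apply: (ordgeMl hC (hs1 _ R's)).
    by apply: (subringX (sR (hs1 _ R's))); exact: phis.
  exact: us.
Qed.


(** The residues of the coordinates fix the residue of every element of the chart ring, hence which
    denominators are invertible. *)
Lemma chart_point_coordinates (S R R' : set K) :
  spec (gen_subring (range iota `|` S)) R -> spec (gen_subring (range iota `|` S)) R' ->
  (forall y, S y -> exists c, max_ideal R (y - iota c) /\ max_ideal R' (y - iota c)) ->
  R `<=` R'.
Proof.
set A := gen_subring _ => hR hR' hS.
have hA : is_subring A by exact: gen_subring_subring.
have [hs hl AR hf] := spec_local_over hA hR.
have [hs' hl' AR' _] := spec_local_over hA hR'.
have kA c : A (iota c) by apply: gen_subring_sub; left; exists c.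
have key a : A a -> exists c, max_ideal R (a - iota c) /\ max_ideal R' (a - iota c).
  move: a; apply: gen_subring_min.
    have mk (Q : set K) c a : is_subring Q -> A `<=` Q -> max_ideal Q (a - iota c) -> Q a.
      move=> hQ AQ [h _]; rewrite -(subrK (iota c) a).
      by apply: subringD => //; exact: AQ.
    apply/is_subringP; split.
    - by exists 1; rewrite rmorph1 subrr; split; apply: max_ideal0.
    - move=> x y [c [h1 h2]] [d [h3 h4]]; exists (c - d).
      have -> : x - y - iota (c - d) = (x - iota c) + - (y - iota d).
        by rewrite rmorphB /=; ring.
      by split; [apply: hl|apply: hl'] => //; exact: max_idealN.
    - move=> x y [c [h1 h2]] [d [h3 h4]]; exists (c * d).
      have -> : x * y - iota (c * d) = x * (y - iota d) + iota d * (x - iota c).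
        by rewrite rmorphM /=; ring.
      split; [apply: hl|apply: hl']; apply: max_idealM => //.
      + exact: mk h1.
      + exact: AR.
      + exact: mk h2.
      + exact: AR'.
  move=> z [[c _ <-]|/hS//].
  by exists c; rewrite subrr; split; apply: max_ideal0.
move=> z /hf[a [b [Aa Ab b0 Rb ->]]]; have [c [m m']] := key _ Ab.
have c0 : iota c != 0.
  by apply/eqP => c0; move: m => [_]; rewrite c0 subr0 => -[/eqP|//]; rewrite (negPf b0).
have [_ R'b] : iota c + (b - iota c) != 0 /\ R' (iota c + (b - iota c))^-1.
  by apply: (unit_add_max hs' hl') => //; [exact: AR'|rewrite -fmorphV; exact: AR'].
by apply: subringM => //; [exact: AR'|move: R'b; rewrite addrC subrK].
Qed.

(** At a zero of b each coordinate takes its value among the roots of a fixed polynomial, since b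
    divides g_i(y_i), and a point is determined by the values of its coordinates. *)
Lemma finite_chart_zeros n (y : 'I_n -> K) b : b != 0 ->
  gen_subring (range iota `|` range y) b ->
  finite_set [set R | [/\ closed R, spec (gen_subring (range iota `|` range y)) R &
                     max_ideal R b]].
Proof.
set A := gen_subring _ => b0 Ab.
have hA : is_subring A by exact: gen_subring_subring.
have [trd _ _] := hC.
have /choice[g hg] : forall i, exists g : {poly k}, g != 0 /\ forall S, is_subring S ->
    range iota `<=` S -> S (y i) -> S b ->
    exists2 r, S r & (map_poly iota g).[y i] = b * r.
  by move=> i; have [g g0 hg] := algebraic_dependence (y i) trd b0; exists g.
have /choice[rt hrt] : forall i, exists s : seq k, forall c, root (g i) c -> c \in s.
  move=> i; have [s es] := closed_field_poly_normal (g i); exists s => c.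
  have [g0 _] := hg i.
  by rewrite es rootZ ?root_prod_XsubC // lead_coef_eq0.
pose N := (\max_i size (rt i))%N.
pose Z := [set R | [/\ closed R, spec A R & max_ideal R b]].
pose coord R (phi : {ffun 'I_n -> 'I_N.+1}) :=
  forall i, max_ideal R (y i - iota (nth 0 (rt i) (phi i))).
(* The default [setT] stands for choices of roots that no zero of b realizes. *)
pose pt phi := xget (setT : set K) [set R | Z R /\ coord R phi].
have inj R R' phi : Z R -> Z R' -> coord R phi -> coord R' phi -> R `<=` R'.
  move=> [_ hR _] [_ hR' _] cR cR'; apply: (chart_point_coordinates hR hR').
  by move=> _ [i _ <-]; exists (nth 0 (rt i) (phi i)).
apply: (@sub_finite_set _ _ [set pt phi | phi in setT]); last first.
  by apply: finite_image; exact: finite_finset.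
move=> R ZR; have [hR sR' mb] := ZR.
have [hs hl AR _] := spec_local_over hA sR'.
have Ay i : A (y i) by apply: gen_subring_sub; right; exists i.
have /choice[phi hphi] : forall i, exists j : 'I_N.+1,
    max_ideal R (y i - iota (nth 0 (rt i) j)).
  move=> i; have [g0 hgi] := hg i.
  have [||||r Rr er] := hgi R => //.
  - by move=> z hz; apply: AR; apply: gen_subring_sub; left.
  - exact: AR.
  - exact: AR.
  have [|c rc mc] := residue_root hC hR g0 (AR _ (Ay i)).
    by rewrite er mulrC; apply: max_idealM.
  have cs := hrt _ _ rc.
  have hi : (index c (rt i) < N.+1)%N.
    rewrite ltnS (leq_trans (index_size _ _)) //.
    exact: (leq_bigmax (F := fun i => size (rt i))).
  by exists (Ordinal hi); rewrite /= nth_index.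
have cR : coord R [ffun i => phi i] by move=> i; rewrite ffunE.
exists [ffun i => phi i] => //.
have [Z' c'] : Z (pt [ffun i => phi i]) /\ coord (pt [ffun i => phi i]) [ffun i => phi i].
  by apply: (@xgetPex _ setT [set R | Z R /\ coord R [ffun i => phi i]]); exists R.
by apply/seteqP; split; [apply: (inj _ _ _ Z' ZR)|apply: (inj _ _ _ ZR Z')]; eassumption.
Qed.

Lemma finite_poles f : finite_set [set R | closed R /\ ~ R f].
Proof.
have [m [x [x0 eC fr]]] := curve_chart hC.
apply: (@sub_finite_set _ _ (\bigcup_(i in [set: 'I_m.+1]) [set R | [/\ closed R,
   spec (gen_subring (range iota `|` range (fun j => x j / x i))) R & ~ R f]])).
  move=> R [hR nf]; have : C R by case: hR.
  by rewrite {1}eC => -[i _ hi]; exists i.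
apply: bigcup_finite => [|i _]; first exact: finite_finset.
have [a [b [Aa Ab b0 ef]]] := fr i f.
apply: sub_finite_set (finite_chart_zeros b0 Ab) => R [hR hRi nf]; split=> //.
have [hs hl AR hf] := spec_local_over (gen_subring_subring _) hRi.
split; first exact: AR.
by right=> Rb; apply: nf; rewrite ef; apply: subringM => //; exact: AR.
Qed.

(** Divisors are handled as lists of points with multiplicity [count_mem], so that dimension counts
    can add one point at a time. *)
Lemma poles_seq f : exists2 S : seq (set K), {in S, forall R, closed R} &
  forall R, closed R -> ordge R (- (count_mem R S)%:Z) f /\ (R f -> R \notin S).
Proof.
have /finite_seqP[r er] := finite_poles f.
have hr R : R \in r -> closed R /\ ~ R f.
  by move=> Rr; have : [set` r] R by []; rewrite -er.
have [S [S1 S2]] : exists S : seq (set K), {subset S <= r} /\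
    {in r, forall R, ordge R (- (count_mem R S)%:Z) f}.
  elim: (r) hr => [|R0 r' IH] hr; first by exists [::].
  have [|S [S1 S2]] := IH; first by move=> R Rr; apply: hr; rewrite inE Rr orbT.
  have [h0 _] : closed R0 /\ ~ R0 f by apply: hr; rewrite inE eqxx.
  have [n hn] := ordge_some hC h0 f.
  exists (nseq `|n|%N R0 ++ S); split.
    move=> R; rewrite mem_cat mem_nseq inE => /orP[/andP[_ ->]//|/S1->].
    by rewrite orbT.
  move=> R; rewrite inE count_cat => /predU1P[->|Rr].
    apply: (ordge_weaken hC h0 _ hn).
    by rewrite count_nseq /= eqxx mul1n; lia.
  have [hR _] : closed R /\ ~ R f by apply: hr; rewrite inE Rr orbT.
  by apply: (ordge_weaken hC hR _ (S2 _ Rr)); lia.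
exists S; first by move=> R /S1/hr[].
move=> R hR; have [Rf|nRf] := pselect (R f); last first.
  split; last by [].
  by apply: S2; have : [set` r] R by rewrite -er.
split; first by apply: (@ordge_weaken _ _ _ _ hC _ hR _ 0); [lia|rewrite ordge0].
by move=> _; apply/negP => /S1/hr[].
Qed.

End Degree.

(** * Principal divisors have degree at most zero *)

Section Dimension.
Variables (k : fieldType) (K : fieldType) (iota : {rmorphism k -> K}).
Implicit Types (V W : set K).

Definition indep n (v : 'I_n -> K) :=
  forall c : 'I_n -> k, \sum_i iota (c i) * v i = 0 -> forall i, c i = 0.
Definition dim_le V N :=
  forall n (v : 'I_n -> K), (forall i, V (v i)) -> indep v -> (n <= N)%N.
Definition dim_ge V N := exists v : 'I_N -> K, (forall i, V (v i)) /\ indep v.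

Lemma dim_leW V W N : W `<=` V -> dim_le V N -> dim_le W N.
Proof. by move=> WV h n v Wv; apply: h => i; apply: WV. Qed.

Lemma dim_exact V N : dim_le V N -> exists2 d, dim_le V d & dim_ge V d.
Proof.
move=> hN; pose P d := `[< dim_ge V d >].
have P0 : exists d, P d.
  exists 0%N; apply/asboolP; exists (fun=> 0); split; first by case.
  by move=> c _ [].
have Pb d : P d -> (d <= N)%N by move=> /asboolP[v [Vv iv]]; exact: hN iv.
case: (ex_maxnP P0 Pb) => d /asboolP hd dmax; exists d => // n v Vv iv.
by apply: dmax; apply/asboolP; exists v.
Qed.

(** The hypothesis says that W / V has dimension at most one. A vector outside V serves as pivot and
    is subtracted from the others. *)
Lemma dim_le_step V W N : is_submodule (range iota) V -> V `<=` W ->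
  (forall w w', W w -> W w' -> ~ V w' -> exists c, V (w - iota c * w')) ->
  dim_le V N -> dim_le W N.+1.
Proof.
move=> [V0 VD VM] VW hW hV [//|n] v Wv iv; rewrite ltnS.
have [allV|/existsNP[i0 nV]] := pselect (forall i, V (v i)).
  by apply: ltnW; exact: hV iv.
have /choice[c hc] : forall i, exists c, V (v (lift i0 i) - iota c * v i0).
  by move=> i; apply: hW.
apply: (hV n (fun i => v (lift i0 i) - iota (c i) * v i0)) => // d hd i.
pose d' i := if unlift i0 i is Some i' then d i' else - \sum_i d i * c i.
have d'0 : d' i0 = - \sum_i d i * c i by rewrite /d' unlift_none.
have d'l l : d' (lift i0 l) = d l by rewrite /d' liftK.
rewrite -d'l; apply: iv.
rewrite (bigD1_ord i0) //= d'0 -[RHS]hd rmorphN rmorph_sum mulNr mulr_suml -sumrN.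
rewrite -big_split /=; apply: eq_bigr => l _.
by rewrite d'l rmorphM /=; ring.
Qed.

Lemma dim_ge_step V W u N : is_submodule (range iota) V -> V `<=` W ->
  W u -> ~ V u -> dim_ge V N -> dim_ge W N.+1.
Proof.
move=> [V0 VD VM] VW Wu nVu [v [Vv iv]].
exists (fun i => if unlift ord0 i is Some i' then v i' else u); split.
  by move=> i; case: unliftP => [i' _|_] //; exact: VW.
move=> c; rewrite big_ord_recl unlift_none.
under eq_bigr do rewrite liftK.
move=> hc.
have c0 : c ord0 = 0.
  apply: contrapT => /eqP c0; apply: nVu.
  have e : u = \sum_(i < N) iota (- (c ord0)^-1) * (iota (c (lift ord0 i)) * v i).
    rewrite -mulr_sumr; move/eqP: hc; rewrite addrC addr_eq0 => /eqP ->.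
    by rewrite rmorphN fmorphV; field; rewrite fmorph_eq0.
  rewrite e; elim/big_ind: _ => // i _.
  by rewrite mulrA -rmorphM; apply: VM => //; eexists.
move=> i; case: (unliftP ord0 i) => [i' ->|->] //.
move: hc; rewrite c0 rmorph0 mul0r add0r => hc.
exact: (iv (fun i => c (lift ord0 i)) hc i').
Qed.

Lemma dim_le_inj V W N a : a != 0 -> (forall f, V f -> W (a * f)) ->
  dim_le W N -> dim_le V N.
Proof.
move=> a0 VW hW n v Vv iv; apply: (hW n (fun i => a * v i)) => [i|c hc].
  exact: VW.
apply: iv; apply: (mulfI a0); rewrite mulr0 -[RHS]hc mulr_sumr.
by apply: eq_bigr => i _; rewrite mulrCA.
Qed.

End Dimension.

Section Divisors.
Variables (k : closedFieldType) (K : fieldType) (iota : {rmorphism k -> K}).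
Variables (C : set (set K)) (hC : smooth_projective_curve iota C).
Local Notation closed := (closed_points C).
Let sR R (hR : closed R) : is_subring R := curve_subring hC hR.1.
Local Notation dim_le := (dim_le iota).
Local Notation dim_ge := (dim_ge iota).

Definition rr_space (A : set K -> int) : set K :=
  [set f | forall R, closed R -> ordge R (- A R) f].

Lemma rr_space_submodule A : is_submodule (range iota) (rr_space A).
Proof.
split.
- by move=> R hR; exact: (ordge_0 hC).
- by move=> a b ha hb R hR; apply: (ordgeD hC hR); [exact: ha|exact: hb].
- move=> _ a [c _ <-] ha R hR; apply: (ordgeMl hC hR); last exact: ha.
  exact: (curve_const hC _ hR.1).
Qed.

Lemma rr_space_sub A B : (forall R, closed R -> A R <= B R) ->
  rr_space A `<=` rr_space B.
Proof.
by move=> AB f hf R hR; apply: (ordge_weaken hC hR _ (hf R hR)); rewrite lerN2 AB.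
Qed.

Lemma rr_space_eq A B : (forall R, closed R -> A R = B R) -> rr_space A = rr_space B.
Proof.
by move=> AB; apply/seteqP; split; apply: rr_space_sub => R hR; rewrite AB.
Qed.

(* Multiplication by a regular form embeds the regular functions in H^0(Omega). *)
Lemma dim_rr_space0 g : has_genus iota C g -> (0 < g)%N -> dim_le (rr_space (fun=> 0)) g.
Proof.
move=> [w [wreg wind wgen]] g0 n v hv iv.
pose i0 : 'I_g := Ordinal g0.
have [d hd wd] : exists2 d, derivation iota d & w i0 d != 0.
  apply: contrapT => h.
  suff : (i0 == i0)%:R = 0 :> k by rewrite eqxx => /eqP; rewrite oner_eq0.
  apply: (wind (fun i => (i == i0)%:R)) => d hd.
  rewrite (bigD1 i0) //= big1 => [|i /negPf->]; last by rewrite rmorph0 mul0r.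
  rewrite ?eqxx ?mulr1n rmorph1 mul1r addr0; apply/eqP; apply: contrapT => /negP wd.
  by apply: h; exists d.
have reg i : regular_form iota C (fun d => v i * w i0 d).
  move=> R hR; have [t [r [ht Rr e]]] := wreg i0 R hR.
  exists t, (v i * r); split=> //.
    by apply: (subringM (sR hR)) => //; have := hv i R hR; rewrite oppr0 ordge0.
  by move=> d' hd'; rewrite (e d' hd') /adb; ring.
have /choice[c hc] : forall i, exists c : 'I_g -> k,
   eq_form iota (fun d => v i * w i0 d) (fun d => \sum_j iota (c j) * w j d).
  by move=> i; exact: wgen.
rewrite leqNgt; apply/negP => gn.
pose M := \matrix_(i < n, j < g) c i j.
have : kermx M != 0.
  by rewrite kermx_eq0 -row_leq_rank -ltnNge (leq_ltn_trans (rank_leq_col M)).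
move=> /eqP; apply; apply/matrixP => i j; rewrite [RHS]mxE.
apply: (iv (fun j => kermx M i j)) => {j}; apply: (mulIf wd); rewrite mul0r mulr_suml.
under eq_bigr => j _ do rewrite -mulrA (hc j d hd) mulr_sumr.
rewrite exchange_big big1 //= => l _.
under eq_bigr => j _ do rewrite mulrA -rmorphM.
rewrite -mulr_suml -rmorph_sum /=.
have := mulmx_ker M => /matrixP/(_ i l); rewrite !mxE => e.
rewrite [X in iota X](_ : _ = 0) ?rmorph0 ?mul0r // -[RHS]e.
by apply: eq_bigr => j _; rewrite !mxE.
Qed.

Local Notation cnt s := (fun R => (count_mem R s)%:Z).

Lemma dim_le_rr_seq A (s : seq (set K)) N : {in s, forall R, closed R} ->
  dim_le (rr_space A) N -> dim_le (rr_space (fun R => A R + (count_mem R s)%:Z)) (N + size s).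
Proof.
move=> hs hA; elim: s hs => [|P s IH] hs.
  rewrite addn0 (@rr_space_eq _ A) // => R _; by rewrite addr0.
rewrite /= addnS.
have hs1 : {in s, forall R, closed R} by move=> R' h; apply: hs; rewrite inE h orbT.
have hP : closed P by apply: hs; rewrite inE eqxx.
apply: dim_le_step (IH hs1); first exact: rr_space_submodule.
  by apply: rr_space_sub => R hR; rewrite /= lerD2l lez_nat leq_addl.
move=> w w' hw hw' nw.
have key R : closed R -> R <> P -> forall f,
   rr_space (fun R : set K => A R + ((P == R) + count_mem R s)%N%:Z) f ->
   ordge R (- (A R + (count_mem R s)%:Z)) f.
  by move=> hR RP f /(_ R hR); case: eqP => // e; case: RP.
have w'P : ~ ordge P (- (A P + (count_mem P s)%:Z)) w'.
  move=> h; apply: nw => R hR; have [->//|RP] := pselect (R = P); exact: key.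
have := hw P hP; have := hw' P hP; rewrite eqxx => h' h.
have e : - (A P + (count_mem P s)%:Z) = - (A P + (true + count_mem P s)%N%:Z) + 1 by lia.
have [|c hc] := ordge_step hC hP h h'; first by rewrite -e.
exists c => R hR; have [->|RP] := pselect (R = P); first by rewrite e.
apply: (ordgeB hC hR); first exact: key.
by apply: (ordgeMl hC hR); [exact: (curve_const hC _ hR.1)|exact: key].
Qed.

(** Here [s0] is the whole divisor and [s] the part still to be added back. Stating the functions u
    relative to [s0] lets one family serve every stage: u with the right b has exactly the order
    that the next copy of P newly allows. *)
Lemma dim_ge_rr_seq A (s0 s : seq (set K)) N :
  {in s, forall R, closed R} ->
  (forall P (b : nat), P \in s0 -> (b < size s0)%N -> exists u,
    [/\ ordge P (- A P + b%:Z) u, ~ ordge P (- A P + b%:Z + 1) u &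
     forall R, closed R -> R <> P -> ordge R (- A R + (count_mem R s0)%:Z) u]) ->
  (forall R, count_mem R s <= count_mem R s0)%N ->
  dim_ge (rr_space (fun R => A R - (count_mem R s)%:Z)) N ->
  dim_ge (rr_space A) (N + size s).
Proof.
move=> hs hu hcount; elim: s hs hcount N => [|P s IH] hs hcount N hN.
  rewrite addn0; rewrite (@rr_space_eq A (fun R => A R - 0)) // => R _; by rewrite subr0.
have hs1 : {in s, forall R, closed R} by move=> R' h; apply: hs; rewrite inE h orbT.
have hP : closed P by apply: hs; rewrite inE eqxx.
rewrite /= addnS -addSn; apply: IH => //.
  by move=> R; apply: leq_trans (hcount R); rewrite /= leq_addl.
have P0 : P \in s0 by rewrite -has_pred1 has_count (leq_trans _ (hcount P)) //= eqxx.
have bs : (count_mem P s < size s0)%N.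
  by apply: leq_trans (count_size (pred1 P) s0); apply: leq_trans (hcount P); rewrite /= eqxx.
have [u [u1 u2 u3]] := hu P (count_mem P s) P0 bs.
apply: (dim_ge_step (u := u) _ _ _ _ hN); first exact: rr_space_submodule.
- by apply: rr_space_sub => R hR; rewrite lerD2l lerN2 /=; lia.
- move=> R hR; have [->|RP] := pselect (R = P); first by rewrite opprB addrC.
  apply: (ordge_weaken hC hR _ (u3 R hR RP)).
  rewrite opprB addrC lerD2l lez_nat; apply: leq_trans (hcount R); exact: leq_addl.
- move=> /(_ P hP); rewrite /= eqxx => h; apply: u2.
  apply: (ordge_weaken hC hP _ h); rewrite -[(true + _)%N]/(count_mem P s).+1.
  by move: (A P) (count_mem P s) => a c; lia.
Qed.

Lemma divisor_seqs (D : set K -> int) : is_divisor C D ->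
  exists sp sn : seq (set K), [/\ {in sp, forall R, closed R}, {in sn, forall R, closed R},
    (forall R, closed R -> D R = (count_mem R sp)%:Z - (count_mem R sn)%:Z) &
    degree C D = (size sp)%:Z - (size sn)%:Z].
Proof.
move=> /finite_seqP[r0 er0]; pose r := undup r0.
have er : [set R | closed R /\ D R != 0] = [set` r].
  by rewrite er0; apply/seteqP; split=> R /=; rewrite mem_undup.
have rP R : R \in r <-> closed R /\ D R != 0.
  by split=> [h|h]; [have : [set` r] R by []|have : [set R | closed R /\ D R != 0] R by []];
    rewrite ?er // -er.
have -> : degree C D = \sum_(R <- r) D R.
  rewrite /degree (fsbigE r) ?undup_uniq //.
  - rewrite big_seq_cond [RHS]big_seq; apply: eq_bigl => R.
    by case: (boolP (R \in r)) => //= /rP[h _]; apply/mem_set.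
  - by move=> R /rP[].
  - move=> R hR; move=> nr; apply/eqP; apply: contrapT => /negP h.
    by move/negP: nr; apply; apply/rP.
suff [sp [sn [h1 h2 h3 h4 h5]]] : exists sp sn : seq (set K), [/\ {subset sp <= r},
   {subset sn <= r},
   {in r, forall R, D R = (count_mem R sp)%:Z - (count_mem R sn)%:Z},
    (forall R, R \notin r -> count_mem R sp = 0%N /\ count_mem R sn = 0%N) &
    \sum_(R <- r) D R = (size sp)%:Z - (size sn)%:Z].
  exists sp, sn; split=> //.
  - by move=> R /h1/rP[].
  - by move=> R /h2/rP[].
  - move=> R hR; have [/h3//|nr] := boolP (R \in r).
    have [-> ->] := h4 _ nr; apply/eqP; rewrite subr0; apply: contrapT => /negP h.
    by move/negP: nr; apply; apply/rP.
have := undup_uniq r0; rewrite -/r; elim: (r) => [|R0 s IH] /=.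
  by move=> _; exists [::], [::]; split=> //; rewrite big_nil.
move=> /andP[R0s us]; have [sp [sn [h1 h2 h3 h4 h5]]] := IH us.
have [e1 e2] := h4 _ R0s.
have [a [b [ab abD]]] : exists a b : nat, D R0 = a%:Z - b%:Z /\ True.
  by case: (D R0) => n; [exists n, 0%N|exists 0%N, n.+1]; split => //; lia.
exists (nseq a R0 ++ sp), (nseq b R0 ++ sn); split.
- move=> R; rewrite mem_cat mem_nseq inE => /orP[/andP[_ ->]//|/h1->].
  by rewrite orbT.
- move=> R; rewrite mem_cat mem_nseq inE => /orP[/andP[_ ->]//|/h2->].
  by rewrite orbT.
- move=> R; rewrite inE !count_cat !count_nseq /= => /predU1P[->|Rs].
    by rewrite eqxx e1 e2 ab; lia.
  have RR : (R0 == R) = false by apply/negP => /eqP e; move: R0s; rewrite e Rs.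
  by rewrite RR (h3 _ Rs).
- move=> R; rewrite inE negb_or !count_cat !count_nseq /= => /andP[RR0 Rs].
  by have [-> ->] := h4 _ Rs; rewrite eq_sym (negPf RR0).
- by rewrite big_cons h5 ab !size_cat !size_nseq; lia.
Qed.

Lemma count_flatten_ge (T U : eqType) (f : U -> seq T) (r : seq U) x R :
  x \in r -> (count_mem R (f x) <= count_mem R (flatten (map f r)))%N.
Proof.
elim: r => // y r IH; rewrite inE /= count_cat => /predU1P[->|/IH]; first exact: leq_addr.
by move=> h; apply: leq_trans h (leq_addl _ _).
Qed.

(* With L(A) = [rr_space A], multiplication by kappa embeds L(A) in L(A - D), while
   dim L(A) - dim L(A - D) = deg D once A allows enough poles. *)
Lemma principal_divisor_degree g (D : set K -> int) kappa : has_genus iota C g -> (0 < g)%N ->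
  is_divisor C D -> 0 < degree C D ->
  (forall R, closed R -> ordge R (D R) kappa) -> kappa = 0.
Proof.
move=> hg g0 hD degD hkappa; have [//|kappa0] := eqVneq kappa 0; exfalso.
have [sp [sn [hsp hsn eD edeg]]] := divisor_seqs hD.
have size_gt : (size sn < size sp)%N by lia.
have /choice[u hu] : forall Pb : set K * nat, exists u, Pb.1 \in sp ->
    [/\ ordge Pb.1 Pb.2%:Z u, ~ ordge Pb.1 (Pb.2%:Z + 1) u &
    {in sp, forall R, R <> Pb.1 -> ordge R (size sp)%:Z u}].
  move=> [P b] /=; have [Psp|nP] := boolP (P \in sp); last by exists 0.
  by have [u hu] := weak_approximation hC b%:Z (size sp)%:Z (hsp _ Psp) hsp; exists u.
have /choice[S hS] : forall f, exists S : seq (set K), {in S, forall R, closed R} /\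
  forall R, closed R -> ordge R (- (count_mem R S)%:Z) f /\ (R f -> R \notin S).
  by move=> f; have [S h1 h2] := poles_seq hC f; exists S.
(* The approximating functions for all points of [sp] and all orders below its length. Their poles
   outside [sp] form the list [a], hence the divisor A: it admits all of them without changing
   orders along [sp]. *)
pose us := [seq u (P, b) | P <- sp, b <- index_iota 0 (size sp)].
pose a := [seq R <- flatten [seq S f | f <- us] | R \notin sp].
have aE R : count_mem R a =
    if R \in sp then 0%N else count_mem R (flatten [seq S f | f <- us]).
  rewrite /a count_filter; case: ifPn => Rsp.
    apply/eqP; rewrite -leqn0 -(count_pred0 (flatten [seq S f | f <- us])).
    by apply: sub_count => x /= /andP[/eqP-> /negP].
  by apply: eq_count => x /=; case: eqP => // ->.
have ha : {in a, forall R, closed R}.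
  move=> R; rewrite mem_filter => /andP[_ /flattenP[_ /mapP[f _ ->]]].
  by have [h _] := hS f; exact: h.
pose A R := (count_mem R a)%:Z.
have dimA : dim_le (rr_space A) (g + size a).
  rewrite (@rr_space_eq A (fun R => 0 + A R)); last by move=> R _; rewrite add0r.
  by apply: dim_le_rr_seq => //; exact: dim_rr_space0.
have sub0 : rr_space (fun R => A R - (count_mem R sp)%:Z) `<=` rr_space A.
  by apply: rr_space_sub => R _; rewrite /A; lia.
have [N leN geN] := dim_exact (dim_leW sub0 dimA).
have : dim_ge (rr_space A) (N + size sp).
  apply: (dim_ge_rr_seq (s0 := sp) hsp _ _ geN) => // P b Psp bsp.
  exists (u (P, b)); have [u1 u2 u3] := hu (P, b) Psp.
  rewrite /A aE Psp oppr0 add0r; split=> // R hR RP; rewrite aE.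
  case: ifPn => Rsp.
    rewrite oppr0 add0r; apply: (ordge_weaken hC hR _ (u3 R Rsp RP)).
    by rewrite lez_nat count_size.
  have -> : count_mem R sp = 0%N by apply/count_memPn.
  rewrite addr0; have [_ /(_ R hR)[h _]] := hS (u (P, b)).
  apply: (ordge_weaken hC hR _ h); rewrite lerN2 lez_nat.
  apply: count_flatten_ge; apply: allpairs_f => //.
  by rewrite mem_index_iota.
move=> [v [hv iv]].
(* Since kappa L(A) lies in L(A - D), the count N + [size sp] found in L(A) is at most N +
   [size sn], which contradicts a positive degree. *)
have /(_ _ v hv iv) : dim_le (rr_space A) (N + size sn).
  apply: (dim_le_inj kappa0) (dim_le_rr_seq hsn leN) => f hf R hR.
  apply: (ordge_weaken hC hR _ (ordgeM hC hR (hkappa R hR) (hf R hR))).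
  by rewrite (eD R hR); lia.
by rewrite leq_add2l leqNgt size_gt.
Qed.

(** The condition at R says that kappa lies in the stalk of O(B)^-d, hence has order at least d B
    there. *)
Lemma negative_sections_zero g (B : set K -> int) (d : nat) kappa :
  has_genus iota C g -> (0 < g)%N -> is_divisor C B -> 0 < degree C B -> (0 < d)%N ->
  (forall R, closed R -> exists2 b, b != 0 /\ O_ B R = [set r * b | r in R] &
     R (kappa * b ^+ d)) -> kappa = 0.
Proof.
move=> hg g0 hB degB d0 hkappa.
apply: (@principal_divisor_degree g (fun R => d%:Z * B R)) => //.
- move: hB; apply: sub_finite_set => R [hR]; rewrite mulf_eq0 negb_or => /andP[_ ?].
  by split.
- by rewrite /degree -mulr_fsumr mulr_gt0 //; lia.
move=> R hR; have [b [b0 eb] hb] := hkappa R hR.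
have : O_ B R (unif R ^ (- B R)).
  right; exists (unif R), 1; rewrite mul1r; split=> //; last exact: (subring1 (sR hR)).
  exact: (unifP hC).
rewrite eb => -[r Rr er].
have -> : kappa = kappa * b ^+ d * b^-1 ^+ d.
  by rewrite exprVn mulfK // expf_neq0.
apply: (ordgeMl hC hR) => //.
have -> : d%:Z * B R = B R *+ d by rewrite -mulr_natl natz.
apply: (ordgeX hC hR); exists r => //.
by rewrite -[B R in RHS]opprK -invr_expz -er; field; rewrite b0; apply: contraTneq (expfz_neq0 (-
  B R) (unif_neq0 hC hR)) => e; rewrite -er e mul0r eqxx.
Qed.

End Divisors.

(** To be applied to the ring of cubes, the result serving as the constants of a derivation. Taking
    unions with S again takes care of the empty chain. *)
Lemma maximal_subring_avoiding (F : fieldType) (S : set F) f : is_subring S -> ~ S f ->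
  exists M, [/\ is_subring M, S `<=` M, ~ M f &
    forall N, is_subring N -> M `<=` N -> ~ N f -> N `<=` M].
Proof.
move=> hS Sf.
pose P X := is_subring (X `|` S) /\ ~ (X `|` S) f.
have [G GP Gtot|X [[hX Xf] Xmax]] := @Zorn_bigcup F P.
  split; last first.
    by move=> [[X GX Xf]|//]; have [_ []] := GP _ GX; left.
  have two x y : (\bigcup_(X in G) X `|` S) x -> (\bigcup_(X in G) X `|` S) y ->
     exists Y, [/\ is_subring (Y `|` S), (Y `|` S) `<=` \bigcup_(X in G) X `|` S,
        (Y `|` S) x & (Y `|` S) y].
    have up X : G X -> X `|` S `<=` \bigcup_(X in G) X `|` S.
      by move=> GX z [Xz|]; [left; exists X|right].
    move=> [[X GX Xx]|Sx] [[Y GY Yy]|Sy].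
    - have [XY|YX] := Gtot _ _ GX GY.
        exists Y; split; [by case: (GP _ GY)|exact: up|by left; apply: XY|by left].
      exists X; split; [by case: (GP _ GX)|exact: up|by left|by left; apply: YX].
    - exists X; split; [by case: (GP _ GX)|exact: up|by left|by right].
    - exists Y; split; [by case: (GP _ GY)|exact: up|by right|by left].
    - exists set0; rewrite set0U; split=> //; by move=> z Sz; right.
  apply/is_subringP; split; first by right; exact: subring1.
    by move=> x y hx hy; have [Y [hY up Yx Yy]] := two x y hx hy; apply: up; apply: subringB.
  by move=> x y hx hy; have [Y [hY up Yx Yy]] := two x y hx hy; apply: up; apply: subringM.
exists (X `|` S); split=> // N hN XN Nf x Nx.
have NS : N `|` S = N by apply/seteqP; split=> z; [case=> // Sz; apply: XN; right|left].
apply: contrapT => nXx; apply: (Xmax N); last by rewrite /P NS.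
split=> [z Xz|NX]; first by apply: XN; left.
by apply: nXx; left; apply: NX.
Qed.

(** * Derivations in characteristic 3 *)

Section Char3.
Variables (k : closedFieldType) (K : fieldType) (iota : {rmorphism k -> K}).
Hypothesis char3 : 3%N \in [pchar k].

Let three0 : 3%:R = 0 :> K.
Proof. by rewrite -(rmorph_nat iota) (pcharf0 char3) rmorph0. Qed.

Lemma closed_cube_root (c : k) : exists d, c = d ^+ 3.
Proof.
have /closed_rootP[d] : size ('X^3 - c%:P : {poly k}) != 1%N by rewrite size_XnsubC.
by rewrite rootE !hornerE subr_eq0 => /eqP<-; exists d.
Qed.

(* With [M] maximal among the subrings containing the cubes but not [f],
   [K = M + M f + M f^2], and [d/df] is a derivation over [M]. *)
Lemma derivation_of_noncube f : (forall u, f <> u ^+ 3) ->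
  exists2 d, derivation iota d & d f != 0.
Proof.
move=> fcube; pose S : set K := [set u ^+ 3 | u in setT].
have hS : is_subring S.
  apply/is_subringP; split.
  - by exists 1; rewrite ?expr1n.
  - move=> _ _ [x _ <-] [y _ <-]; exists (x - y) => //.
    have -> : (x - y) ^+ 3 = x ^+ 3 - y ^+ 3 + 3%:R * (x * y ^+ 2 - x ^+ 2 * y) by ring.
    by rewrite three0 mul0r addr0.
  - by move=> _ _ [x _ <-] [y _ <-]; exists (x * y) => //; rewrite exprMn.
have Sf : ~ S f by move=> [u _ e]; exact: (fcube u).
have [M [hM SM Mf Mmax]] := maximal_subring_avoiding hS Sf.
have Mcube u : M (u ^+ 3) by apply: SM; exists u.
(* Containing all cubes, M is a field. *)
have MV x : M x -> M x^-1.
  move=> Mx; have [->|x0] := eqVneq x 0; first by rewrite invr0; exact: subring0.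
  have -> : x^-1 = x ^+ 2 * (x^-1) ^+ 3 by field.
  by apply: subringM => //; apply: subringX.
have MM x y : M x -> M y -> M (x * y) by exact: subringM.
have MD x y : M x -> M y -> M (x + y) by exact: subringD.
have MB x y : M x -> M y -> M (x - y) by exact: subringB.
have M0 := subring0 hM; have M1 := subring1 hM.
pose rep x a b c := [/\ M a, M b, M c & x = a + b * f + c * f ^+ 2].
have span x : exists a b c, rep x a b c.
  have [Mx|nMx] := pselect (M x).
    by exists x, 0, 0; split=> //; rewrite !mul0r !addr0.
  pose N := [set z | exists a b c, [/\ M a, M b, M c & z = a + b * x + c * x ^+ 2]].
  have hN : is_subring N.
    apply/is_subringP; split.
    - by exists 1, 0, 0; split=> //; rewrite !mul0r !addr0.
    - move=> _ _ [a [b [c [Ma Mb Mc ->]]]] [a' [b' [c' [Ma' Mb' Mc' ->]]]].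
      by exists (a - a'), (b - b'), (c - c'); split; [exact: MB|exact: MB|exact: MB|ring].
    - move=> _ _ [a [b [c [Ma Mb Mc ->]]]] [a' [b' [c' [Ma' Mb' Mc' ->]]]].
      have Mx3 := Mcube x.
      exists (a * a' + (b * c' + c * b') * x ^+ 3),
        (a * b' + b * a' + c * c' * x ^+ 3), (a * c' + b * b' + c * a').
      by split; [do ![assumption|apply: (MD)|apply: (MM)]|do ![assumption|apply: (MD)|apply: (MM)]|
        do ![assumption|apply: (MD)|apply: (MM)]|ring].
  have MN : M `<=` N.
    by move=> z Mz; exists z, 0, 0; split=> //; rewrite !mul0r !addr0.
  have [a [b [c [Ma Mb Mc ef]]]] : N f.
    apply: contrapT => nNf; apply: nMx; apply: (Mmax N) => //.
    by exists 0, 1, 0; split=> //; ring.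
  have [c0|c0] := eqVneq c 0.
    have b0 : b != 0.
      by apply: contra_notN Mf => /eqP b0; rewrite ef b0 c0 !mul0r !addr0.
    exists (- a / b), b^-1, 0; split=> //.
    - by apply: (MM); [rewrite -sub0r; exact: MB|exact: MV].
    - exact: MV.
    - by rewrite ef c0; field.
  (* By maximality f = a + b x + c x^2 over M. As 2 = -1, this y completes the square and y^2 = f /
     c + g; then y = (y^2)^2 / y^3 is quadratic in f, since y^3 lies in M. *)
  pose y := x - b / c.
  have My3 := Mcube y.
  have y0 : y != 0.
    apply: contra_notN nMx => /eqP; rewrite /y => /eqP; rewrite subr_eq0 => /eqP ->.
    by apply: (MM) => //; exact: MV.
  pose g := (b ^+ 2 / c - a) / c; pose i := c^-1.
  have ey : y ^+ 2 = i * f + g.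
    have -> : i * f + g = y ^+ 2 + 3%:R * (x * b / c) by rewrite /i /g /y ef; field.
    by rewrite three0 mul0r addr0.
  have Mi : M i by exact: MV.
  have Mg : M g by do ![assumption|apply: (MM)|apply: (MB)|apply: (MV)].
  have MVy : M (y ^+ 3)^-1 by exact: MV.
  exists (b / c + g ^+ 2 * (y ^+ 3)^-1), ((i * g + g * i) * (y ^+ 3)^-1),
    (i * i * (y ^+ 3)^-1).
  split; [by do ![assumption|apply: (MD)|apply: (MM)|apply: (MV)]|by do ![assumption|apply:
    (MD)|apply: (MM)]|
    by do ![assumption|apply: (MD)|apply: (MM)]|].
  have -> : x = b / c + y ^+ 2 ^+ 2 * (y ^+ 3)^-1.
    have -> : y ^+ 2 ^+ 2 * (y ^+ 3)^-1 = y by field.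
    by rewrite /y; ring.
  by rewrite ey; ring.
have sq y : y ^+ 2 = 0 \/ M (y ^+ 2) -> M y.
  move=> h; have [->//|y0] := eqVneq y 0.
  have hy : M (y ^+ 2) by case: h => // ->.
  have -> : y = y ^+ 3 * (y ^+ 2)^-1 by field.
  by apply: (MM) => //; exact: MV.
have indep a b c : M a -> M b -> M c -> a + b * f + c * f ^+ 2 = 0 ->
    [/\ a = 0, b = 0 & c = 0].
  move=> Ma Mb Mc e.
  have c0 : c = 0.
    apply: contrapT => /eqP c0; apply: Mf.
    have -> : f = (f - b / c) + b / c by ring.
    apply: (MD); last by apply: (MM) => //; exact: MV.
    (* A quadratic relation for f puts the square of f - b / c in M, and z = z^3 / z^2 brings the
       root of a square of M back into M. *)
    apply: sq; right.
    have -> : (f - b / c) ^+ 2 = (b / c) ^+ 2 - a / c + (a + b * f + c * f ^+ 2) / c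
       - 3%:R * (f * b / c) by field.
    rewrite e three0 !mul0r addr0 subr0.
    apply: (MB); last by apply: (MM) => //; exact: MV.
    by apply: subringX => //; apply: (MM) => //; exact: MV.
  move: e; rewrite c0 mul0r addr0 => e.
  have b0 : b = 0.
    apply: contrapT => /eqP b0; apply: Mf.
    have -> : f = - a / b + (a + b * f) / b by field.
    rewrite e mul0r addr0; apply: (MM); [rewrite -sub0r; exact: MB|exact: MV].
  by move: e; rewrite b0 mul0r addr0.
have /choice[d hd] : forall x, exists dx, forall a b c, rep x a b c -> dx = b + c * f *+ 2.
  move=> x; have [a [b [c [Ma Mb Mc e]]]] := span x; exists (b + c * f *+ 2).
  move=> a' b' c' [Ma' Mb' Mc' e'].
  have [||||_ /eqP + /eqP] := @indep (a - a') (b - b') (c - c'); [exact: MB|exact: MB|exact: MB| |].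
    have -> : a - a' + (b - b') * f + (c - c') * f ^+ 2 = x - x by rewrite {1}e e'; ring.
    by rewrite subrr.
  by rewrite !subr_eq0 => /eqP -> /eqP ->.
exists d; last by rewrite (hd f 0 1 0) ?mul0r ?mul0rn ?addr0 ?oner_neq0 //; split=> //; ring.
split.
- move=> x y; have [a [b [c rx]]] := span x; have [a' [b' [c' ry]]] := span y.
  rewrite (hd _ _ _ _ rx) (hd _ _ _ _ ry).
  have [Ma Mb Mc ex] := rx; have [Ma' Mb' Mc' ey] := ry.
  rewrite (hd (x + y) (a + a') (b + b') (c + c')); first by ring.
  by split; [exact: MD|exact: MD|exact: MD|rewrite ex ey; ring].
- move=> x y; have [a [b [c rx]]] := span x; have [a' [b' [c' ry]]] := span y.
  rewrite (hd _ _ _ _ rx) (hd _ _ _ _ ry).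
  have [Ma Mb Mc ex] := rx; have [Ma' Mb' Mc' ey] := ry.
  have Mf3 := Mcube f.
  rewrite (hd (x * y) (a * a' + (b * c' + c * b') * f ^+ 3)
    (a * b' + b * a' + c * c' * f ^+ 3) (a * c' + b * b' + c * a')).
    rewrite {1}ex {1}ey; apply/eqP; rewrite -subr_eq0; apply/eqP.
    rewrite -[RHS](mul0r (- (b * c' + c * b') * f ^+ 2 - c * c' * f ^+ 3)) -three0.
    by ring.
  by split; [do ![assumption|apply: (MD)|apply: (MM)]|do ![assumption|apply: (MD)|apply: (MM)]|
        do ![assumption|apply: (MD)|apply: (MM)]|rewrite ex ey; ring].
(* Constants of k are cubes, k being closed, and cubes lie in M. *)
- move=> c; have [u ->] := closed_cube_root c.
  rewrite (hd _ (iota (u ^+ 3)) 0 0) ?mul0r ?mul0rn ?addr0 //.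
  by split=> //; [rewrite rmorphXn; exact: Mcube|rewrite !mul0r !addr0].
Qed.

End Char3.

(** * Invertible modules and the charts of X *)

Section Lines.
Variables (F : fieldType).
Implicit Types (Q : set F).

Definition line Q (g : F) : set F := [set r * g | r in Q].

Lemma lineP Q g x : line Q g x <-> exists2 r, Q r & x = r * g.
Proof. by split=> [[r Qr <-]|[r Qr ->]]; exists r. Qed.

Lemma line1 Q : line Q 1 = Q.
Proof.
apply/seteqP; split=> x; first by move=> /lineP[r Qr ->]; rewrite mulr1.
by move=> Qx; exists x; rewrite ?mulr1.
Qed.

Section Theory.
Variables (Q : set F) (hQ : is_subring Q).

Lemma line_gen g : line Q g g.
Proof. by exists 1; rewrite ?mul1r //; exact: subring1. Qed.

Lemma lineD g x x' : line Q g x -> line Q g x' -> line Q g (x + x').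
Proof.
move=> /lineP[r Qr ->] /lineP[r' Qr' ->]; rewrite -mulrDl; exists (r + r') => //.
exact: subringD.
Qed.

Lemma lineB g x x' : line Q g x -> line Q g x' -> line Q g (x - x').
Proof.
move=> /lineP[r Qr ->] /lineP[r' Qr' ->]; rewrite -mulrBl; exists (r - r') => //.
exact: subringB.
Qed.

Lemma line_mul g r x : Q r -> line Q g x -> line Q g (r * x).
Proof.
by move=> Qr /lineP[r' Qr' ->]; rewrite mulrA; exists (r * r') => //; exact: subringM.
Qed.

Lemma line_submodule g : is_submodule Q (line Q g).
Proof.
split.
- by exists 0; rewrite ?mul0r //; exact: subring0.
- by move=> a b; exact: lineD.
- by move=> r a; exact: line_mul.
Qed.

Lemma line_eq g g' : g != 0 -> line Q g = line Q g' ->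
  exists u, [/\ Q u, Q u^-1, u != 0 & g' = u * g].
Proof.
move=> g0 e; have /lineP[u Qu eu] : line Q g g' by rewrite e; exact: line_gen.
have /lineP[u' Qu' eu'] : line Q g' g by rewrite -e; exact: line_gen.
have uu : u' * u = 1 by apply: (mulIf g0); rewrite mul1r -mulrA -eu -eu'.
have u0 : u != 0 by apply: contra_eq_neq uu => ->; rewrite mulr0 eq_sym oner_neq0.
exists u; split=> //; have -> : u^-1 = u' by rewrite -(mulfK u0 u') uu div1r.
by [].
Qed.

Lemma unit_expz u (n : int) : Q u -> Q u^-1 -> Q (u ^ n).
Proof.
move=> Qu Qi; case: n => n; first exact: subringX.
by rewrite NegzE -invr_expz -exprnP -exprVn; exact: subringX.
Qed.

Lemma tpow_line g n : g != 0 -> tpow Q (line Q g) n = line Q (g ^ n).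
Proof.
move=> g0; apply/seteqP; split=> x.
  move=> [g' [g'0 e [r Qr ->]]].
  have [u [Qu Qui u0 ->]] := line_eq g0 e.
  rewrite expfzMl mulrA; exists (r * u ^ n) => //.
  by apply: subringM => //; exact: unit_expz.
by move=> /lineP[r Qr ->]; exists g; split=> //; exists r.
Qed.

Lemma span_sub S M : is_submodule Q M -> S `<=` M -> span Q S `<=` M.
Proof. by move=> hM SM x; apply; split. Qed.

Lemma tensor_line g g' : tensor Q (line Q g) (line Q g') = line Q (g * g').
Proof.
apply/seteqP; split.
  apply: span_sub; first exact: line_submodule.
  move=> _ [_ [_ [/lineP[r Qr ->] /lineP[r' Qr' ->] ->]]].
  by exists (r * r'); [exact: subringM|ring].
move=> _ /lineP[r Qr ->] M [[_ _ MM] hM]; apply: MM => //; apply: hM.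
by exists g, g'; split=> //; exact: line_gen.
Qed.

(* The ring Q[w] when w^l lies in Q. *)
Definition cyclic_ext l w : set F :=
  [set x | exists r : 'I_l -> F, (forall i, Q (r i)) /\ x = \sum_(i < l) r i * w ^+ i].

Lemma cyclic_ext_monomial l w i r : (0 < l)%N -> Q (w ^+ l) -> Q r ->
  cyclic_ext l w (r * w ^+ i).
Proof.
move=> l0 Ql Qr.
have il : (i %% l < l)%N by rewrite ltn_mod.
exists (fun i' => if i' == Ordinal il then r * (w ^+ l) ^+ (i %/ l) else 0); split.
  move=> i'; case: ifP => _; last exact: subring0.
  by apply: subringM => //; exact: subringX.
rewrite (bigD1 (Ordinal il)) //= eqxx big1 => [|i' /negPf->]; last by rewrite mul0r.
by rewrite addr0 -mulrA -exprM -exprD {1}(divn_eq i l) [(l * _)%N]mulnC.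
Qed.

Lemma cyclic_extD l w x x' : cyclic_ext l w x -> cyclic_ext l w x' ->
  cyclic_ext l w (x + x').
Proof.
move=> [r [Qr ->]] [r' [Qr' ->]]; exists (fun i => r i + r' i); split.
  by move=> i; exact: subringD.
by rewrite -big_split; apply: eq_bigr => i _; rewrite mulrDl.
Qed.

Lemma cyclic_ext_subring l w : (0 < l)%N -> Q (w ^+ l) -> is_subring (cyclic_ext l w).
Proof.
move=> l0 Ql; apply/is_subringP; split.
- have := cyclic_ext_monomial 0 l0 Ql (subring1 hQ).
  by rewrite mul1r expr0.
- move=> _ _ [r [Qr ->]] [r' [Qr' ->]]; exists (fun i => r i - r' i); split.
    by move=> i; exact: subringB.
  by rewrite -sumrB; apply: eq_bigr => i _; rewrite mulrBl.
- move=> _ _ [r [Qr ->]] [r' [Qr' ->]]; rewrite mulr_suml.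
  have S0 : cyclic_ext l w 0.
    exists (fun=> 0); split=> [_|]; first exact: subring0.
    by rewrite big1 // => i _; rewrite mul0r.
  elim/big_ind: _ => // [x x'|i _]; first exact: cyclic_extD.
  rewrite mulr_sumr; elim/big_ind: _ => // [x x'|i' _]; first exact: cyclic_extD.
  rewrite mulrACA -exprD; apply: cyclic_ext_monomial => //; exact: subringM.
Qed.

Lemma cyclic_ext_base l w : (0 < l)%N -> Q (w ^+ l) -> Q `<=` cyclic_ext l w.
Proof.
by move=> l0 Ql r Qr; have := cyclic_ext_monomial 0 l0 Ql Qr; rewrite expr0 mulr1.
Qed.

Lemma cyclic_ext_gen l w : (0 < l)%N -> Q (w ^+ l) -> cyclic_ext l w w.
Proof.
move=> l0 Ql; have := cyclic_ext_monomial 1 l0 Ql (subring1 hQ).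
by rewrite expr1 mul1r.
Qed.

Lemma cyclic_ext_sub l w (S : set F) : is_subring S -> Q `<=` S -> S w ->
  cyclic_ext l w `<=` S.
Proof.
move=> hS QS Sw _ [r [Qr ->]]; apply: subring_sum => // i _.
by apply: subringM => //; [exact: QS|exact: subringX].
Qed.

End Theory.

End Lines.

Lemma span_image_line (F F' : fieldType) (f : {rmorphism F' -> F}) (R : set F') (Q : set F) g :
  is_subring R -> is_subring Q -> f @` R `<=` Q ->
  span Q (f @` line R g) = line Q (f g).
Proof.
move=> hR hQ RQ; apply/seteqP; split.
  apply: span_sub; first exact: line_submodule.
  move=> _ [_ /lineP[r Rr ->] <-]; rewrite rmorphM; exists (f r) => //.
  by apply: RQ; exists r.
move=> _ /lineP[r Qr ->] M [[_ _ MM] hM]; apply: MM => //; apply: hM.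
by exists g => //; exact: line_gen.
Qed.

(* One of the two charts of X over the local scheme of R, with [e0], [e1] a basis
   of the stalk of E: the affine scheme of R[v, w]. *)
Section Chart.
Variables (K Om : fieldType) (j : {rmorphism K -> Om}) (C : set (set K)).
Variables (p e l : nat) (B : set K -> int) (E : set K -> set Om) (zeta : Om).
Variables (R : set K) (b : K) (e0 e1 : Om).
Local Notation q := (p.+1 %/ l)%N.
Local Notation n := (b ^+ (e %/ l)).
Definition basis_stalk (R' : set K) : set Om :=
  [set x | exists u u', [/\ R' u, R' u' & x = j u * e0 + j u' * e1]].
Definition chart_v := e1 / e0.
(** The coefficient of [zeta] is the generator of the stalk of M attached to e0 and b, so the cover
    algebra over Q becomes Q[w]. *)
Definition chart_w := e0 ^- q * j n ^+ p * zeta.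
Definition base_ring := gen_subring ((j @` R) `|` [set chart_v]).
Definition chart_ring := gen_subring ((j @` R) `|` ([set chart_v] `|` [set chart_w])).
Hypotheses (CR : C R) (hR : is_subring R) (b0 : b != 0) (e00 : e0 != 0) (l0 : (0 < l)%N).
(** Points of the chart may lie over a generization of R, so b and the basis must trivialize the
    sheaves there too. *)
Hypothesis stalks : forall Q, is_subring Q -> j @` R `<=` Q ->
  O_ B (proj_pt j Q) = line (proj_pt j Q) b /\ E (proj_pt j Q) = basis_stalk (proj_pt j Q).
Hypothesis stalkR : E R = basis_stalk R.
Hypothesis wl : base_ring (chart_w ^+ l).
Local Notation v := chart_v.
Local Notation w := chart_w.

Lemma base_subring : is_subring base_ring.
Proof. exact: gen_subring_subring. Qed.
Lemma chart_subring : is_subring chart_ring.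
Proof. exact: gen_subring_subring. Qed.
Lemma base_const u : R u -> base_ring (j u).
Proof. by move=> Ru; apply: gen_subring_sub; left; exists u. Qed.
Lemma base_v : base_ring v.
Proof. by apply: gen_subring_sub; right. Qed.
Lemma chart_const u : R u -> chart_ring (j u).
Proof. by move=> Ru; apply: gen_subring_sub; left; exists u. Qed.
Lemma chart_v_mem : chart_ring v.
Proof. by apply: gen_subring_sub; right; left. Qed.
Lemma chart_w_mem : chart_ring w.
Proof. by apply: gen_subring_sub; right; right. Qed.
Lemma base_chart : base_ring `<=` chart_ring.
Proof.
apply: gen_subring_min; first exact: chart_subring.
by move=> z [[u Ru <-]|->]; [exact: chart_const|exact: chart_v_mem].
Qed.
Lemma chart_ring_min (S : set Om) : is_subring S -> j @` R `<=` S -> S v -> S w ->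
  chart_ring `<=` S.
Proof.
by move=> hS RS Sv Sw; apply: gen_subring_min => // z [/RS//|[->|->]].
Qed.

Lemma proj_pt_subring Q : is_subring Q -> is_subring (proj_pt j Q).
Proof.
move=> hQ; apply/is_subringP; split.
- by rewrite /proj_pt /= rmorph1; exact: subring1.
- by move=> x y; rewrite /proj_pt /= rmorphB; exact: subringB.
- by move=> x y; rewrite /proj_pt /= rmorphM; exact: subringM.
Qed.

Section Stalk.
Variables (Q : set Om) (hQ : is_subring Q) (RQ : j @` R `<=` Q).

Lemma N_ell_stalk : N_ell B e l (proj_pt j Q) = line (proj_pt j Q) n.
Proof.
have [eB _] := stalks hQ RQ.
by rewrite /N_ell eB tpow_line //; exact: proj_pt_subring.
Qed.

Lemma proj_image : j @` proj_pt j Q `<=` Q.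
Proof. by move=> _ [u Qu <-]. Qed.

Lemma pullback_N_ell : pullback j (N_ell B e l) Q = line Q (j n).
Proof.
rewrite /pullback N_ell_stalk span_image_line //; first exact: proj_pt_subring.
exact: proj_image.
Qed.

Hypothesis Qv : Q v.

Lemma O1_stalk : O1 j E Q = line Q e0.
Proof.
have [_ eE] := stalks hQ RQ.
rewrite /O1 eE; apply/seteqP; split.
  apply: span_sub; first exact: line_submodule.
  move=> _ [u [u' [Qu Qu' ->]]]; exists (j u + j u' * v).
    by apply: subringD => //; apply: subringM.
  by rewrite /chart_v; field.
move=> _ /lineP[r Qr ->] M [[_ _ MM] hM]; apply: MM => //; apply: hM.
exists 1, 0; rewrite rmorph1 rmorph0 mul1r mul0r addr0; split=> //.
  exact: (subring1 (proj_pt_subring hQ)).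
exact: (subring0 (proj_pt_subring hQ)).
Qed.

Lemma cover_stalk : cover_algebra j p e l B E zeta Q = cyclic_ext Q l w.
Proof.
have n0 : n != 0 by rewrite expf_neq0.
have jn0 : j n != 0 by rewrite fmorph_eq0.
have mu0 : e0 ^- q * j n ^+ p != 0 by rewrite mulf_neq0 ?invr_eq0 // expf_neq0.
have eM : M_sheaf j p e l B E Q = line Q (e0 ^- q * j n ^+ p).
  rewrite /M_sheaf O1_stalk tpow_line // /pullback N_ell_stalk.
  rewrite (tpow_line (proj_pt_subring hQ)) // span_image_line //.
  - by rewrite tensor_line // -invr_expz -!exprnP [j (_ ^+ p)]rmorphXn.
  - exact: proj_pt_subring.
  - exact: proj_image.
apply/seteqP; split=> x.
  move=> [m [hm ->]].
  have /choice[r hr] : forall i : 'I_l, exists r, Q r /\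
      m i = r * (e0 ^- q * j n ^+ p) ^+ i.
    by move=> i; have := hm i; rewrite eM tpow_line // => /lineP[r Qr ->]; exists r.
  exists r; split=> [i|]; first by case: (hr i).
  by apply: eq_bigr => i _; case: (hr i) => _ ->; rewrite /chart_w [in RHS]exprMn mulrA.
move=> [r [Qr ->]]; exists (fun i => r i * (e0 ^- q * j n ^+ p) ^+ i); split.
  by move=> i; rewrite eM tpow_line //; exists (r i).
by apply: eq_bigr => i _; rewrite /chart_w [in LHS]exprMn mulrA.
Qed.

Lemma base_sub_Q : base_ring `<=` Q.
Proof. by apply: gen_subring_min => // z [/RQ|->]. Qed.

End Stalk.

(** The image of Q' in P is the localization of R[v] at the trace of Q', and Q' is then a point of
    the cover algebra over it. *)
Lemma chart_points Q' : spec chart_ring Q' ->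
  raynaud_surface j C p e l B E zeta Q'.
Proof.
move=> /(spec_local_over chart_subring)[hQ' hl AQ' hf].
have AQ : base_ring `<=` Q' by move=> z /base_chart; exact: AQ'.
pose Q := fractions_at base_ring Q'.
have hQ : is_subring Q by apply: fractions_at_subring => //; exact: base_subring.
have BQ : base_ring `<=` Q.
  by apply: fractions_at_sub => //; exact: (subring1 base_subring).
have RQ : j @` R `<=` Q by move=> _ [u Ru <-]; apply: BQ; exact: base_const.
have Qv : Q v by apply: BQ; exact: base_v.
have QQ' : Q `<=` Q'.
  by move=> _ [a [c [Ba Bc c0 Qc ->]]]; apply: subringM => //; exact: AQ.
have Qw : Q (w ^+ l) by exact: BQ.
have Q'w : Q' w by apply: AQ'; exact: chart_w_mem.
have loc := fractions_at_local base_subring hQ' hl AQ.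
exists Q.
  exists R, e0; split=> //.
    rewrite stalkR; exists 1, 0; rewrite rmorph1 rmorph0 mul1r mul0r addr0.
    by split=> //; [exact: subring1|exact: subring0].
  set A := gen_subring _; have -> : A = base_ring.
    apply/seteqP; split; apply: gen_subring_min; rewrite ?/A; try exact: gen_subring_subring.
      move=> z [[u Ru <-]|]; first exact: base_const.
      rewrite stalkR => -[_ [u [u' [Ru Ru' ->]]] <-].
      have -> : (j u * e0 + j u' * e1) / e0 = j u + j u' * v by rewrite /chart_v; field.
      apply: (subringD base_subring); first exact: base_const.
      by apply: (subringM base_subring); [exact: base_const|exact: base_v].
    move=> z [Rz|->]; apply: gen_subring_sub; [by left|right].
    exists e1 => //; rewrite stalkR; exists 0, 1; rewrite rmorph1 rmorph0 mul1r mul0r add0r.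
    by split=> //; [exact: subring0|exact: subring1].
  exact: local_over_spec base_subring loc.
have hcyc := cyclic_ext_subring hQ l0 Qw.
rewrite cover_stalk //; apply: local_over_spec => //.
have cycQ' := cyclic_ext_sub hQ' QQ' Q'w.
apply: (local_over_change (B := chart_ring)) => //.
apply: chart_ring_min.
- exact: fractions_at_subring.
- by move=> z /RQ hz; apply: fractions_at_sub => //; [exact: subring1|exact: cyclic_ext_base].
- by apply: fractions_at_sub => //; [exact: subring1|exact: cyclic_ext_base].
- by apply: fractions_at_sub => //; [exact: subring1|exact: cyclic_ext_gen].
Qed.

(** P is covered by the sets where some section f generates O(1); invertibility of e0 / f says that
    Q also lies where e0 does. *)
Lemma points_chart f Q Q' : E R f -> f != 0 ->
  spec (gen_subring ((j @` R) `|` [set x / f | x in E R])) Q ->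
  spec (cover_algebra j p e l B E zeta Q) Q' -> Q (e0 / f)^-1 ->
  spec chart_ring Q'.
Proof.
move=> Ef f0; set A := gen_subring _ => sQ sQ' Qinv.
have hA : is_subring A by exact: gen_subring_subring.
have locQ := spec_local_over hA sQ; have [hQ hl AQ hf] := locQ.
have Ee x : E R x -> A (x / f) by move=> Ex; apply: gen_subring_sub; right; exists x.
have [E0 E1] : E R e0 /\ E R e1.
  rewrite stalkR; split; [exists 1, 0|exists 0, 1]; rewrite rmorph1 rmorph0 !mul1r !mul0r;
    rewrite ?addr0 ?add0r; split=> //; solve [exact: subring1|exact: subring0].
have RA u : R u -> A (j u) by move=> Ru; apply: gen_subring_sub; left; exists u.
have RQ : j @` R `<=` Q by move=> _ [u Ru <-]; apply: AQ; exact: RA.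
have Qv : Q v.
  have -> : v = (e1 / f) * (e0 / f)^-1 by rewrite /chart_v; field; rewrite e00 f0.
  by apply: subringM => //; apply: AQ; exact: Ee.
have BQ := base_sub_Q hQ RQ Qv.
have locB : local_over base_ring Q.
  apply: local_over_change locQ _ => //; first exact: base_subring.
  have hF : is_subring (fractions_at base_ring Q).
    by apply: fractions_at_subring => //; exact: base_subring.
  have BF : base_ring `<=` fractions_at base_ring Q.
    by apply: fractions_at_sub => //; exact: (subring1 base_subring).
  apply: gen_subring_min => // z [[u Ru <-]|[x Ex <-]].
    by apply: BF; exact: base_const.
  have -> : x / f = (x / e0) / (f / e0) by field; rewrite e00 f0.
  have Be x' : E R x' -> base_ring (x' / e0).
    rewrite stalkR => -[u [u' [Ru Ru' ->]]].
    have -> : (j u * e0 + j u' * e1) / e0 = j u + j u' * v by rewrite /chart_v; field.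
    apply: (subringD base_subring); first exact: base_const.
    by apply: (subringM base_subring); [exact: base_const|exact: base_v].
  exists (x / e0), (f / e0); split; [exact: Be|exact: Be| |by rewrite invf_div; apply: AQ; exact:
    Ee|by []].
  by rewrite mulf_neq0 ?invr_eq0.
have Qw : Q (w ^+ l) by exact: BQ.
have hcyc := cyclic_ext_subring hQ l0 Qw.
move: sQ'; rewrite cover_stalk // => /(spec_local_over hcyc) locQ'.
have [hQ' hl' cQ' _] := locQ'.
have QQ' : Q `<=` Q' by move=> z Qz; apply: cQ'; exact: cyclic_ext_base.
have Q'w : Q' w by apply: cQ'; exact: cyclic_ext_gen.
apply: local_over_spec; first exact: chart_subring.
apply: local_over_change locQ' _; first exact: chart_subring.
  apply: chart_ring_min => //; last exact: QQ'.
  by move=> z /RQ; exact: QQ'.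
have hF : is_subring (fractions_at chart_ring Q').
  by apply: fractions_at_subring => //; exact: chart_subring.
have AF : chart_ring `<=` fractions_at chart_ring Q'.
  by apply: fractions_at_sub => //; exact: (subring1 chart_subring).
apply: cyclic_ext_sub => //; last by apply: AF; exact: chart_w_mem.
have [_ _ _ hB] := locB.
move=> z /hB[a [c [Ba Bc c0 Qc ->]]]; exists a, c; split=> //.
- exact: base_chart.
- exact: base_chart.
- exact: QQ'.
Qed.

End Chart.

(** * The section at infinity *)

Section Transcendental.
Variables (K Om : fieldType) (j : {rmorphism K -> Om}).

Definition transcendental (u : Om) := forall P : {poly K}, P != 0 -> (map_poly j P).[u] != 0.

Lemma transcendentalP u : transcendental u <-> ~ integralOver j u.
Proof.
rewrite -integral_algebraic; split=> [h [P P0 /rootP e]|h P P0].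
  by have := h P P0; rewrite e eqxx.
by apply/negP => /eqP e; apply: h; exists P => //; apply/rootP.
Qed.

(** A relation for y / s over K homogenizes to one between s and y. *)
Lemma alg_indep2_ratio s y : alg_indep2 j s y -> s != 0 /\ transcendental (y / s).
Proof.
pose ev : {rmorphism {poly K} -> Om} := horner_eval s \o map_poly j.
move=> hsy; have {}hsy q : q != 0 -> (map_poly ev q).[y] != 0 := hsy q.
have s0 : s != 0.
  have := hsy ('X)%:P; rewrite polyC_eq0 polyX_eq0 map_polyC hornerC /=.
  by rewrite map_polyX /horner_eval hornerX; exact.
split=> // P P0; pose N := (size P).-1.
have hN : size P = N.+1 by rewrite /N prednK // lt0n size_poly_eq0.
pose q := \poly_(i < size P) (P`_i *: 'X^(N - i) : {poly K}).
have q0 : q != 0.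
  apply/eqP => /(congr1 (fun q : {poly {poly K}} => q`_N)).
  rewrite coef_poly hN ltnSn subnn expr0 coef0 => /eqP.
  by rewrite scaler_eq0 oner_eq0 orbF -[P`_N]/(lead_coef P) lead_coef_eq0 (negPf P0).
have := hsy q q0.
have -> : (map_poly ev q).[y] = s ^+ N * (map_poly j P).[y / s].
  rewrite (horner_coef_wide _ (leq_trans (size_poly _ _) (size_poly _ _))).
  rewrite (horner_coef_wide _ (size_poly _ _)) mulr_sumr.
  apply: eq_bigr => i _; rewrite coef_map coef_poly ltn_ord coef_map /=.
  rewrite /horner_eval map_polyZ hornerZ map_polyXn hornerXn.
  have hi : (i <= N)%N by rewrite -ltnS -hN.
  rewrite -[in s ^+ N](subnK hi) exprD expr_div_n; field.
  by rewrite expf_neq0.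
by apply: contraNneq => ->; rewrite mulr0.
Qed.

Lemma transcendental_affine u t c : t != 0 -> transcendental u ->
  transcendental (j t * (u + j c)).
Proof.
move=> t0 /transcendentalP hu; apply/transcendentalP => h; apply: hu.
have -> : u = j t^-1 * (j t * (u + j c)) - j c.
  by rewrite fmorphV; field; rewrite fmorph_eq0.
by apply: integral_sub; [apply: integral_mul => //|]; exact: integral_id.
Qed.

Lemma transcendental_inv u : transcendental u -> transcendental u^-1.
Proof.
move=> /transcendentalP hu; apply/transcendentalP => h; apply: hu.
by rewrite -[u]invrK; exact: integral_inv.
Qed.

Lemma transcendental_neq0 u : transcendental u -> u != 0.
Proof. by move=> /(_ 'X); rewrite polyX_eq0 map_polyX hornerX; exact. Qed.

(** Multiplying an integral equation of degree N for 1/x by x^N gives a polynomial in x over K with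
    constant term 1, so nonzero, that vanishes at x. *)
Lemma transcendental_not_integral_inv x : transcendental x ->
  ~ integralOver (horner_eval x \o map_poly j) x^-1.
Proof.
move=> tx; pose ev : {rmorphism {poly K} -> Om} := horner_eval x \o map_poly j.
move=> [P Pmon /rootP]; rewrite -/ev => hroot.
have x0 := transcendental_neq0 tx.
have P0 := monic_neq0 Pmon; pose N := (size P).-1.
have hN : size P = N.+1 by rewrite /N prednK // lt0n size_poly_eq0.
pose G := \sum_(i < N.+1) P`_i * 'X^(N - i) : {poly K}.
have G0 : G != 0.
  apply/eqP => /(congr1 (fun q => q.[0])).
  rewrite horner0 /G horner_sum big_ord_recr /= subnn expr0 mulr1.
  have -> : P`_N = 1 by move/monicP: Pmon; rewrite lead_coefE -/N.
  rewrite hornerC big1 ?add0r => [/eqP|i _]; first by rewrite oner_eq0.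
  by rewrite hornerM hornerXn expr0n subn_eq0 leqNgt ltn_ord /= mulr0.
move/eqP: (tx G G0); apply.
have -> : (map_poly j G).[x] = x ^+ N * (map_poly ev P).[x^-1].
  rewrite -[LHS]/(ev G) /G rmorph_sum (@horner_coef_wide _ N.+1); last first.
    by rewrite -hN size_poly.
  rewrite mulr_sumr; apply: eq_bigr => i _.
  have evX m : ev 'X^m = x ^+ m.
    by rewrite -[LHS]/(horner_eval x (map_poly j 'X^m)) map_polyXn /horner_eval hornerXn.
  rewrite rmorphM coef_map evX.
  have hi : (i <= N)%N by rewrite -ltnS.
  by rewrite -[in x ^+ N](subnK hi) exprD exprVn; field; rewrite expf_neq0.
by rewrite hroot mulr0.
Qed.

End Transcendental.

Section Filtration.
Variables (F : fieldType) (O : set F) (hO : is_subring O) (w : F) (w0 : w != 0) (Ow : O w).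
Hypothesis hinv : forall o, O o -> 1 + w * o != 0 /\ O (1 + w * o)^-1.

Definition punit z := exists2 o, O o & z = 1 + w * o.

Lemma punit1 : punit 1.
Proof. by exists 0; rewrite ?mulr0 ?addr0 //; exact: subring0. Qed.

Lemma punit_neq0 z : punit z -> z != 0.
Proof. by move=> [o Oo ->]; case: (hinv Oo). Qed.

Lemma punit_mem z : punit z -> O z.
Proof. by move=> [o Oo ->]; apply: (subringD hO (subring1 hO)); exact: subringM. Qed.

Lemma punitM z z' : punit z -> punit z' -> punit (z * z').
Proof.
move=> [o Oo ->] [o' Oo' ->]; exists (o + o' + w * (o * o')); last by ring.
by apply: (subringD hO); [exact: subringD|do 2!apply: (subringM hO) => //].
Qed.

Lemma punitV z : punit z -> punit z^-1.
Proof.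
move=> [o Oo ->]; have [n0 Oi] := hinv Oo.
exists (- (o * (1 + w * o)^-1)); first by apply: (subringN hO); exact: subringM.
by field.
Qed.

Lemma punitX z n : punit z -> punit (z ^+ n).
Proof.
by move=> hz; elim: n => [|n IH]; [exact: punit1|rewrite exprS; exact: punitM].
Qed.

Lemma punit_expz z (n : int) : punit z -> punit (z ^ n).
Proof.
move=> hz; case: n => n; first exact: punitX.
by rewrite NegzE -invr_expz -exprnP; apply: punitV; exact: punitX.
Qed.

Definition fil (n : int) := line O (w ^ n).

Lemma filD n z z' : fil n z -> fil n z' -> fil n (z + z').
Proof. exact: lineD. Qed.

Lemma filB n z z' : fil n z -> fil n z' -> fil n (z - z').
Proof. exact: lineB. Qed.

Lemma fil_mem n o : O o -> fil n (w ^ n * o).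
Proof. by move=> Oo; exists o => //; rewrite mulrC. Qed.

Lemma filMl n z o : O o -> fil n z -> fil n (o * z).
Proof. exact: line_mul. Qed.

Hypothesis wnonunit : ~ O w^-1.

(** This stands in for the valuation along w: it only needs that w is not invertible in O. *)
Lemma fil_unit m n u : u != 0 -> O u^-1 -> fil n (w ^ m * u) -> n <= m.
Proof.
move=> u0 Oui /lineP[o Oo e]; rewrite leNgt; apply/negP => mn.
apply: wnonunit; have [N eN] : exists N : nat, n - m = N.+1%:Z by exists `|n - m|.-1%N; lia.
have -> : w^-1 = w ^+ N * (o * u^-1).
  have e2 : u = o * w ^+ N.+1.
    apply: (mulfI (expfz_neq0 m w0)); rewrite e.
    have -> : n = m + N.+1%:Z by lia.
    by rewrite expfzDr // -exprnP; ring.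
  rewrite {1}e2 in u0 *; have o0 : o != 0 by apply: contraNneq u0 => ->; rewrite mul0r.
  by rewrite e2 exprS; field; rewrite o0 w0 expf_neq0.
by apply: (subringM hO); [exact: subringX|exact: subringM].
Qed.

End Filtration.

(** * Local trivializations of the extension and the equations of X *)

Section Surface.
Variables (k : closedFieldType) (p : nat) (hp : p \in [pchar k]).
Variables (K : fieldType) (iota : {rmorphism k -> K}) (C : set (set K)).
Variables (hC : smooth_projective_curve iota C).
Variables (D : set K -> int) (f0 : K) (e : nat) (B : set K -> int) (h : K) (hh : h != 0).
Hypothesis hN : forall R, C R -> O_ D R = [set h * a | a in tpow R (O_ B R) e%:Z].
Variables (l : nat) (l0 : (0 < l)%N) (hlp : (l %| p.+1)%N) (hle : (l %| e)%N).
Variables (Om : fieldType) (j : {rmorphism K -> Om}) (s y : Om).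
Hypothesis hsy : alg_indep2 j s y.
Variables (E : set K -> set Om) (hE : tango_extension iota j C p D f0 s y E).
Variables (theta : Om) (a : K).
Hypothesis etheta : theta = y ^+ p + j a * s ^+ p.
Hypothesis htheta : forall R, C R -> forall b, tpow R (O_ D R) p%:Z b ->
    frobenius_pullback j p E R (j b * theta).
Variables (zeta : Om) (hzeta : zeta ^+ l = j h ^+ p * (s * theta)).
Local Notation q := (p.+1 %/ l)%N.
Local Notation curve_subring := (curve_subring hC).

(* With b a local generator of N and alpha adapted to it, [s] and [basisY b alpha]
   form a basis of E_R, and (h b^e)^p [theta] = Y^p + beta s^p, where
   beta = (h b^e)^p (a - alpha^p) lies in R. *)
Definition basisY b alpha := j (h * b ^+ e) * (y + j alpha * s).
Local Notation Y := basisY.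

Definition local_data R b alpha := [/\ b != 0, O_ B R = line R b,
  E R = basis_stalk j s (Y b alpha) R & R ((h * b ^+ e) ^+ p * (a - alpha ^+ p))].

Let p0 : (0 < p)%N. Proof. exact: prime_gt0 (pcharf_prime hp). Qed.
Let pcharOm : p \in [pchar Om].
Proof. by rewrite (fmorph_pchar (j \o iota)). Qed.
Let s0 : s != 0. Proof. by have [] := alg_indep2_ratio hsy. Qed.
Let tu : transcendental j (y / s). Proof. by have [] := alg_indep2_ratio hsy. Qed.

Lemma expD_char (x x' : Om) : (x + x') ^+ p = x ^+ p + x' ^+ p.
Proof. by have := pFrobenius_autD_comm pcharOm (mulrC x x'); rewrite !pFrobenius_autE. Qed.

Lemma tau_neq0 b : b != 0 -> h * b ^+ e != 0.
Proof. by move=> b0; rewrite mulf_neq0 // expf_neq0. Qed.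

Lemma basisYE b alpha : Y b alpha = s * (j (h * b ^+ e) * (y / s + j alpha)).
Proof. by rewrite /basisY; field. Qed.

Lemma basisY_ratio b alpha : b != 0 -> transcendental j (Y b alpha / s).
Proof.
move=> b0; rewrite basisYE mulrAC divff // mul1r.
by apply: transcendental_affine => //; exact: tau_neq0.
Qed.

Lemma basisY_neq0 b alpha : b != 0 -> Y b alpha != 0.
Proof.
move=> b0; have /transcendental_neq0 := basisY_ratio alpha b0.
by rewrite mulf_eq0 negb_or => /andP[].
Qed.

Lemma line_O_ R : C R -> exists2 b, b != 0 & O_ B R = line R b.
Proof.
move=> CR; have [RT|RT] := pselect (R = setT).
  exists 1; first exact: oner_neq0.
  by rewrite line1 RT; apply/seteqP; split=> // z _; left.
have hR : closed_points C R by split.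
have hs := curve_subring CR.
have t0 := unif_neq0 hC hR; exists (unif R ^ (- B R)); first exact: expfz_neq0.
apply/seteqP; split=> z.
  move=> [//|[t [r [[t'0 ht] Rr ->]]]].
  have [_ ht'] := unifP hC hR.
  have [|u [Ru Rui u0 ->]] := line_eq hs t0 (_ : line R (unif R) = line R t).
    by rewrite /line -ht -ht'.
  rewrite expfzMl mulrA; exists (r * u ^ (- B R)) => //.
  by apply: subringM => //; exact: unit_expz.
move=> /lineP[r Rr ->]; right; exists (unif R), r; split=> //; exact: (unifP hC).
Qed.

Lemma O_D_line R b : C R -> b != 0 -> O_ B R = line R b -> O_ D R = line R (h * b ^+ e).
Proof.
move=> CR b0 eB; rewrite hN // eB tpow_line //; last exact: curve_subring.
apply/seteqP; split=> z.
  by move=> [_ /lineP[r Rr ->] <-]; exists r => //; rewrite -exprnP; ring.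
move=> /lineP[r Rr ->]; exists (r * b ^ e%:Z); first by exists r.
by rewrite -exprnP; ring.
Qed.

Lemma extension_basis R b alpha : C R -> b != 0 -> O_ B R = line R b ->
  E R = [set w | exists u v, [/\ R u, O_ D R v & w = j u * s + j v * (y + j alpha * s)]] ->
  E R = basis_stalk j s (Y b alpha) R.
Proof.
move=> CR b0 eB ->; rewrite (O_D_line CR b0 eB); apply/seteqP; split=> z.
  move=> [u [_ [Ru /lineP[v Rv ->] ->]]]; exists u, v; split=> //.
  by rewrite rmorphM /basisY; ring.
move=> [u [v [Ru Rv ->]]]; exists u, (v * (h * b ^+ e)); split=> //; first by exists v.
by rewrite rmorphM /basisY; ring.
Qed.

Lemma extension_stalk R b : C R -> b != 0 -> O_ B R = line R b ->
  exists alpha, E R = basis_stalk j s (Y b alpha) R.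
Proof.
move=> CR b0 eB; have [I [U [x [[hU hcov] _ [al [hal _]]]]]] := hE.
have [i _ Ui] : (\bigcup_i U i) R by rewrite -hcov.
by exists (al i); apply: extension_basis => //; exact: hal.
Qed.

Lemma basis_stalkT b b' alpha alpha' : b != 0 -> b' != 0 ->
  basis_stalk j s (Y b alpha) setT = basis_stalk j s (Y b' alpha') setT.
Proof.
have sub b1 b2 a1 a2 : b1 != 0 -> b2 != 0 ->
    basis_stalk j s (Y b1 a1) setT `<=` basis_stalk j s (Y b2 a2) setT.
  move=> b10 b20 _ [u [v [_ _ ->]]].
  have h0 := tau_neq0 b20.
  exists (u + v * (h * b1 ^+ e) * (a1 - a2)), (v * (h * b1 ^+ e) / (h * b2 ^+ e)).
  split=> //; rewrite /basisY; move: (h * b1 ^+ e) (h * b2 ^+ e) h0 => t1 t2 t20.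
  rewrite !(rmorphD, rmorphM, rmorphB, fmorphV) /=; field.
  by rewrite fmorph_eq0.
by move=> b0 b'0; apply/seteqP; split; exact: sub.
Qed.

Lemma local_data_generic b alpha : b != 0 -> local_data setT b alpha.
Proof.
move=> b0; have CT := curve_generic hC.
have eT : O_ B setT = line setT b.
  apply/seteqP; split=> z _; last by left.
  by exists (z / b) => //; rewrite divfK.
split=> //; have [al ->] := extension_stalk CT b0 eT.
exact: basis_stalkT.
Qed.

(** The splitting hypothesis writes (h b^e)^p [theta] as u s^p + v Y^p with u, v in R. Since y / s
    is transcendental, coefficients of s^p and y^p can be compared: v = 1, and u is the element in
    question. *)
Lemma splitting_integral R b alpha : C R -> b != 0 -> O_ B R = line R b ->
  E R = basis_stalk j s (Y b alpha) R -> R ((h * b ^+ e) ^+ p * (a - alpha ^+ p)).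
Proof.
move=> CR b0 eB eE; have hs := curve_subring CR.
set t := h * b ^+ e; have t0 : t != 0 by exact: tau_neq0.
have : tpow R (O_ D R) p%:Z (t ^+ p).
  by rewrite (O_D_line CR b0 eB) tpow_line //; apply: line_gen.
move=> /(htheta CR) hpb.
have : [set z | exists u v, [/\ R u, R v & z = j u * s ^+ p + j v * Y b alpha ^+ p]]
    (j (t ^+ p) * theta).
  move: hpb; apply; split.
    split.
    - by exists 0, 0; rewrite !rmorph0 !mul0r addr0; split=> //; exact: subring0.
    - move=> _ _ [u [v [Ru Rv ->]]] [u' [v' [Ru' Rv' ->]]].
      by exists (u + u'), (v + v'); split; [exact: subringD|exact: subringD|rewrite !rmorphD; ring].
    - move=> _ _ [r Rr <-] [u [v [Ru Rv ->]]].
      by exists (r * u), (r * v); split; [exact: subringM|exact: subringM|rewrite !rmorphM; ring].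
  move=> _ [x + <-]; rewrite eE => -[u [v [Ru Rv ->]]].
  exists (u ^+ p), (v ^+ p); split; [exact: subringX|exact: subringX|].
  by rewrite expD_char !exprMn !rmorphXn.
move=> [u [v [Ru Rv]]].
have eY : Y b alpha ^+ p = j (t ^+ p) * (y ^+ p + j (alpha ^+ p) * s ^+ p).
  by rewrite /basisY -/t [LHS]exprMn expD_char [(j alpha * s) ^+ p]exprMn !rmorphXn.
rewrite etheta eY => eq1.
have eq0 : j (t ^+ p - v * t ^+ p) * y ^+ p +
    j (t ^+ p * a - u - v * t ^+ p * alpha ^+ p) * s ^+ p = 0.
  apply/eqP; rewrite -[X in _ == X](subrr (j (t ^+ p) * (y ^+ p + j a * s ^+ p))) {2}eq1.
  by apply/eqP; rewrite !(rmorphB, rmorphM) /=; ring.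
pose P : {poly K} := (t ^+ p - v * t ^+ p) *: 'X^p +
   (t ^+ p * a - u - v * t ^+ p * alpha ^+ p)%:P.
have P0 : P = 0.
  apply/eqP; apply: contraT => /tu/eqP; case.
  rewrite /P rmorphD /= map_polyZ map_polyXn map_polyC hornerD hornerZ hornerXn hornerC /=.
  apply: (mulIf (expf_neq0 p s0)); rewrite mul0r expr_div_n -[RHS]eq0; field.
  by rewrite expf_neq0.
have := congr1 (fun Q : {poly K} => Q`_p) P0.
rewrite /P coefD coefZ coefXn eqxx coefC -[p == 0%N]negbK -lt0n p0 mulr1 addr0 coef0 => e1.
have := congr1 (fun Q : {poly K} => Q`_0) P0.
rewrite /P coefD coefZ coefXn coefC eqxx eq_sym -[p == 0%N]negbK -lt0n p0 mulr0 add0r coef0 => e2.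
suff -> : t ^+ p * (a - alpha ^+ p) = u by [].
apply/eqP; rewrite -subr_eq0; apply/eqP.
transitivity ((t ^+ p * a - u - v * t ^+ p * alpha ^+ p) - (t ^+ p - v * t ^+ p) * alpha ^+ p).
  by ring.
by rewrite e1 e2 mul0r subr0.
Qed.


Lemma local_data_exists R : C R -> exists b alpha, local_data R b alpha.
Proof.
move=> CR; have [b b0 eB] := line_O_ CR; have [alpha eE] := extension_stalk CR b0 eB.
by exists b, alpha; split=> //; exact: splitting_integral.
Qed.

(** The trace of Q on K contains R, so it is R or K by maximality, and at the generic point any b <>
    0 and alpha will do. *)
Lemma local_data_proj R b alpha (Q : set Om) : C R -> local_data R b alpha ->
  is_subring Q -> j @` R `<=` Q -> local_data (proj_pt j Q) b alpha.
Proof.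
move=> CR hd hQ RQ; have hP := proj_pt_subring j hQ.
have RP : R `<=` proj_pt j Q by move=> u Ru; apply: RQ; exists u.
have [->|PR] := pselect (proj_pt j Q = R); first exact: hd.
have -> : proj_pt j Q = setT; last by apply: local_data_generic; case: hd.
have [RT|RT] := pselect (R = setT).
  by apply/seteqP; split=> // u _; apply: RP; rewrite RT.
have [f Pf nRf] : exists2 f, proj_pt j Q f & ~ R f.
  apply: contrapT => nh; apply: PR; apply/seteqP; split=> // f Pf.
  by apply: contrapT => nRf; apply: nh; exists f.
exact: (curve_maximal hC (conj CR RT) hP RP Pf nRf).
Qed.

Lemma basis_stalkC (e0 e1 : Om) R : basis_stalk j e0 e1 R = basis_stalk j e1 e0 R.
Proof.
by apply/seteqP; split=> _ [u [v [Ru Rv ->]]]; exists v, u; rewrite addrC.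
Qed.

Definition beta b alpha := (h * b ^+ e) ^+ p * (a - alpha ^+ p).
Local Notation v1 b alpha := (chart_v s (Y b alpha)).
Local Notation w1 b := (chart_w j p e l zeta b s).
Local Notation x2 b alpha := (chart_v (Y b alpha) s).
Local Notation w2 b alpha := (chart_w j p e l zeta b (Y b alpha)).
Definition chart1 R b alpha := chart_ring j p e l zeta R b s (Y b alpha).
Definition chart2 R b alpha := chart_ring j p e l zeta R b (Y b alpha) s.

Lemma tau_theta b alpha :
  j (h * b ^+ e) ^+ p * theta = Y b alpha ^+ p + j (beta b alpha) * s ^+ p.
Proof.
rewrite /beta etheta /basisY [in RHS]exprMn expD_char [(j alpha * s) ^+ p]exprMn.
rewrite [j (_ * (_ - _))]rmorphM rmorphB !rmorphXn /=; ring.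
Qed.

Lemma chart_w_pow b alpha e0 : chart_w j p e l zeta b e0 ^+ l =
  e0 ^- p.+1 * (s * (Y b alpha ^+ p + j (beta b alpha) * s ^+ p)).
Proof.
rewrite -tau_theta /chart_w !exprMn hzeta -exprVn -!exprM divnK // exprVn.
have -> : j (b ^+ (e %/ l)) ^+ (p * l) = j (b ^+ e) ^+ p.
  by rewrite -!rmorphXn -!exprM [(p * l)%N]mulnC mulnA divnK.
by rewrite [j (h * _)]rmorphM exprMn; ring.
Qed.

Lemma w1_pow b alpha : w1 b ^+ l = v1 b alpha ^+ p + j (beta b alpha).
Proof.
by rewrite (chart_w_pow b alpha) /chart_v expr_div_n exprS; field; rewrite s0 expf_neq0.
Qed.

(** Hence x is w^l up to a unit near x = 0, and w is a parameter along the section at infinity. *)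
Lemma w2_pow b alpha : b != 0 ->
  w2 b alpha ^+ l = x2 b alpha + j (beta b alpha) * x2 b alpha ^+ p.+1.
Proof.
move=> b0; have Y0 := basisY_neq0 alpha b0.
rewrite (chart_w_pow b alpha) /chart_v expr_div_n !exprS; field.
by rewrite Y0 expf_neq0.
Qed.

Lemma x2_transcendental b alpha : b != 0 -> transcendental j (x2 b alpha).
Proof.
by move=> b0; rewrite /chart_v -invf_div; apply/transcendental_inv/basisY_ratio.
Qed.

(** * The two charts of X over a point of C *)

Section LocalCharts.
Variables (R : set K) (b alpha : K) (CR : C R) (hd : local_data R b alpha).
Let hR := curve_subring CR.
Let b0 : b != 0. Proof. by case: hd. Qed.
Let Y0 := basisY_neq0 alpha b0.
Let Rbeta : R (beta b alpha). Proof. by case: hd. Qed.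

Lemma chart1_base_pow : base_ring j R s (Y b alpha) (w1 b ^+ l).
Proof.
have hB := base_subring j R s (Y b alpha).
rewrite (w1_pow b alpha); apply: (subringD hB); last exact: base_const.
by apply: (subringX hB); exact: base_v.
Qed.

Lemma chart2_base_pow : base_ring j R (Y b alpha) s (w2 b alpha ^+ l).
Proof.
have hB := base_subring j R (Y b alpha) s.
rewrite w2_pow //; apply: (subringD hB); first exact: base_v.
apply: (subringM hB); first exact: base_const.
by apply: (subringX hB); exact: base_v.
Qed.

Lemma chart1_stalks (Q : set Om) : is_subring Q -> j @` R `<=` Q ->
  O_ B (proj_pt j Q) = line (proj_pt j Q) b /\
  E (proj_pt j Q) = basis_stalk j s (Y b alpha) (proj_pt j Q).
Proof. by move=> hQ RQ; case: (local_data_proj CR hd hQ RQ). Qed.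

Lemma chart2_stalks (Q : set Om) : is_subring Q -> j @` R `<=` Q ->
  O_ B (proj_pt j Q) = line (proj_pt j Q) b /\
  E (proj_pt j Q) = basis_stalk j (Y b alpha) s (proj_pt j Q).
Proof. by rewrite basis_stalkC; exact: chart1_stalks. Qed.

Lemma stalk1 : E R = basis_stalk j s (Y b alpha) R. Proof. by case: hd. Qed.
Lemma stalk2 : E R = basis_stalk j (Y b alpha) s R.
Proof. by rewrite basis_stalkC stalk1. Qed.

Local Notation X := (raynaud_surface j C p e l B E zeta).

Lemma chart1_surface Q : spec (chart1 R b alpha) Q -> X Q.
Proof.
exact: (chart_points CR hR b0 s0 l0 chart1_stalks stalk1 chart1_base_pow).
Qed.

Lemma chart2_surface Q : spec (chart2 R b alpha) Q -> X Q.
Proof.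
exact: (chart_points CR hR b0 Y0 l0 chart2_stalks stalk2 chart2_base_pow).
Qed.

Lemma x2_v1 : x2 b alpha = (v1 b alpha)^-1. Proof. by rewrite /chart_v invf_div. Qed.

Lemma w2_w1 : w2 b alpha = w1 b * x2 b alpha ^+ q.
Proof. by rewrite /chart_w /chart_v expr_div_n; field; rewrite !expf_neq0. Qed.

Lemma v1_neq0 : v1 b alpha != 0.
Proof. by rewrite /chart_v mulf_neq0 // invr_eq0. Qed.

Lemma spec_chart1_of_v1 Q : spec (chart2 R b alpha) Q -> Q (v1 b alpha) ->
  spec (chart1 R b alpha) Q.
Proof.
have hA1 : is_subring (chart1 R b alpha) by exact: chart_subring.
have hA2 : is_subring (chart2 R b alpha) by exact: chart_subring.
move=> /(spec_local_over hA2) loc Qv; have [hQ hl AQ _] := loc.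
have Qx : Q (x2 b alpha) by apply: AQ; exact: chart_v_mem.
have Qw : Q (w2 b alpha) by apply: AQ; exact: chart_w_mem.
have RQ : j @` R `<=` Q by move=> _ [u Ru <-]; apply: AQ; exact: chart_const.
have v0 := v1_neq0.
have ew : w1 b = w2 b alpha * v1 b alpha ^+ q.
  by rewrite w2_w1 x2_v1 exprVn divfK // expf_neq0.
have A1Q : chart1 R b alpha `<=` Q.
  by apply: chart_ring_min => //; rewrite ew; apply: subringM => //; exact: subringX.
apply: local_over_spec => //; apply: local_over_change loc _ => //.
have hF := fractions_at_subring hA1 hQ.
have AF := fractions_at_sub (A := chart1 R b alpha) hQ (subring1 hA1).
have A1v : chart1 R b alpha (v1 b alpha) by exact: chart_v_mem.
apply: chart_ring_min => //.
- by move=> _ [u Ru <-]; apply: AF; exact: chart_const.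
- rewrite x2_v1 -div1r; apply: fractions_at_div => //; first exact: subring1.
  by rewrite -x2_v1.
- have -> : w2 b alpha = w1 b / v1 b alpha ^+ q by rewrite ew mulfK // expf_neq0.
  apply: fractions_at_div => //.
  + exact: chart_w_mem.
  + exact: (subringX hA1).
  + by rewrite expf_neq0.
  + by rewrite -exprVn -x2_v1; exact: subringX.
Qed.

End LocalCharts.

(** The ratios s / f and Y / f generate the unit ideal, so one of them is invertible at Q. A point
    outside the first chart lies in the second, with 1/x not regular there. *)
Lemma surface_points Q' : raynaud_surface j C p e l B E zeta Q' ->
  exists2 R, C R & forall b alpha, local_data R b alpha ->
    spec (chart1 R b alpha) Q' \/
    (spec (chart2 R b alpha) Q' /\ max_ideal Q' (x2 b alpha)).
Proof.
move=> [Q [R [f [CR Ef fn0 sQ]]] sQ']; exists R => // b alpha hd.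
have hR := curve_subring CR; have [b0 eB eE Rb] := hd.
have Y0 := basisY_neq0 alpha b0.
set A := gen_subring _ in sQ.
have hA : is_subring A by exact: gen_subring_subring.
have [hQ hl AQ _] := spec_local_over hA sQ.
have RQ u : R u -> Q (j u) by move=> Ru; apply: (AQ); apply: gen_subring_sub; left; exists u.
have EQ x : E R x -> Q (x / f) by move=> Ex; apply: (AQ); apply: gen_subring_sub; right; exists x.
have Es : E R s.
  rewrite eE; exists 1, 0; rewrite rmorph1 rmorph0 mul1r mul0r addr0.
  by split=> //; [exact: subring1|exact: subring0].
have EY : E R (Y b alpha).
  rewrite eE; exists 0, 1; rewrite rmorph1 rmorph0 mul1r mul0r add0r.
  by split=> //; [exact: subring0|exact: subring1].
have [Qi|nQi] := pselect (Q (s / f)^-1).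
  left; exact: (points_chart hR b0 s0 l0 (chart1_stalks CR hd) (stalk1 hd)
    (chart1_base_pow hd) Ef fn0 sQ sQ' Qi).
have QYi : Q (Y b alpha / f)^-1.
  apply: contrapT => nQY; apply: (@max_ideal1 _ Q hQ).
  have ms : max_ideal Q (s / f) by split; [exact: EQ|right].
  have mY : max_ideal Q (Y b alpha / f) by split; [exact: EQ|right].
  move: (Ef); rewrite eE => -[u [u' [Ru Ru' ef]]].
  have -> : 1 = j u * (s / f) + j u' * (Y b alpha / f) by rewrite -(divff fn0) {1}ef; field.
  by apply: hl; apply: max_idealM => //; exact: RQ.
have s2 := points_chart hR b0 Y0 l0 (chart2_stalks CR hd) (stalk2 hd)
    (chart2_base_pow hd) Ef fn0 sQ sQ' QYi.
have [Qv|nQv] := pselect (Q' (v1 b alpha)).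
  by left; apply: (spec_chart1_of_v1 hd).
right; split=> //.
have [hQ' _ AQ' _] := spec_local_over (chart_subring _ _ _ _ _ _ _ _ _) s2.
split; first by apply: AQ'; exact: chart_v_mem.
by right; rewrite x2_v1 invrK.
Qed.

(* The ideal (x2, w2) of chart2 that defines the section at infinity. *)
Definition infinity_ideal R b alpha := [set z | exists c d,
  [/\ chart2 R b alpha c, chart2 R b alpha d & z = x2 b alpha * c + w2 b alpha * d]].

Lemma chart2_subring R b alpha : is_subring (chart2 R b alpha).
Proof. exact: chart_subring. Qed.

Lemma chart2_const R b alpha r : R r -> chart2 R b alpha (j r).
Proof. exact: chart_const. Qed.

Lemma chart2_x R b alpha : chart2 R b alpha (x2 b alpha).
Proof. exact: chart_v_mem. Qed.

Lemma chart2_w R b alpha : chart2 R b alpha (w2 b alpha).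
Proof. exact: chart_w_mem. Qed.

Lemma chart2_generic R b alpha : chart2 R b alpha `<=` chart2 setT b alpha.
Proof.
apply: chart_ring_min; first exact: chart2_subring.
- by move=> _ [u _ <-]; exact: chart2_const.
- exact: chart2_x.
- exact: chart2_w.
Qed.

Lemma infinity_ideal_generic R b alpha :
  infinity_ideal R b alpha `<=` infinity_ideal setT b alpha.
Proof.
by move=> _ [c [d [hc hd ->]]]; exists c, d; split=> //; [exact: (chart2_generic hc)|exact:
  (chart2_generic hd)].
Qed.

Lemma infinity_ideal_submodule R b alpha :
  is_submodule (chart2 R b alpha) (infinity_ideal R b alpha).
Proof.
have hA := chart2_subring R b alpha; split.
- by exists 0, 0; rewrite !mulr0 addr0; split=> //; exact: (subring0 hA).
- move=> _ _ [c [d [hc hd ->]]] [c' [d' [hc' hd' ->]]].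
  by exists (c + c'), (d + d'); split; [exact: (subringD hA)|exact: (subringD hA)|ring].
- move=> r _ hr [c [d [hc hd ->]]].
  by exists (r * c), (r * d); split; [exact: (subringM hA)|exact: (subringM hA)|ring].
Qed.

Lemma infinity_ideal_x R b alpha c :
  chart2 R b alpha c -> infinity_ideal R b alpha (x2 b alpha * c).
Proof.
by move=> hc; exists c, 0; rewrite mulr0 addr0; split=> //; exact: (subring0 (chart2_subring R b
  alpha)).
Qed.

Lemma infinity_ideal_w R b alpha c :
  chart2 R b alpha c -> infinity_ideal R b alpha (w2 b alpha * c).
Proof.
by move=> hc; exists 0, c; rewrite mulr0 add0r; split=> //; exact: (subring0 (chart2_subring R b
  alpha)).
Qed.

Lemma infinity_ideal_sub R b alpha : infinity_ideal R b alpha `<=` chart2 R b alpha.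
Proof.
have hA := chart2_subring R b alpha.
move=> _ [c [d [hc hd ->]]]; apply: (subringD hA); apply: (subringM hA) => //.
- exact: chart2_x.
- exact: chart2_w.
Qed.

Lemma infinity_idealN R b alpha i : infinity_ideal R b alpha i -> infinity_ideal R b alpha (- i).
Proof.
have hA := chart2_subring R b alpha.
move=> hi; have [_ _ h1] := infinity_ideal_submodule R b alpha.
by rewrite -mulN1r; apply: h1 => //; apply: (subringN hA); exact: (subring1 hA).
Qed.

(* Modulo x the element w is nilpotent, so otherwise 1/x would be integral over K[x]. *)
Lemma infinity_ideal_proper b alpha : b != 0 -> ~ infinity_ideal setT b alpha 1.
Proof.
move=> b0 [c [d [hc hd e1]]].
have hA := chart2_subring setT b alpha.
have tx := x2_transcendental alpha b0; have x0 := transcendental_neq0 tx.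
pose ev : {rmorphism {poly K} -> Om} := horner_eval (x2 b alpha) \o map_poly j.
have evC u : ev u%:P = j u.
  by rewrite -[LHS]/(horner_eval _ (map_poly j u%:P)) map_polyC /horner_eval hornerC.
have evX : ev 'X = x2 b alpha.
  by rewrite -[LHS]/(horner_eval _ (map_poly j 'X)) map_polyX /horner_eval hornerX.
have integralA z : chart2 setT b alpha z -> integralOver ev z.
  move: z; apply: chart_ring_min.
  - apply/is_subringP; split; [exact: integral1|exact: integral_sub|exact: integral_mul].
  - by move=> _ [u _ <-]; rewrite -evC; exact: integral_id.
  - by rewrite -evX; exact: integral_id.
  - pose P : {poly K} := 'X + (beta b alpha)%:P * 'X^(p.+1).
    have eP : ev P = w2 b alpha ^+ l.
      by rewrite /P rmorphD rmorphM rmorphXn evC evX w2_pow.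
    exists ('X^l - P%:P); first exact: monicXnsubC.
    have -> : map_poly ev ('X^l - P%:P) = 'X^l - (ev P)%:P.
      by rewrite rmorphB /= map_polyXn map_polyC.
    by rewrite rootE eP hornerD hornerXn hornerN hornerC subrr.
(* From 1 - x c = w d, raising to the power l gives 1 - x c' = x (1 + beta x^p) d^l, which exhibits
   1/x in the ring. *)
have [c' hc' e2] : exists2 c', chart2 setT b alpha c' &
    (1 - x2 b alpha * c) ^+ l = 1 - x2 b alpha * c'.
  elim: (l) => [|m [c' hc' em]].
    by exists 0; rewrite ?expr0 ?mulr0 ?subr0 //; exact: (subring0 hA).
  exists (c + c' - x2 b alpha * c * c'); last by rewrite exprS em; ring.
  apply: (subringB hA); first exact: (subringD hA).
  by apply: (subringM hA) => //; apply: (subringM hA) => //; exact: chart2_x.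
have : chart2 setT b alpha (x2 b alpha)^-1.
  have -> : (x2 b alpha)^-1 = c' + (1 + j (beta b alpha) * x2 b alpha ^+ p) * d ^+ l.
    apply: (mulfI x0); rewrite divff //.
    have : (1 - x2 b alpha * c) ^+ l = w2 b alpha ^+ l * d ^+ l.
      by rewrite -exprMn e1; congr (_ ^+ _); ring.
    rewrite e2 w2_pow // exprS => e3.
    transitivity (1 - x2 b alpha * c' + x2 b alpha * c'); first by ring.
    by rewrite e3; ring.
  apply: (subringD hA) => //; apply: (subringM hA); last exact: (subringX hA).
  apply: (subringD hA); first exact: (subring1 hA).
  apply: (subringM hA); first exact: chart2_const.
  by apply: (subringX hA); exact: chart2_x.
by move=> /integralA; exact: transcendental_not_integral_inv.
Qed.

Lemma infinity_ideal_generic_const b alpha c : b != 0 ->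
  infinity_ideal setT b alpha (j c) -> c = 0.
Proof.
move=> b0 Ic; apply/eqP; apply: contraT => c0; exfalso; apply: (infinity_ideal_proper b0).
have [_ _ hM] := infinity_ideal_submodule setT b alpha.
have -> : 1 = j c^-1 * j c by rewrite -rmorphM mulVf ?rmorph1.
by apply: hM => //; exact: chart2_const.
Qed.

(** * The local ring along the section at infinity *)

Section Infinity.
Variables (R : set K) (b alpha : K) (hR : is_subring R) (b0 : b != 0)
  (Rbeta : R (beta b alpha)).
Local Notation x := (x2 b alpha).
Local Notation w := (w2 b alpha).
Local Notation A := (chart2 R b alpha).
Local Notation I := (infinity_ideal R b alpha).
Let hA : is_subring A := chart2_subring R b alpha.
Let w2_pow' := w2_pow alpha b0.

Lemma infinity_ideal_const c : I (j c) -> c = 0.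
Proof. by move=> /infinity_ideal_generic; exact: infinity_ideal_generic_const. Qed.

Lemma one_add_neq0 i : I i -> 1 + i != 0.
Proof.
move=> Ii; apply/eqP => i1; have /infinity_ideal_const/eqP : I (j 1).
  rewrite rmorph1; have -> : 1 = - i by apply/eqP; rewrite -addr_eq0 i1.
  exact: infinity_idealN.
by rewrite oner_eq0.
Qed.

(** The quotient by the ideal at infinity is R: the section is a copy of the base. The constant is
    unique by [infinity_ideal_const]. *)
Lemma chart2_decomposition z : A z -> exists2 r, R r & I (z - j r).
Proof.
have [I0 ID IM] := infinity_ideal_submodule R b alpha.
suff : A `<=` [set z | A z /\ exists2 r, R r & I (z - j r)] by move=> hsub /hsub[].
apply: chart_ring_min.
- apply/is_subringP; split.
  + split; first exact: (subring1 hA).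
    by exists 1; [exact: (subring1 hR)|rewrite rmorph1 subrr].
  + move=> z1 z' [Az [r Rr Ir]] [Az' [r' Rr' Ir']]; split; first exact: (subringB hA).
    exists (r - r'); first exact: (subringB hR).
    have -> : z1 - z' - j (r - r') = (z1 - j r) + - (z' - j r') by rewrite rmorphB; ring.
    by apply: (ID) => //; exact: infinity_idealN.
  + move=> z1 z' [Az [r Rr Ir]] [Az' [r' Rr' Ir']]; split; first exact: (subringM hA).
    exists (r * r'); first exact: (subringM hR).
    have -> : z1 * z' - j (r * r') = z1 * (z' - j r') + j r' * (z1 - j r).
      by rewrite rmorphM; ring.
    by apply: (ID); apply: (IM) => //; exact: chart2_const.
- move=> _ [u Ru <-]; split; first exact: chart2_const.
  by exists u => //; rewrite subrr.
- split; first exact: chart2_x.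
  exists 0; first exact: (subring0 hR).
  by rewrite rmorph0 subr0 -[x]mulr1; apply: infinity_ideal_x; exact: (subring1 hA).
- split; first exact: chart2_w.
  exists 0; first exact: (subring0 hR).
  by rewrite rmorph0 subr0 -[w]mulr1; apply: infinity_ideal_w; exact: (subring1 hA).
Qed.

(* When R is local, this is the local ring of X at the point of the section
   at infinity over R; see [infinity_ring_spec]. *)
Definition infinity_ring := [set z | exists c i, [/\ A c, I i & z = c / (1 + i)]].
Local Notation O := infinity_ring.

Lemma one_addM i i' : I i -> I i' -> exists2 i'', I i'' & (1 + i) * (1 + i') = 1 + i''.
Proof.
have [I0 ID IM] := infinity_ideal_submodule R b alpha.
move=> Ii Ii'; exists (i + i' + i * i'); last by ring.
by apply: (ID); [exact: ID|apply: (IM) => //; exact: infinity_ideal_sub].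
Qed.

Lemma infinity_ring_subring : is_subring O.
Proof.
have [I0 ID IM] := infinity_ideal_submodule R b alpha.
have A1 i : I i -> A (1 + i).
  by move=> Ii; apply: (subringD hA (subring1 hA)); exact: infinity_ideal_sub.
apply/is_subringP; split.
- by exists 1, 0; rewrite addr0 divr1; split=> //; exact: (subring1 hA).
- move=> _ _ [c [i [Ac Ii ->]]] [d [i' [Ad Ii' ->]]].
  have n1 := one_add_neq0 Ii; have n2 := one_add_neq0 Ii'.
  have [i'' Ii'' e1] := one_addM Ii Ii'.
  exists (c * (1 + i') - d * (1 + i)), i''; split=> //; last first.
    by rewrite -e1; field; rewrite n1 n2.
  by apply: (subringB hA); apply: (subringM hA) => //; exact: A1.
- move=> _ _ [c [i [Ac Ii ->]]] [d [i' [Ad Ii' ->]]].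
  have n1 := one_add_neq0 Ii; have n2 := one_add_neq0 Ii'.
  have [i'' Ii'' e1] := one_addM Ii Ii'.
  exists (c * d), i''; split=> //; first exact: (subringM hA).
  by rewrite -e1; field; rewrite n1 n2.
Qed.
Let hO := infinity_ring_subring.

Lemma infinity_ring_chart : A `<=` O.
Proof.
have [I0 _ _] := infinity_ideal_submodule R b alpha.
by move=> c Ac; exists c, 0; rewrite addr0 divr1.
Qed.

Lemma infinity_ring_const r : R r -> O (j r).
Proof. by move=> Rr; apply: infinity_ring_chart; exact: chart2_const. Qed.

Lemma infinity_ring_inv i : I i -> O (1 + i)^-1.
Proof. by move=> Ii; exists 1, i; rewrite div1r; split=> //; exact: (subring1 hA). Qed.

Lemma unit_part : [/\ 1 + j (beta b alpha) * x ^+ p != 0,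
   O (1 + j (beta b alpha) * x ^+ p), O (1 + j (beta b alpha) * x ^+ p)^-1 &
   x * (1 + j (beta b alpha) * x ^+ p) = w ^+ l].
Proof.
have Ii : I (j (beta b alpha) * x ^+ p).
  have -> : j (beta b alpha) * x ^+ p = x * (j (beta b alpha) * x ^+ p.-1).
    by rewrite -{1}(prednK p0) exprS; ring.
  apply: infinity_ideal_x; apply: (subringM hA); first exact: chart2_const.
  by apply: (subringX hA); exact: chart2_x.
split; [exact: one_add_neq0| |exact: infinity_ring_inv|by rewrite w2_pow' exprS; ring].
apply: infinity_ring_chart; apply: (subringD hA); first exact: (subring1 hA).
exact: infinity_ideal_sub.
Qed.

Lemma infinity_x_w : exists2 o, O o & x = w * o.
Proof.
have [u0 Ou Oui eu] := unit_part.
exists (w ^+ l.-1 / (1 + j (beta b alpha) * x ^+ p)).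
  apply: (subringM hO) => //; apply: (subringX hO).
  by apply: infinity_ring_chart; exact: chart2_w.
by rewrite mulrA -exprS (prednK l0) -eu mulfK.
Qed.

Lemma infinity_ideal_w_multiple i : I i -> exists2 o, O o & i = w * o.
Proof.
move=> [c [d [Ac Ad ->]]]; have [o Oo ex] := infinity_x_w.
exists (o * c + d); last by rewrite {1}ex; ring.
apply: (subringD hO); last exact: infinity_ring_chart.
by apply: (subringM hO) => //; exact: infinity_ring_chart.
Qed.

(** One exact Taylor step in w. Repeating it on o yields as many coefficients of a Laurent tail as
    needed. *)
Lemma infinity_ring_decomposition z : O z -> exists r o, [/\ R r, O o & z = j r + w * o].
Proof.
have [I0 ID IM] := infinity_ideal_submodule R b alpha.
move=> [c [i [Ac Ii ->]]]; have [r Rr Ir] := chart2_decomposition Ac.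
have [|o Oo eo] := @infinity_ideal_w_multiple (c - j r - j r * i).
  by apply: (ID) => //; apply: infinity_idealN; apply: (IM) => //; exact: chart2_const.
exists r, (o / (1 + i)); split=> //.
  by apply: (subringM hO) => //; exact: infinity_ring_inv.
rewrite mulrA -eo; field; exact: one_add_neq0.
Qed.

Lemma infinity_w_const o c : O o -> w * o = j c -> c = 0.
Proof.
have [I0 ID IM] := infinity_ideal_submodule R b alpha.
move=> [d [i [Ad Ii ->]]] e1.
have [_ IDT IMT] := infinity_ideal_submodule setT b alpha.
apply: (infinity_ideal_generic_const (alpha := alpha) b0).
have -> : j c = w * d + - (j c * i).
  rewrite -e1; field; exact: one_add_neq0.
apply: (IDT); first by apply: (@infinity_ideal_generic R); exact: infinity_ideal_w.
apply: infinity_idealN; apply: (IMT); first exact: chart2_const.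
exact: (@infinity_ideal_generic R).
Qed.

Lemma infinity_w_neq0 : w != 0.
Proof.
have [u0 _ _ eu] := unit_part.
have x0 := transcendental_neq0 (x2_transcendental alpha b0).
apply: contraTneq (mulf_neq0 x0 u0) => ew.
by rewrite eu ew expr0n negbK -[l]prednK.
Qed.

Lemma infinity_w_nonunit : ~ O w^-1.
Proof.
move=> Ow; have w0 := infinity_w_neq0.
have /(infinity_w_const Ow)/eqP : w * w^-1 = j 1 by rewrite divff ?rmorph1.
by rewrite oner_eq0.
Qed.

Lemma infinity_unit r o : R r -> R r^-1 -> r != 0 -> O o -> j r + w * o != 0 /\ O (j r + w * o)^-1.
Proof.
have [I0 ID IM] := infinity_ideal_submodule R b alpha.
move=> Rr Rri r0 [c [i [Ac Ii ->]]]; have i0 := one_add_neq0 Ii.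
have jr0 : j r != 0 by rewrite fmorph_eq0.
have Ii' : I (i + j r^-1 * (w * c)).
  by apply: (ID) => //; apply: (IM); [exact: chart2_const|exact: infinity_ideal_w].
have i'0 := one_add_neq0 Ii'.
have -> : j r + w * (c / (1 + i)) = j r * (1 + (i + j r^-1 * (w * c))) / (1 + i).
  by rewrite fmorphV; field; rewrite i0 jr0.
split; first by rewrite !mulf_neq0 ?invr_eq0.
rewrite invf_div invfM -fmorphV.
apply: (subringM hO); first by apply: (subringD hO (subring1 hO));
  apply: infinity_ring_chart; exact: infinity_ideal_sub.
by apply: (subringM hO); [exact: infinity_ring_const|exact: infinity_ring_inv].
Qed.

Lemma infinity_maxP : (forall u v, max_ideal R u -> max_ideal R v -> max_ideal R (u + v)) ->
  forall z, max_ideal O z <-> exists r o, [/\ max_ideal R r, O o & z = j r + w * o].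
Proof.
move=> hl z; split.
  move=> [Oz hz]; have [r [o [Rr Oo ez]]] := infinity_ring_decomposition Oz.
  exists r, o; split=> //; split=> //.
  have [->|r0] := eqVneq r 0; [by left|right] => Rri.
  have [z0 Ozi] := infinity_unit Rr Rri r0 Oo.
  by case: hz; rewrite ez // => /eqP; rewrite (negPf z0).
have Ow : O w by apply: infinity_ring_chart; exact: chart2_w.
move=> [r [o [[Rr hr] Oo ez]]]; split.
  by rewrite ez; apply: (subringD hO); [exact: infinity_ring_const|exact: (subringM hO)].
have [->|z0] := eqVneq z 0; [by left|right] => Oz.
have [r' [o' [Rr' Oo' ez']]] := infinity_ring_decomposition Oz.
have e1 : w * (- (j r * o' + o * z^-1)) = j (r * r' - 1).
  have : z * z^-1 = 1 by rewrite divff.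
  rewrite {1}ez mulrDl {1}ez' rmorphB rmorphM rmorph1 => <-; ring.
have := infinity_w_const _ e1 => /(_ _)/eqP; rewrite subr_eq0 => hrr.
have /eqP rr : r * r' == 1.
  apply: hrr; apply: (subringN hO); apply: (subringD hO); apply: (subringM hO) => //.
  exact: infinity_ring_const.
have r0 : r != 0 by apply: contra_eq_neq rr => ->; rewrite mul0r eq_sym oner_neq0.
case: hr => [/eqP|]; first by rewrite (negPf r0).
apply; have -> : r^-1 = r' by rewrite -[r'](mulKf r0) rr mulr1.
by [].
Qed.

Lemma infinity_ring_spec :
  (forall u v, max_ideal R u -> max_ideal R v -> max_ideal R (u + v)) ->
  spec A O /\ max_ideal O x.
Proof.
move=> hl; have hm := infinity_maxP hl; split.
  apply: local_over_spec => //; split=> //.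
  - move=> z z' /hm[r [o [mr Oo ->]]] /hm[r' [o' [mr' Oo' ->]]]; apply/hm.
    exists (r + r'), (o + o'); split; [exact: hl|exact: subringD|rewrite rmorphD; ring].
  - exact: infinity_ring_chart.
  - move=> _ [c [i [Ac Ii ->]]]; exists c, (1 + i); split=> //.
    + by apply: (subringD hA (subring1 hA)); exact: infinity_ideal_sub.
    + exact: one_add_neq0.
    + exact: infinity_ring_inv.
have [o Oo ex] := infinity_x_w; apply/hm; exists 0, o.
by rewrite rmorph0 add0r; split=> //; exact: max_ideal0.
Qed.

Section PointAtInfinity.
Variables (Q : set Om) (hsp : spec A Q) (hx : max_ideal Q x).
Let hQ : is_subring Q. Proof. by case: (spec_local_over hA hsp). Qed.
Let hlQ : forall u v, max_ideal Q u -> max_ideal Q v -> max_ideal Q (u + v).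
Proof. by case: (spec_local_over hA hsp). Qed.
Let AQ : A `<=` Q. Proof. by case: (spec_local_over hA hsp). Qed.

Lemma point_w_max : max_ideal Q w.
Proof.
have Qw : Q w by apply: AQ; exact: chart2_w.
apply: (max_ideal_rootX (n := l) hQ Qw).
have [_ _ _ <-] := unit_part; rewrite mulrC; apply: max_idealM => //.
apply: AQ; apply: (subringD hA (subring1 hA)); apply: (subringM hA).
  exact: chart2_const.
by apply: (subringX hA); exact: chart2_x.
Qed.

Lemma point_ideal_max i : I i -> max_ideal Q i.
Proof.
move=> [c [d [Ac Ad ->]]]; apply: hlQ; rewrite mulrC; apply: max_idealM => //;
  by [exact: AQ|exact: point_w_max].
Qed.

(** Every point at infinity in the chart over R is thus a generization of the one whose local ring
    is O, so an open set containing the latter contains them all. *)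
Lemma infinity_ring_point : O `<=` Q.
Proof.
move=> _ [c [i [Ac Ii ->]]]; apply: subringM => //; first exact: AQ.
have [] // := @unit_add_max _ Q hQ hlQ 1 i (oner_neq0 _) (subring1 hQ).
- by rewrite invr1; exact: subring1.
- exact: point_ideal_max.
Qed.

(* Q/wQ is a localization of R, hence reduced. *)
Lemma point_radical z N c : Q z -> Q c -> z ^+ N = c * x -> line Q w z.
Proof.
move=> Qz Qc ez.
have [_ _ _ hf] := spec_local_over hA hsp.
have [d [d' [Ad Ad' d'0 Qd' edd]]] := hf z Qz.
have [r Rr Ir] := chart2_decomposition Ad.
have hOQ := infinity_ring_point.
have [o Oo eo] := infinity_ideal_w_multiple Ir.
have [r0|r0] := eqVneq r 0.
  exists (o / d'); first by apply: subringM => //; exact: hOQ.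
  by move: eo; rewrite r0 rmorph0 subr0 edd => ->; ring.
(* If r <> 0, then r^N lies in w Q. Clearing the denominator of the cofactor puts r' r^N in the
   ideal at infinity, which meets R in 0; so r' = 0 and that denominator would not be invertible. *)
exfalso.
have [o' Oo' ex] := infinity_x_w.
have Qw : Q w by apply: AQ; exact: chart2_w.
have Qr : Q (j r) by apply: AQ; exact: chart2_const.
have [g Qg eg] : exists2 g, Q g & j r ^+ N = w * g.
  have [g Qg eg] : exists2 g, Q g & d ^+ N = j r ^+ N + w * g.
    have -> : d = j r + w * o by rewrite -eo; ring.
    have Qo := hOQ _ Oo.
    elim: (N) => [|M [g Qg IH]].
      by exists 0; rewrite ?expr0 ?mulr0 ?addr0 //; exact: subring0.
    exists (j r * g + o * (j r ^+ M + w * g)); last by rewrite !exprS IH; ring.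
    apply: (subringD hQ); first exact: subringM.
    apply: (subringM hQ) => //; apply: (subringD hQ); first exact: subringX.
    exact: subringM.
  exists (d' ^+ N * c * o' - g).
    apply: (subringB hQ) => //; apply: (subringM hQ); last exact: hOQ.
    by apply: (subringM hQ) => //; apply: (subringX hQ); exact: AQ.
  have -> : j r ^+ N = d ^+ N - w * g by rewrite eg; ring.
  have -> : d ^+ N = d' ^+ N * (c * x).
    by rewrite -ez edd expr_div_n mulrC divfK // expf_neq0.
  by rewrite {1}ex; ring.
have [d1 [d2 [Ad1 Ad2 d20 Qd2 egg]]] := hf g Qg.
have [r' Rr' Ir'] := chart2_decomposition Ad2.
have [I0 ID IM] := infinity_ideal_submodule R b alpha.
have : I (j (r' * r ^+ N)).
  have -> : j (r' * r ^+ N) = w * d1 + - (j r ^+ N * (d2 - j r')).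
    rewrite rmorphM rmorphXn.
    have -> : w * d1 = d2 * (w * g) by rewrite egg; field.
    by rewrite -eg; ring.
  apply: (ID); first exact: infinity_ideal_w.
  apply: infinity_idealN; apply: (IM) => //.
  by apply: (subringX hA); exact: chart2_const.
move=> /infinity_ideal_const/eqP; rewrite mulf_eq0 expf_eq0 (negPf r0) andbF orbF => /eqP r'0.
move: Ir'; rewrite r'0 rmorph0 subr0 => /point_ideal_max[_ [/eqP|//]].
by rewrite (negPf d20).
Qed.

End PointAtInfinity.

End Infinity.

(** * The polarization in the two charts *)

Section Polarization.
Variables (R : set K) (b alpha : K) (CR : C R) (hd : local_data R b alpha).
Let hR := curve_subring CR.
Let b0 : b != 0. Proof. by case: hd. Qed.
Let Y0 := basisY_neq0 alpha b0.
Let Rbeta : R (beta b alpha). Proof. by case: hd. Qed.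
Local Notation n := (b ^+ (e %/ l)).
Let n0 : n != 0. Proof. by rewrite expf_neq0. Qed.

Lemma polarization_chart1 Q m : spec (chart1 R b alpha) Q ->
  tpow Q (polarization j e l B E s Q) m = line Q (j (n ^ m)).
Proof.
have hA : is_subring (chart1 R b alpha) by exact: chart_subring.
move=> /(spec_local_over hA)[hQ _ AQ _].
have RQ : j @` R `<=` Q by move=> _ [u Ru <-]; apply: AQ; exact: chart_const.
have Qv : Q (v1 b alpha) by apply: AQ; exact: chart_v_mem.
have eO := O1_stalk s0 (chart1_stalks CR hd) hQ RQ Qv.
have eI : Etilde_ideal j E s Q = line Q 1.
  rewrite line1; apply/seteqP; split=> z; first by case.
  move=> Qz; split=> //; exists 1%N; rewrite eO tpow_line //.
  exists (z * s ^ (-1)); first by exists z.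
  by rewrite expr1 -invr_expz expr1z mulrCA divff // mulr1.
rewrite /polarization eI tpow_line ?oner_neq0 //.
rewrite (pullback_N_ell e l b0 (chart1_stalks CR hd) hQ RQ) tensor_line // exp1rz mul1r.
by rewrite tpow_line ?fmorph_eq0 // fmorphXz.
Qed.

(** The ideal of E~ is generated by w: it contains w because w^l is x times a unit of Q, and nothing
    outside w Q because Q / w Q is reduced. *)
Lemma polarization_chart2 Q m : spec (chart2 R b alpha) Q -> max_ideal Q (x2 b alpha) ->
  tpow Q (polarization j e l B E s Q) m = line Q ((w2 b alpha)^- 1 ^ m * j (n ^ m)).
Proof.
have hA := chart2_subring R b alpha.
move=> hsp hx; have [hQ _ AQ _] := spec_local_over hA hsp.
have RQ : j @` R `<=` Q by move=> _ [u Ru <-]; apply: AQ; exact: chart_const.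
have Qx : Q (x2 b alpha) by apply: AQ; exact: chart_v_mem.
have eO := O1_stalk Y0 (chart2_stalks CR hd) hQ RQ Qx.
have w0 := infinity_w_neq0 b0 Rbeta.
have eI : Etilde_ideal j E s Q = line Q (w2 b alpha).
  rewrite /Etilde_ideal eO tpow_line //; apply/seteqP; split=> z.
    move=> [Qz [N [_ [c Qc <-] ez]]].
    apply: (point_radical hR b0 Rbeta hsp hx (N := N) Qz Qc).
    by rewrite -ez -invr_expz expr1z /chart_v; ring.
  move=> /lineP[c Qc ->]; have Qw : Q (w2 b alpha) by apply: AQ; exact: chart_w_mem.
  split; first exact: subringM.
  exists l; have [u0 Ou _ eu] := unit_part b0 Rbeta.
  exists (c ^+ l * (1 + j (beta b alpha) * x2 b alpha ^+ p) * Y b alpha ^ (-1)).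
    exists (c ^+ l * (1 + j (beta b alpha) * x2 b alpha ^+ p)) => //.
    apply: (subringM hQ); first exact: subringX.
    exact: (infinity_ring_point b0 Rbeta hsp hx).
  by rewrite [(c * _) ^+ l]exprMn -eu -invr_expz expr1z /chart_v; ring.
rewrite /polarization eI tpow_line //.
rewrite (pullback_N_ell e l b0 (chart2_stalks CR hd) hQ RQ) tensor_line //.
rewrite tpow_line ?mulf_neq0 ?fmorph_eq0 ?expfz_neq0 //.
by rewrite expfzMl fmorphXz.
Qed.

End Polarization.

(** * Pole orders along the section at infinity *)

Section Expansion.
Variables (R : set K) (b alpha : K) (CR : C R) (hd : local_data R b alpha).
Let hR := curve_subring CR.
Let b0 : b != 0. Proof. by case: hd. Qed.
Let Rbeta : R (beta b alpha). Proof. by case: hd. Qed.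
Local Notation n := (b ^+ (e %/ l)).
Let n0 : n != 0. Proof. by rewrite expf_neq0. Qed.
Let jn0 : j n != 0. Proof. by rewrite fmorph_eq0. Qed.
Local Notation x := (x2 b alpha).
Local Notation w := (w2 b alpha).
Local Notation O := (infinity_ring R b alpha).
Let hO : is_subring O := infinity_ring_subring R alpha b0.

Lemma w2_neq0 : w != 0. Proof. exact: infinity_w_neq0 b0 Rbeta. Qed.

Lemma w2_mem : O w.
Proof. by apply: (@infinity_ring_chart R); exact: chart2_w. Qed.

Lemma infinity_hinv o : O o -> 1 + w * o != 0 /\ O (1 + w * o)^-1.
Proof.
move=> Oo; rewrite -(rmorph1 j); apply: (infinity_unit b0) => //.
- exact: (subring1 hR).
- by rewrite invr1; exact: (subring1 hR).
- exact: oner_neq0.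
Qed.

Definition unit_u := 1 + j (beta b alpha) * x ^+ p.

Lemma unit_u_punit : punit O w unit_u.
Proof.
have [o Oo ex] := infinity_x_w b0 Rbeta.
exists (j (beta b alpha) * (o * x ^+ p.-1)).
  apply: (subringM hO); first exact: infinity_ring_const.
  apply: (subringM hO) => //; apply: (subringX hO).
  by apply: (@infinity_ring_chart R); exact: chart2_x.
by rewrite /unit_u -{1}(prednK p0) exprS {1}ex; ring.
Qed.

Lemma v1_expansion : v1 b alpha = unit_u * w ^ (- l%:Z).
Proof.
have [u0 _ _ eu] := unit_part b0 Rbeta.
have x0 := transcendental_neq0 (x2_transcendental alpha b0).
rewrite -invr_expz -exprnP -eu -/unit_u -[v1 b alpha]invrK -x2_v1.
by field; rewrite x0 u0.
Qed.

Lemma w1_expansion : w1 b = unit_u ^+ q * w ^ (- p%:Z).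
Proof.
have x0 := transcendental_neq0 (x2_transcendental alpha b0).
have -> : w1 b = w * v1 b alpha ^+ q.
  by rewrite (w2_w1 hd) x2_v1 exprVn divfK // expf_neq0 // -invr_eq0 -x2_v1.
rewrite v1_expansion exprMn mulrCA; congr (_ * _).
rewrite [_ ^+ q]exprnP exprz_exp -{1}(expr1z w) -expfzDr ?w2_neq0 //.
(* The exponent is 1 - q l = -p because q l = p + 1. *)
congr (_ ^ _); have := divnK hlp; lia.
Qed.

(* The pole orders along the section at infinity of the functions on chart1. *)
Definition semig d := exists i c, (i < l)%N /\ d = (p * i + l * c)%N.

Lemma monomial_expansion i c : exists2 o, O o &
  w1 b ^+ i * v1 b alpha ^+ c = w ^ (- (p * i + l * c)%N%:Z) * (1 + w * o).
Proof.
have [o Oo eo] : punit O w (unit_u ^+ (q * i + c)).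
  exact: (punitX hO w2_mem _ unit_u_punit).
exists o => //; rewrite -eo w1_expansion v1_expansion !exprMn exprD exprM.
rewrite PoszD opprD expfzDr ?w2_neq0 // !PoszM.
rewrite [(w ^ _) ^+ i]exprnP [(w ^ _) ^+ c]exprnP !exprz_exp !mulNr; ring.
Qed.

(** Up to a function on the affine chart, z has order at least n at infinity. *)
Definition near_chart1 (n : int) z := exists c o, [/\ chart1 R b alpha c, O o & z = c + w ^ n * o].

Lemma near_chart1_semig d z : semig d -> near_chart1 (- d%:Z) z -> near_chart1 (- d%:Z + 1) z.
Proof.
move=> [i [c [_ ed]]] [z1 [o [hz1 Oo ->]]].
have hA1 : is_subring (chart1 R b alpha) by exact: chart_subring.
have [r [o' [Rr Oo' eo]]] := infinity_ring_decomposition hR b0 Rbeta Oo.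
have [o2 Oo2 em] := monomial_expansion i c.
exists (z1 + j r * (w1 b ^+ i * v1 b alpha ^+ c)), (o' - j r * o2); split.
- apply: (subringD hA1) => //; apply: (subringM hA1); first exact: chart_const.
  by apply: (subringM hA1); apply: (subringX hA1); [exact: chart_w_mem|exact: chart_v_mem].
- by apply: (subringB hO) => //; apply: (subringM hO) => //; exact: infinity_ring_const.
- by rewrite em -ed eo expfzDr ?w2_neq0 // expr1z; ring.
Qed.

(** As p = -1 modulo l, the residue i of (l - 1) d satisfies p i = d modulo l. So d lies in the
    semigroup once p i <= d. *)
Lemma semig_large d : (1 < l)%N -> (p * ((l.-1 * d) %% l) <= d)%N -> semig d.
Proof.
move=> l1 hd'; exists ((l.-1 * d) %% l)%N, ((d - p * ((l.-1 * d) %% l)) %/ l)%N.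
split; first by rewrite ltn_mod.
have hdiv : (l %| d - p * ((l.-1 * d) %% l))%N.
  rewrite -eqn_mod_dvd // modnMmr.
  have e1 : (q * (l.-1 * d) * l + d = d * l + p * (l.-1 * d))%N.
    have -> : (d * l = d + l.-1 * d)%N by rewrite mulnC -{1}(prednK l0) mulSn.
    by rewrite mulnAC divnK // mulSn addnC addnA.
  by rewrite -(modnMDl (q * (l.-1 * d)) d) e1 modnMDl.
by rewrite [(l * _)%N]mulnC divnK // subnKC.
Qed.

(** The pole of z is bounded by l N, and every d >= p l lies in the semigroup, so the tail can be
    shortened down to order -p l. This makes the starting order the same for all points of C. *)
Lemma near_chart1_start z N : (1 < l)%N -> O (x ^+ N * z) -> near_chart1 (- (p * l)%N%:Z) z.
Proof.
move=> l1 hz.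
have start : near_chart1 (- (l * N)%N%:Z) z.
  exists 0, (unit_u ^+ N * (x ^+ N * z)); split.
  - by apply: subring0; exact: chart_subring.
  - apply: (subringM hO) => //; apply: (subringX hO).
    exact: (punit_mem hO w2_mem unit_u_punit).
  - have x0 := transcendental_neq0 (x2_transcendental alpha b0).
    have ew : w ^ (- (l * N)%N%:Z) = (x * unit_u)^-1 ^+ N.
      have [_ _ _ eu] := unit_part b0 Rbeta; rewrite -/unit_u in eu.
      by rewrite eu -invr_expz -exprnP exprVn -exprM.
    have u0 := punit_neq0 infinity_hinv unit_u_punit.
    by rewrite add0r ew exprVn exprMn; field; rewrite !expf_neq0.
have [hN1|hN1] := leqP (l * N) (p * l).
  have [z1 [o [h1 h2 ->]]] := start.
  exists z1, (w ^+ (p * l - l * N) * o); split=> //.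
    by apply: (subringM hO) => //; apply: (subringX hO); exact: w2_mem.
  congr (_ + _); rewrite mulrA exprnP -expfzDr ?w2_neq0 //; congr (_ ^ _ * _); lia.
have one_more M : near_chart1 (- (p * l + M)%N%:Z) z -> near_chart1 (- (p * l)%N%:Z) z.
  elim: M => [|M IH]; first by rewrite addn0.
  move=> h1; apply: IH.
  have -> : - (p * l + M)%N%:Z = - (p * l + M.+1)%N%:Z + 1 by lia.
  apply: near_chart1_semig => //; apply: semig_large => //.
  apply: leq_trans (leq_addr _ _); rewrite leq_mul2l; apply/orP; right.
  by apply: ltnW; rewrite ltn_mod.
apply: (one_more (l * N - p * l)%N).
by rewrite subnKC // ltnW.
Qed.

End Expansion.

(* The chart at the generic point with [b = 1] and [alpha = 0], to which all the
   others are compared. *)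
Local Notation v0 := (v1 1 0).
Local Notation w0 := (w1 1).
Local Notation xi := (x2 1 0).
Local Notation om := (w2 1 0).
Local Notation O0 := (infinity_ring setT 1 0).
Local Notation A0 := (chart1 setT 1 0).
Let one0 : 1 != 0 :> K := oner_neq0 K.
Let CT : C setT := curve_generic hC.
Let d0 : local_data setT 1 0 := local_data_generic 0 one0.
Let hO0 : is_subring O0 := infinity_ring_subring setT 0 one0.
Let hA0 : is_subring A0. Proof. exact: chart_subring. Qed.
Let om0 : om != 0 := w2_neq0 d0.
Let Oom : O0 om := w2_mem setT 1 0.
Let hinv0 o : O0 o -> 1 + om * o != 0 /\ O0 (1 + om * o)^-1 := infinity_hinv CT d0 (o := o).
Let Oj c : O0 (j c). Proof. exact: infinity_ring_const. Qed.
Let A0j c : A0 (j c). Proof. exact: chart_const. Qed.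
Let A0v : A0 v0. Proof. exact: chart_v_mem. Qed.
Let A0w : A0 w0. Proof. exact: chart_w_mem. Qed.
Let xi0 : xi != 0 := transcendental_neq0 (x2_transcendental 0 one0).
Let beta0 : [set: K] (beta 1 0). Proof. by []. Qed.
Let nonunit0 : ~ O0 om^-1 := infinity_w_nonunit one0 beta0.
Let v0xi : v0 * xi = 1. Proof. by rewrite x2_v1 divff // -invr_eq0 -x2_v1. Qed.

(** * Comparison of the local charts with the generic one *)

Section Compare.
Variables (R : set K) (b alpha : K) (CR : C R) (hd : local_data R b alpha).
Let hR := curve_subring CR.
Let b0 : b != 0. Proof. by case: hd. Qed.
Local Notation n := (b ^+ (e %/ l)).
Let n0 : n != 0. Proof. by rewrite expf_neq0. Qed.
Let jn0 : j n != 0. Proof. by rewrite fmorph_eq0. Qed.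
(** Up to scaling, changing alpha translates v0 by h alpha; this is the ratio of the translate to v0
    = 1 / xi. *)
Definition eps := 1 + j (h * alpha) * xi.

Lemma eps_punit : punit O0 om eps.
Proof.
have [o Oo ex] := infinity_x_w one0 beta0.
by exists (j (h * alpha) * o); [exact: subringM|rewrite /eps {1}ex; ring].
Qed.

Lemma eps_neq0 : eps != 0.
Proof. exact: (punit_neq0 (@hinv0) eps_punit). Qed.

Lemma v1_compare : v1 b alpha = j n ^+ l * (v0 + j (h * alpha)).
Proof.
rewrite -rmorphXn -exprM divnK // /chart_v /basisY expr1n mulr1 rmorph0 mul0r addr0.
by rewrite !rmorphM; field.
Qed.

Lemma v1_eps : v1 b alpha = j n ^+ l * (v0 * eps).
Proof. by rewrite v1_compare; congr (_ * _); rewrite /eps mulrDr mulr1 mulrCA v0xi mulr1. Qed.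

Lemma x2_compare : x2 b alpha = (j n ^+ l)^-1 * (xi / eps).
Proof. by rewrite [LHS]x2_v1 v1_eps [LHS]invfM; congr (_ * _); rewrite [LHS]invfM -x2_v1. Qed.

Lemma w1_compare : w1 b = j n ^+ p * w0.
Proof. by rewrite /chart_w expr1n rmorph1 expr1n; ring. Qed.

(** Up to the constant 1 / n, the parameter changes by a unit that is 1 modulo xi, hence modulo
    om^l. *)
Lemma w2_compare : w2 b alpha = (j n)^-1 * (om * eps ^- q).
Proof.
rewrite (w2_w1 hd) w1_compare x2_compare (w2_w1 d0) exprMn expr_div_n exprVn -exprM.
rewrite [(l * q)%N]mulnC divnK // exprS; field.
by rewrite jn0 !expf_neq0 // eps_neq0.
Qed.

Lemma infinity_ring_compare : infinity_ring R b alpha `<=` O0.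
Proof.
have heV : punit O0 om eps^-1 by apply: (punitV hO0 (@hinv0)); exact: eps_punit.
have hx : exists2 o, O0 o & x2 b alpha = om * o.
  have [o Oo ex] := infinity_x_w one0 beta0.
  exists (j (n ^+ l)^-1 * (o * eps^-1)); last by rewrite x2_compare {1}ex fmorphV [j (_ ^+
    l)]rmorphXn; ring.
  apply: (subringM hO0) => //; apply: (subringM hO0) => //.
  exact: (punit_mem hO0 Oom heV).
have hw : exists2 o, O0 o & w2 b alpha = om * o.
  exists (j n^-1 * eps ^- q); last by rewrite w2_compare fmorphV; ring.
  apply: (subringM hO0) => //; rewrite -exprVn; apply: (subringX hO0).
  exact: (punit_mem hO0 Oom heV).
have [ox Oox ex] := hx; have [ow Oow ew] := hw.
have AO : chart2 R b alpha `<=` O0.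
  apply: chart_ring_min => //.
  - by move=> _ [u _ <-].
  - by rewrite ex; exact: subringM.
  - by rewrite ew; exact: subringM.
move=> _ [c [i [Ac [d [d' [Ad Ad' ->]]] ->]]].
have -> : x2 b alpha * d + w2 b alpha * d' = om * (ox * d + ow * d') by rewrite ex ew; ring.
apply: (subringM hO0); first exact: AO.
have [] // := hinv0 (o := ox * d + ow * d').
by apply: (subringD hO0); apply: (subringM hO0) => //; exact: AO.
Qed.

Lemma chart1_compare : chart1 R b alpha `<=` A0.
Proof.
apply: chart_ring_min => //.
- by move=> _ [u _ <-].
- rewrite v1_compare -rmorphXn; apply: (subringM hA0) => //; exact: (subringD hA0).
- by rewrite w1_compare -rmorphXn; exact: (subringM hA0).
Qed.

Lemma spec_chart1_generic Q : spec A0 Q -> spec (chart1 R b alpha) Q.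
Proof.
have hA : is_subring (chart1 R b alpha) by exact: chart_subring.
move=> /(spec_local_over hA0) loc; have [hQ hl AQ _] := loc.
apply: local_over_spec => //; apply: local_over_change loc _ => //.
  by move=> z /chart1_compare; exact: AQ.
set A := chart1 R b alpha.
have hF : is_subring (fractions_at A Q) by exact: fractions_at_subring.
have AF : A `<=` fractions_at A Q by apply: fractions_at_sub => //; exact: subring1.
have Fj c : fractions_at A Q (j c).
  have [_ _ _ hf] := curve_point_facts hC CR.
  have [r [r' [Rr Rr' r'0 ->]]] := hf c.
  rewrite rmorphM fmorphV; apply: fractions_at_div.
  - exact: chart_const.
  - exact: chart_const.
  - by rewrite fmorph_eq0.
  - by rewrite -fmorphV; apply: AQ.
apply: chart_ring_min => //.
- by move=> _ [u _ <-].
- have -> : v0 = j (n ^- l) * v1 b alpha - j (h * alpha).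
    by rewrite v1_compare fmorphV rmorphXn; field; rewrite expf_neq0.
  apply: (subringB hF) => //; apply: (subringM hF) => //; apply: AF; exact: chart_v_mem.
- have -> : w0 = j (n ^- p) * w1 b.
    by rewrite w1_compare fmorphV rmorphXn mulKf // expf_neq0.
  by apply: (subringM hF) => //; apply: AF; exact: chart_w_mem.
Qed.

End Compare.

(** * Normal forms on the generic affine chart *)

Definition monomial d :=
  let i := ((l.-1 * d) %% l)%N in
  if (p * i <= d)%N then w0 ^+ i * v0 ^+ ((d - p * i) %/ l) else 0.

(** The residue of d modulo l determines i, since p = -1 modulo l. So there is one basis monomial
    for each pole order d in the semigroup, and [monomial] is 0 at the gaps. *)
Lemma monomialE i c : (i < l)%N -> monomial (p * i + l * c) = w0 ^+ i * v0 ^+ c.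
Proof.
move=> il; rewrite /monomial.
have -> : (l.-1 * (p * i + l * c) %% l = i)%N.
  have -> : (l.-1 * (p * i + l * c) %% l = (i * l + l.-1 * (p * i + l * c)) %% l)%N.
    by rewrite modnMDl.
  have -> : (i * l + l.-1 * (p * i + l * c) = (l.-1 * (q * i) + l.-1 * c) * l + i)%N.
    have -> : (i * l = i + l.-1 * i)%N by rewrite mulnC -{1}(prednK l0) mulSn.
    have e1 : (q * i * l = i + p * i)%N by rewrite mulnAC divnK // mulSn.
    by rewrite mulnDl -!mulnA [(q * (i * l))%N]mulnA e1 !mulnDr [(c * l)%N]mulnC; lia.
  by rewrite modnMDl modn_small.
by rewrite leq_addr addKn mulKn.
Qed.

Lemma monomial_cases d : monomial d = 0 \/
  exists i c, [/\ (i < l)%N, d = (p * i + l * c)%N & monomial d = w0 ^+ i * v0 ^+ c].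
Proof.
have [hd'|hd'] := leqP (p * ((l.-1 * d) %% l)) d; last first.
  by left; rewrite /monomial leqNgt hd'.
have [l1|l1] := leqP l 1; last first.
  right; have [i [c [il ed]]] := semig_large l1 hd'.
  by exists i, c; split=> //; rewrite ed monomialE.
have el : l = 1%N by apply/eqP; rewrite eqn_leq l1 l0.
right; exists 0%N, d; rewrite {1 2}el mul1n muln0 add0n; split=> //.
by rewrite -{1}[d]mul1n -{1}el -[(l * d)%N]add0n -{1}(muln0 p) monomialE.
Qed.

Definition normal_form f := exists N (c : nat -> K), f = \sum_(d < N) j (c d) * monomial d.

Lemma normal_form_monomial c d : normal_form (j c * monomial d).
Proof.
exists d.+1, (fun d' => if d' == d then c else 0); rewrite big_ord_recr /= eqxx big1 ?add0r //.
by move=> i _; rewrite ltn_eqF ?ltn_ord // rmorph0 mul0r.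
Qed.

Lemma normal_formD f f' : normal_form f -> normal_form f' -> normal_form (f + f').
Proof.
have pad N (c : nat -> K) N' : exists c' : nat -> K, \sum_(d < N) j (c d) * monomial d =
    \sum_(d < N + N') j (c' d) * monomial d.
  exists (fun d => if (d < N)%N then c d else 0).
  rewrite big_split_ord /= [X in _ + X]big1 ?addr0.
    by apply: eq_bigr => i _; rewrite ltn_ord.
  by move=> i _; rewrite ltnNge leq_addr /= rmorph0 mul0r.
move=> [N [c ->]] [N' [c' ->]].
have [c1 ->] := pad N c N'; have [c2 ->] := pad N' c' N.
exists (N + N')%N, (fun d => c1 d + c2 d); rewrite [(N' + N)%N]addnC -big_split.
by apply: eq_bigr => i _; rewrite rmorphD mulrDl.
Qed.

Lemma normal_form_map (g : Om -> Om) f : (forall x x', g (x + x') = g x + g x') -> g 0 = 0 ->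
  (forall c d, normal_form (g (j c * monomial d))) -> normal_form f -> normal_form (g f).
Proof.
move=> gD g0 hg [N [c ->]]; elim: N => [|N IH].
  by rewrite big_ord0 g0; exists 0%N, (fun=> 0); rewrite big_ord0.
by rewrite big_ord_recr /= gD; exact: normal_formD.
Qed.

Lemma normal_form_const c f : normal_form f -> normal_form (j c * f).
Proof.
apply: (normal_form_map (g := fun x => j c * x)) => [x x'||c' d]; rewrite ?mulrDr ?mulr0 //.
by rewrite mulrA -rmorphM; exact: normal_form_monomial.
Qed.

Lemma normal_form_v f : normal_form f -> normal_form (v0 * f).
Proof.
apply: (normal_form_map (g := fun x => v0 * x)) => [x x'||c d]; rewrite ?mulrDr ?mulr0 //.
have [->|[i [c' [il _ ->]]]] := monomial_cases d.
  by rewrite !mulr0; exists 0%N, (fun=> 0); rewrite big_ord0.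
have -> : v0 * (j c * (w0 ^+ i * v0 ^+ c')) = j c * monomial (p * i + l * c'.+1).
  by rewrite monomialE // exprS; ring.
exact: normal_form_monomial.
Qed.

Lemma normal_form_w f : normal_form f -> normal_form (w0 * f).
Proof.
apply: (normal_form_map (g := fun x => w0 * x)) => [x x'||c d]; rewrite ?mulrDr ?mulr0 //.
have [->|[i [c' [il _ ->]]]] := monomial_cases d.
  by rewrite !mulr0; exists 0%N, (fun=> 0); rewrite big_ord0.
have [il'|il'] := ltnP i.+1 l.
  have -> : w0 * (j c * (w0 ^+ i * v0 ^+ c')) = j c * monomial (p * i.+1 + l * c').
    by rewrite monomialE // exprS; ring.
  exact: normal_form_monomial.
have ei : i.+1 = l by apply/eqP; rewrite eqn_leq il il'.
have -> : w0 * (j c * (w0 ^+ i * v0 ^+ c')) =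
    j c * monomial (p * 0 + l * (p + c')) + j (c * beta 1 0) * monomial (p * 0 + l * c').
  rewrite !monomialE // !mul1r exprD rmorphM.
  transitivity (j c * (w0 ^+ l * v0 ^+ c')); first by rewrite -ei exprS; ring.
  by rewrite (w1_pow 1 0); ring.
by apply: normal_formD; exact: normal_form_monomial.
Qed.

Lemma chart1_normal_form f : A0 f -> normal_form f.
Proof.
have n1 : normal_form 1.
  have := normal_form_monomial 1 (p * 0 + l * 0).
  by rewrite monomialE // rmorph1 !mul1r.
have nN f' : normal_form f' -> normal_form (- f').
  by move=> hf; rewrite -mulN1r -(rmorph1 j) -rmorphN; exact: normal_form_const.
suff : A0 `<=` [set f | forall f', normal_form f' -> normal_form (f * f')].
  by move=> hs /hs /(_ _ n1); rewrite mulr1.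
apply: chart_ring_min.
- apply/is_subringP; split=> /= [f' hf'|x x' hx hx' f' hf'|x x' hx hx' f' hf'].
  + by rewrite mul1r.
  + rewrite mulrBl; apply: normal_formD; [exact: hx|apply: nN; exact: hx'].
  + by rewrite -mulrA; apply: hx; exact: hx'.
- by move=> _ [c _ <-] f'; exact: normal_form_const.
- exact: normal_form_v.
- exact: normal_form_w.
Qed.

(** The monomials of a normal form have distinct pole orders, so the last nonzero term cannot be
    cancelled. *)
Lemma chart1_leading f : A0 f -> f = 0 \/
  exists d c o, [/\ semig d, c != 0, O0 o & f = om ^ (- d%:Z) * (j c + om * o)].
Proof.
move=> /chart1_normal_form[N [c ->]].
suff : (\sum_(d < N) j (c d) * monomial d = 0) \/ exists d c' o, [/\ (d < N)%N, semig d, c' != 0,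
    O0 o & \sum_(d < N) j (c d) * monomial d = om ^ (- d%:Z) * (j c' + om * o)].
  by move=> [->|[d [c' [o [_ h1 h2 h3 ->]]]]]; [left|right; exists d, c', o].
elim: N => [|N IH]; first by left; rewrite big_ord0.
rewrite big_ord_recr /=.
have [h0|hm] : j (c N) * monomial N = 0 \/ c N != 0 /\ exists i c',
    [/\ (i < l)%N, N = (p * i + l * c')%N & monomial N = w0 ^+ i * v0 ^+ c'].
  have [->|cD] := eqVneq (c N) 0; first by left; rewrite rmorph0 mul0r.
  by have [->|h1] := monomial_cases N; [left; rewrite mulr0|right].
  rewrite h0 addr0; case: IH => [->|[d [c' [o [dD h1 h2 h3 ->]]]]]; [by left|right].
  by exists d, c', o; split=> //; exact: ltnW.
have [cD [i [c' [il eD eM]]]] := hm; right.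
have [o Oo em] := monomial_expansion d0 i c'.
have [o' Oo' eS] : exists2 o', O0 o' &
   \sum_(d < N) j (c d) * monomial d = om ^ (- N%:Z) * (om * o').
  case: IH => [->|[d [c'' [o'' [dD h1 h2 h3 ->]]]]].
    by exists 0; rewrite ?mulr0 //; exact: subring0.
  exists (om ^+ (N - d).-1 * (j c'' + om * o'')).
    apply: (subringM hO0); first exact: subringX.
    by apply: (subringD hO0) => //; exact: subringM.
  have -> : - d%:Z = - N%:Z + (N - d)%N%:Z by lia.
  rewrite expfzDr // -exprnP; have {1}-> : (N - d)%N = (N - d).-1.+1 by lia.
  by rewrite exprS; ring.
exists N, (c N), (j (c N) * o + o'); split=> //.
- by exists i, c'.
- by apply: (subringD hO0) => //; exact: subringM.
- by rewrite eS eM em -eD; ring.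
Qed.

Lemma leading_unit c o : c != 0 -> O0 o -> j c + om * o != 0 /\ O0 (j c + om * o)^-1.
Proof. by move=> c0 Oo; exact: (infinity_unit one0). Qed.

Lemma chart1_gap (n : int) f c o : A0 f -> (forall d, semig d -> n != - d%:Z) -> O0 o ->
  f = om ^ n * (j c + om * o) -> c = 0.
Proof.
move=> /chart1_leading hf hgap Oo ef; apply/eqP; apply: contraT => c0; exfalso.
have [u0 Oui] := leading_unit c0 Oo.
have Ou : O0 (j c + om * o) by apply: (subringD hO0) => //; exact: subringM.
case: hf => [f0'|[d [c' [o' [hdd c'0 Oo' ef']]]]].
  move/eqP: ef; rewrite f0' eq_sym mulf_eq0 (negPf u0) orbF expfz_eq0 (negPf om0).
  by rewrite andbF.
have [u'0 Ou'i] := leading_unit c'0 Oo'.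
have Ou' : O0 (j c' + om * o') by apply: (subringD hO0) => //; exact: subringM.
have h1 : - d%:Z <= n.
  apply: (fil_unit hO0 om0 Oom nonunit0 u0 Oui); rewrite -ef ef'; exact: fil_mem.
have h2 : n <= - d%:Z.
  apply: (fil_unit hO0 om0 Oom nonunit0 u'0 Ou'i); rewrite -ef' ef; exact: fil_mem.
by have /eqP := hgap d hdd; apply; apply/eqP; rewrite eq_le h1 h2.
Qed.

Lemma chart1_vanishing (n : int) f : A0 f -> 0 < n -> fil O0 om n f -> f = 0.
Proof.
move=> /chart1_leading[//|[d [c [o [_ c0 Oo ->]]]]] n0 hf; exfalso.
have [u0 Oui] := leading_unit c0 Oo.
by have := fil_unit hO0 om0 Oom nonunit0 u0 Oui hf; lia.
Qed.

Variables (g : nat) (hg : has_genus iota C g) (g0 : (0 < g)%N).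
Hypotheses (e0 : (0 < e)%N) (hB : is_divisor C B) (hBample : 0 < degree C B).
Local Notation nn b := (b ^+ (e %/ l)).

Lemma negative_vanishing kappa d : (0 < d)%N ->
  (forall R, C R -> exists b alpha, local_data R b alpha /\ R (kappa * b ^+ d)) -> kappa = 0.
Proof.
move=> dpos hk; apply: (negative_sections_zero hC hg g0 hB hBample dpos) => R [CR _].
by have [b [al [[b0 eB _ _] hR]]] := hk R CR; exists b.
Qed.

Lemma nn_pos d : (0 < d)%N -> (0 < e %/ l * d)%N.
Proof. by move=> dpos; rewrite muln_gt0 dpos divn_gt0 // dvdn_leq. Qed.

Section Descent.
Variables (m : nat) (F0 : Om).

(** * Descent on the pole order of the obstruction *)

(* [f] is a difference of a section on the chart at infinity and one on chart1,
   in the trivialization by (nn b)^m, and agrees with the reference [F0] up to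
   such differences at the generic point. *)
Definition obstruction R b alpha f :=
  (exists N, infinity_ring R b alpha (x2 b alpha ^+ N * (j (nn b) ^+ m * f))) /\
  (exists c o, [/\ A0 c, O0 o & f - F0 = c + om ^ m%:Z * o]).
Hypothesis obstructionF0 : obstruction setT 1 0 F0.
Hypothesis obstruction_exists : forall R b alpha, C R -> local_data R b alpha ->
  exists f, obstruction R b alpha f.

(** All points and all local data are treated together, because a coefficient is shown to vanish
    only as a section over the whole of C. *)
Definition obstruction_ge n := forall R b alpha f,
  C R -> local_data R b alpha -> obstruction R b alpha f ->
  near_chart1 R b alpha n (j (nn b) ^+ m * f).

Lemma step_start : (1 < l)%N -> obstruction_ge (- (p * l)%N%:Z).
Proof.
move=> l1 R b al f CR hd [[N hN1] _].
exact: (near_chart1_start CR hd (N := N) l1 hN1).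
Qed.

Lemma step_semig d : semig d -> obstruction_ge (- d%:Z) -> obstruction_ge (- d%:Z + 1).
Proof.
by move=> hsd hst R b al f CR hd hf; apply: near_chart1_semig => //; exact: hst.
Qed.

(** The unit relating the two parameters is 1 modulo om, so only the scaling by n affects the
    leading coefficient. *)
Lemma leading_compare R b alpha (n : int) r o : C R -> local_data R b alpha ->
  infinity_ring R b alpha o -> exists2 o', O0 o' &
  w2 b alpha ^ n * (j r + w2 b alpha * o) = j (nn b) ^ (- n) * (om ^ n * (j r + om * o')).
Proof.
move=> CR hd Oo; have Oo0 := infinity_ring_compare hd Oo.
have [b0 _ _ _] := hd; have jn0 : j (nn b) != 0 by rewrite fmorph_eq0 expf_neq0.
have he := eps_punit alpha.
have he1 : punit O0 om (eps alpha ^- q) by apply: (punitV hO0 (@hinv0)); exact: punitX.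
have [o1 Oo1 e1] := punit_expz hO0 Oom (@hinv0) n he1.
have hw := w2_compare hd.
exists (o1 * j r + (1 + om * o1) * (j (nn b))^-1 * eps alpha ^- q * o).
  apply: (subringD hO0); first exact: subringM.
  apply: (subringM hO0) => //; apply: (subringM hO0); last exact: (punit_mem hO0 Oom he1).
  apply: (subringM hO0); last by rewrite -fmorphV.
  by apply: (subringD hO0 (subring1 hO0)); exact: subringM.
rewrite hw !expfzMl e1 exprz_inv; ring.
Qed.

Lemma reference_normalization : j (nn (1 : K)) = 1.
Proof. by rewrite expr1n rmorph1. Qed.

Lemma step_leading (n : int) : n < m%:Z -> (forall d, semig d -> n != - d%:Z) -> obstruction_ge n ->
  exists rho, forall R b alpha f, C R -> local_data R b alpha -> obstruction R b alpha f ->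
    exists c r o, [/\ chart1 R b alpha c, R r, infinity_ring R b alpha o,
      j (nn b) ^+ m * f = c + w2 b alpha ^ n * (j r + w2 b alpha * o) &
      r = rho * nn b ^ (m%:Z + n)].
Proof.
move=> nm hgap hst.
have [c0 [o0 [Ac0 Oo0]]] := hst _ _ _ _ CT d0 obstructionF0.
rewrite reference_normalization expr1n mul1r => eF.
have [rho [o1 [_ Oo1 eo0]]] := infinity_ring_decomposition (curve_subring CT) one0 beta0 Oo0.
exists rho => R b al f CR hd hf; have hR := curve_subring CR.
have [b0 _ _ Rb] := hd; have n0 : nn b != 0 by rewrite expf_neq0.
have [c [o [Ac Oo ef]]] := hst _ _ _ _ CR hd hf.
have [r [o' [Rr Oo' eo]]] := infinity_ring_decomposition hR b0 Rb Oo.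
exists c, r, o'; split=> //; first by rewrite ef eo.
have [_ [c1 [o2 [Ac1 Oo2 eff]]]] := hf.
have [o3 Oo3 ew] := leading_compare n r CR hd Oo'.
have en : nn b ^ (m%:Z + n) = nn b ^+ m * nn b ^ n by rewrite expfzDr // -exprnP.
have [N eN] : exists N : nat, m%:Z = n + N.+1%:Z by exists `|m%:Z - n|.-1%N; lia.
(* This is the coefficient in order n of an element of [A0], obtained by subtracting the expansions
   of f, rescaled, and of [F0] over the generic point. The remainder of f - [F0] has order m > n and
   does not interfere, and n is minus a gap. *)
suff : rho - r * (nn b ^ (m%:Z + n))^-1 = 0.
  move/eqP; rewrite subr_eq0 => /eqP ->; rewrite divfK // en mulf_neq0 ?expf_neq0 //.
  exact: expfz_neq0.
apply: (@chart1_gap n (j (nn b ^- m) * c - c0 - c1) _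
  (o1 + om ^+ N * o2 - j (nn b ^ (m%:Z + n))^-1 * o3)) => //.
- apply: (subringB hA0) => //; apply: (subringB hA0) => //; apply: (subringM hA0) => //.
  exact: (chart1_compare Ac).
- apply: (subringB hO0); last exact: subringM.
  by apply: (subringD hO0) => //; apply: (subringM hO0) => //; exact: subringX.
have ec : c = j (nn b) ^+ m * f - j (nn b) ^ (- n) * (om ^ n * (j r + om * o3)).
  by rewrite -ew ef eo; ring.
have ec0 : c0 = F0 - om ^ n * (j rho + om * o1) by rewrite eF eo0; ring.
have ec1 : c1 = f - F0 - om ^ n * (om * om ^+ N) * o2.
  by rewrite eff eN expfzDr // -exprnP exprS; ring.
have eA : j (nn b) ^+ m = j (nn b ^+ m) by rewrite [RHS]rmorphXn.
have eB : j (nn b) ^ (- n) = (j (nn b ^ n))^-1 by rewrite fmorphXz invr_expz.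
have nA0 : nn b ^+ m != 0 by rewrite expf_neq0.
have nB0 : nn b ^ n != 0 by rewrite expfz_neq0.
rewrite ec ec0 ec1 eA eB en; move: (nn b ^+ m) (nn b ^ n) nA0 nB0 => nA nB nA0 nB0.
by rewrite !(fmorphV, rmorphB, rmorphM) /=; field; rewrite !fmorph_eq0 nA0 nB0.
Qed.

Lemma step_gap (n : int) : n < m%:Z -> 0 < m%:Z + n -> (forall d, semig d -> n != - d%:Z) ->
  obstruction_ge n -> obstruction_ge (n + 1).
Proof.
move=> nm mn hgap /(step_leading nm hgap)[rho hrho].
have [N eN] : exists N : nat, m%:Z + n = N.+1%:Z by exists (`|(m%:Z + n)%R|%N.-1); lia.
have rho0 : rho = 0.
  apply: (@negative_vanishing _ (e %/ l * N.+1)%N); first exact: nn_pos.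
  move=> R CR; have [b [al hd]] := local_data_exists CR; exists b, al; split=> //.
  have [f hf] := obstruction_exists CR hd.
  have [c [r [o [_ Rr _ _ er]]]] := hrho _ _ _ _ CR hd hf.
  by move: Rr; rewrite er eN -exprnP exprM.
move=> R b al f CR hd hf.
have [c [r [o [Ac Rr Oo ef er]]]] := hrho _ _ _ _ CR hd hf.
exists c, o; split=> //.
by rewrite ef er rho0 mul0r rmorph0 add0r expfzDr ?(w2_neq0 hd) // expr1z mulrA.
Qed.

(** * The exceptional order -5 for p = 3 and l = 4 *)

Section Special.
Hypotheses (p3 : p = 3%N) (l4 : l = 4%N) (m2 : (2 <= m)%N) (noncube : forall u, a != u ^+ 3).

Let q1 : q = 1%N. Proof. by rewrite p3 l4. Qed.
Let three0 : 3%:R = 0 :> K.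
Proof. by rewrite -p3 -(rmorph_nat iota) (pcharf0 hp) rmorph0. Qed.

(** Modulo these elements orders -3 and -4 disappear, being leading terms of w0 and v0, and the
    coefficients in orders -5, -2, -1, the gaps, remain meaningful. *)
Definition congr0 z := exists c o, [/\ A0 c, O0 o & z = c + o].

Lemma congr0D z z' : congr0 z -> congr0 z' -> congr0 (z + z').
Proof.
move=> [c [o [hc ho ->]]] [c' [o' [hc' ho' ->]]]; exists (c + c'), (o + o').
by split; [exact: (subringD hA0)|exact: (subringD hO0)|ring].
Qed.

Lemma congr0M c z : congr0 z -> congr0 (j c * z).
Proof.
move=> [c1 [o [hc ho ->]]]; exists (j c * c1), (j c * o).
by split; [exact: (subringM hA0)|exact: (subringM hO0)|ring].
Qed.

Lemma congr0B z z' : congr0 z -> congr0 z' -> congr0 (z - z').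
Proof.
move=> hz hz'; apply: congr0D => //.
by rewrite -mulN1r -(rmorph1 j) -rmorphN; exact: congr0M.
Qed.

Lemma congr0_O o : O0 o -> congr0 o.
Proof. by move=> Oo; exists 0, o; rewrite add0r; split=> //; exact: (subring0 hA0). Qed.

Lemma congr0_A c : A0 c -> congr0 c.
Proof. by move=> Ac; exists c, 0; rewrite addr0; split=> //; exact: (subring0 hO0). Qed.

Lemma congr0_gap d5 d2 d1 :
  congr0 (j d5 * om ^- 5 + j d2 * om ^- 2 + j d1 * om ^- 1) -> d5 = 0 /\ d1 = 0.
Proof.
have gap i1 : (i1 == 5)%N || (i1 == 2)%N || (i1 == 1)%N ->
   forall d, semig d -> - i1%:Z != - d%:Z.
  move=> hk d [i [c [il ed]]]; apply/eqP => e1; move: il ed; rewrite p3 l4; lia.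
move=> [c [o [Ac Oo e1]]].
have OX i1 : O0 (om ^+ i1) by exact: subringX.
have OD z z' : O0 z -> O0 z' -> O0 (z + z') by exact: subringD.
have OB z z' : O0 z -> O0 z' -> O0 (z - z') by exact: subringB.
have OM z z' : O0 z -> O0 z' -> O0 (z * z') by exact: subringM.
have d50 : d5 = 0.
  apply: (@chart1_gap (- 5%:Z) c _ (j d2 * om ^+ 2 + j d1 * om ^+ 3 - om ^+ 4 * o)) => //.
  - exact: gap.
  - by apply: (OB); [apply: (OD)|]; apply: (OM).
  - have -> : c = j d5 * om ^- 5 + j d2 * om ^- 2 + j d1 * om ^- 1 - o by rewrite e1; ring.
    by rewrite -invr_expz -exprnP; field.
rewrite d50 rmorph0 mul0r add0r in e1.
have d20 : d2 = 0.
  apply: (@chart1_gap (- 2%:Z) c _ (j d1 - om * o)) => //.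
  - exact: gap.
  - by apply: (OB) => //; apply: (OM).
  - have -> : c = j d2 * om ^- 2 + j d1 * om ^- 1 - o by rewrite e1; ring.
    by rewrite -invr_expz -exprnP; field.
rewrite d20 rmorph0 mul0r add0r in e1.
split=> //; apply: (@chart1_gap (- 1%:Z) c _ (- o)) => //.
- exact: gap.
- by rewrite -sub0r; apply: (OB) => //; exact: subring0.
- have -> : c = j d1 * om ^- 1 - o by rewrite e1; ring.
  by rewrite -invr_expz -exprnP; field.
Qed.

(** Five Taylor steps give r0, ..., r4 in orders -5, ..., -1. As [eps] is 1 + t xi with xi of order
    4, passing to om mixes orders differing by 4 only: modulo regular terms the fifth power
    contributes 5 t in order -1, and the lower powers contribute their leading term alone. *)
Lemma special_expansion R b alpha f : C R -> local_data R b alpha -> obstruction R b alpha f ->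
  obstruction_ge (- 5%:Z) -> exists r0 r4 c2, [/\ R r0, R r4,
    (r0 = 0 -> near_chart1 R b alpha (- 5%:Z + 1) (j (nn b) ^+ m * f)) &
    congr0 (f - (j (r0 * nn b ^+ 5 / nn b ^+ m) * om ^- 5 + j c2 * om ^- 2 +
      j ((r4 * nn b + 5%:R * (h * alpha) * (r0 * nn b ^+ 5)) / nn b ^+ m) * om ^- 1))].
Proof.
move=> CR hd hf hst; have hR := curve_subring CR.
have [b0 _ _ Rb] := hd; have n0 : nn b != 0 by rewrite expf_neq0.
have jn0 : j (nn b) != 0 by rewrite fmorph_eq0.
have [c [o [Ac Oo ef]]] := hst _ _ _ _ CR hd hf.
have dec := infinity_ring_decomposition hR b0 Rb.
have [r0 [o1 [Rr0 Oo1 e0']]] := dec _ Oo; have [r1 [o2 [_ Oo2 e1]]] := dec _ Oo1.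
have [r2 [o3 [_ Oo3 e2]]] := dec _ Oo2; have [r3 [o4 [_ Oo4 e3]]] := dec _ Oo3.
have [r4 [o5 [Rr4 Oo5 e4]]] := dec _ Oo4.
exists r0, r4, (r3 * nn b ^+ 2 / nn b ^+ m); split=> //.
  move=> r00; exists c, o1; split=> //.
  by rewrite ef e0' r00 rmorph0 add0r expfzDr ?(w2_neq0 hd) // expr1z mulrA.
have [u0 Ou Oui eU] := unit_part one0 beta0.
set U := 1 + j (beta 1 0) * xi ^+ p in u0 Ou Oui eU.
have Oxi : O0 xi by apply: (@infinity_ring_chart setT); exact: chart2_x.
have OX z i1 : O0 z -> O0 (z ^+ i1) by exact: subringX.
have OD z z' : O0 z -> O0 z' -> O0 (z + z') by exact: subringD.
have OM z z' : O0 z -> O0 z' -> O0 (z * z') by exact: subringM.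
have ON i1 : O0 i1%:R by exact: subring_nat.
pose t := j (h * alpha).
have Ot : O0 t by exact: Oj.
have exi : xi = om ^+ 4 * U^-1 by rewrite -[LHS](mulfK u0) eU; congr (_ * _); congr (_ ^+ _).
have eps1 : eps alpha = 1 + t * xi by [].
have ew : w2 b alpha = (j (nn b))^-1 * (om / eps alpha).
  by rewrite (w2_compare hd) q1 expr1.
have epsn0 := eps_neq0 alpha.
have eU3 : U = 1 + j (beta 1 0) * xi ^+ 3 by rewrite /U; congr (_ + _); congr (_ * _); congr (_
  ^+ _).
(* Here v0 = U om^-4, and below w0 = U om^-3, where U - 1 has order at least 12. *)
have m4 : congr0 (om ^- 4).
  have -> : om ^- 4 = v0 - j (beta 1 0) * xi ^+ 2 * U^-1.
    have -> : v0 = xi^-1 by rewrite x2_v1 invrK.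
    have -> : xi^-1 = om ^- 4 * U by rewrite exi invfM invrK.
    rewrite {1}eU3; transitivity (om ^- 4 + j (beta 1 0) * xi ^+ 2 * (om ^- 4 * xi - U^-1)).
      by rewrite exi; field; rewrite u0 om0.
    by ring.
  apply: congr0B; first exact: congr0_A.
  by apply: congr0_O; apply: (OM) => //; apply: (OM) => //; exact: OX.
have m3 : congr0 (om ^- 3).
  have -> : om ^- 3 = w0 - j (beta 1 0) * om ^+ 9 * U^-1 ^+ 3.
    have -> : w0 = U * om ^- 3.
      rewrite (w1_expansion d0) /unit_u -/U q1 expr1; congr (_ * _).
      by rewrite -invr_expz -exprnP; congr (_^-1); congr (_ ^+ _).
    rewrite {1}eU3 exi; field; by rewrite u0 om0.
  apply: congr0B; first exact: congr0_A.
  by apply: congr0_O; apply: (OM); [apply: (OM) => //|]; exact: OX.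
(* Binomial expansion of (1 + t xi)^5: the square and higher terms are regular, and the linear term
   5 t U^-1 om^-1 differs from 5 t om^-1 by a regular one since U^-1 - 1 is divisible by om^12. *)
have n5 : congr0 (om ^- 5 * eps alpha ^+ 5 - (om ^- 5 + 5%:R * t * om ^- 1)).
  have -> : om ^- 5 * eps alpha ^+ 5 - (om ^- 5 + 5%:R * t * om ^- 1) =
    om ^+ 3 * U^-1 ^+ 2 * t ^+ 2 * (10%:R + 10%:R * (t * xi) + 5%:R * (t * xi) ^+ 2 + (t * xi) ^+ 3)
    - 5%:R * t * j (beta 1 0) * om ^+ 11 * U^-1 ^+ 4.
    have eU4 : U^-1 - 1 = - (j (beta 1 0) * (om ^+ 4 * U^-1) ^+ 3 * U^-1).
      rewrite -exi; apply: (mulIf u0); rewrite mulrBl mulVf // mul1r mulNr divfK //.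
      by rewrite {1}eU3; ring.
    transitivity (om ^+ 3 * U^-1 ^+ 2 * t ^+ 2 * (10%:R + 10%:R * (t * xi) + 5%:R * (t * xi) ^+ 2
      + (t * xi) ^+ 3) + 5%:R * t * om ^- 1 * (U^-1 - 1)).
      by rewrite eps1 exi; field; rewrite u0 om0.
    by rewrite eU4; field; rewrite u0 om0.
  apply: congr0_O; apply: (subringB hO0); by do ![assumption|exact: ON|exact: Oj|apply:
    (OX)|apply: (OD)|apply: (OM)].
(* The difference [eps] - 1 is divisible by om^4, so the error is regular for exponents up to 4. *)
have n_small i1 : (i1 < 4)%N -> congr0 (om ^- i1.+1 * (eps alpha ^+ i1.+1 - 1)).
  move=> i4; have [S OS eS] : exists2 S, O0 S & eps alpha ^+ i1.+1 - 1 = t * xi * S.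
    elim: (i1) => [|i [S OS IH]]; first by exists 1; [exact: subring1|rewrite eps1; ring].
    exists (eps alpha * S + 1); first by rewrite eps1; apply: (OD); [apply: (OM) => //;
      apply: (OD); [exact: subring1|exact: OM]|exact: subring1].
    rewrite exprS (_ : eps alpha * eps alpha ^+ i.+1 - 1 =
      eps alpha * (eps alpha ^+ i.+1 - 1) + (eps alpha - 1)); last by ring.
    have -> : eps alpha - 1 = t * xi by rewrite eps1; ring.
    by rewrite IH; ring.
  apply: congr0_O; rewrite eS exi.
  have -> : om ^+ 4 = om ^+ (4 - i1.+1) * om ^+ i1.+1 by rewrite -exprD subnK.
  have -> : om ^- i1.+1 * (t * (om ^+ (4 - i1.+1) * om ^+ i1.+1 * U^-1) * S) =
    t * om ^+ (4 - i1.+1) * U^-1 * S by field; rewrite u0 expf_neq0.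
  by do ![assumption|apply: (OX)|apply: (OM)].
pose nu := j (nn b); pose I0 := nu ^- m.
have efI : f = I0 * (c + w2 b alpha ^- 5 * o).
  have -> : w2 b alpha ^- 5 = w2 b alpha ^ (- 5%:Z) by rewrite -invr_expz.
  by rewrite -ef /I0 mulKf // expf_neq0.
have jE x : j (x / nn b ^+ m) = j x * I0.
  by rewrite rmorphM fmorphV [j (_ ^+ m)]rmorphXn.
have em : f - (j (r0 * nn b ^+ 5 / nn b ^+ m) * om ^- 5 + j (r3 * nn b ^+ 2 / nn b ^+ m) * om ^- 2 +
      j ((r4 * nn b + 5%:R * (h * alpha) * (r0 * nn b ^+ 5)) / nn b ^+ m) * om ^- 1) =
  I0 * (c + o5 + j r0 * nu ^+ 5 * (om ^- 5 * eps alpha ^+ 5 - (om ^- 5 + 5%:R * t * om ^- 1))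
    + (j r1 * nu ^+ 4 * om ^- 4 + j r1 * nu ^+ 4 * (om ^- 4 * (eps alpha ^+ 4 - 1)))
    + (j r2 * nu ^+ 3 * om ^- 3 + j r2 * nu ^+ 3 * (om ^- 3 * (eps alpha ^+ 3 - 1)))
    + j r3 * nu ^+ 2 * (om ^- 2 * (eps alpha ^+ 2 - 1))
    + j r4 * nu * (om ^- 1 * (eps alpha ^+ 1 - 1))).
  have jn i : j (nn b ^+ i) = nu ^+ i by rewrite [LHS]rmorphXn.
  have j5 : j (r0 * nn b ^+ 5 / nn b ^+ m) = j r0 * nu ^+ 5 * I0.
    by rewrite jE [j (r0 * _)]rmorphM jn.
  have j2 : j (r3 * nn b ^+ 2 / nn b ^+ m) = j r3 * nu ^+ 2 * I0.
    by rewrite jE [j (r3 * _)]rmorphM jn.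
  have j1 : j ((r4 * nn b + 5%:R * (h * alpha) * (r0 * nn b ^+ 5)) / nn b ^+ m) =
      (j r4 * nu + 5%:R * t * (j r0 * nu ^+ 5)) * I0.
    rewrite jE [j (r4 * _ + _)]rmorphD [j (r4 * _)]rmorphM [j (5%:R * _ * _)]rmorphM.
    by rewrite [j (5%:R * _)]rmorphM [j (r0 * _)]rmorphM jn rmorph_nat.
  rewrite j5 j2 j1 efI e0' e1 e2 e3 e4 ew -/nu.
  by field; rewrite ?epsn0 ?om0 ?andbT /=; exact: jn0.
have jnu i : nu ^+ i = j (nn b ^+ i) by rewrite [RHS]rmorphXn.
rewrite em /I0 jnu -fmorphV; apply: congr0M.
rewrite !jnu -[nu]/(j (nn b)) -!rmorphM.
apply: congr0D; last exact/congr0M/(n_small 0%N).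
apply: congr0D; last exact/congr0M/(n_small 1%N).
apply: congr0D; last by apply: congr0D; apply: congr0M; [exact: m3|exact: (n_small 2%N)].
apply: congr0D; last by apply: congr0D; apply: congr0M; [exact: m4|exact: (n_small 3%N)].
apply: congr0D; last exact: congr0M.
apply: congr0D; first by apply: congr0_A; exact: (chart1_compare Ac).
by apply: congr0_O; exact: (infinity_ring_compare hd Oo5).
Qed.

Lemma step_special : obstruction_ge (- 5%:Z) -> obstruction_ge (- 5%:Z + 1).
Proof.
move=> hst.
have [rho [tau [c20 [_ _ _]]]] := special_expansion CT d0 obstructionF0 hst.
rewrite !expr1n !mulr1 divr1 mulr0 mulr0 mul0r addr0 divr1 => hF.
have key R b al f : C R -> local_data R b al -> obstruction R b al f -> exists r0 r4,
   [/\ R r0, R r4, (r0 = 0 -> near_chart1 R b al (- 5%:Z + 1) (j (nn b) ^+ m * f)),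
      r0 * nn b ^+ 5 = rho * nn b ^+ m &
      r4 * nn b + 5%:R * (h * al) * (r0 * nn b ^+ 5) = tau * nn b ^+ m].
  move=> CR hd hf; have [b0 _ _ _] := hd.
  have n0 : nn b ^+ m != 0 by rewrite !expf_neq0.
  have [r0 [r4 [c2 [Rr0 Rr4 hr0 hfc]]]] := special_expansion CR hd hf hst.
  have [_ [c [o [Ac Oo eff]]]] := hf.
  have hdiff : congr0 (f - F0).
    rewrite eff; apply: congr0D; first exact: congr0_A.
    by apply: congr0_O; apply: (subringM hO0) => //; exact: subringX.
  set c5 := r0 * nn b ^+ 5 / nn b ^+ m in hfc.
  set c1 := (_ / nn b ^+ m) in hfc.
  have [] := @congr0_gap (c5 - rho) (c2 - c20) (c1 - tau).
    have -> : j (c5 - rho) * om ^- 5 + j (c2 - c20) * om ^- 2 + j (c1 - tau) * om ^- 1 =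
      (F0 - (j rho * om ^- 5 + j c20 * om ^- 2 + j tau * om ^- 1))
      - (f - (j c5 * om ^- 5 + j c2 * om ^- 2 + j c1 * om ^- 1)) + (f - F0).
      by rewrite !rmorphB; ring.
    by apply: congr0D => //; exact: congr0B.
  move=> /eqP; rewrite subr_eq0 => /eqP e5 /eqP; rewrite subr_eq0 => /eqP e1.
  by exists r0, r4; split=> //; rewrite -?e5 -?e1 divfK.
have rho0 : rho = 0.
  have kappa0 : tau ^+ 3 + h ^+ 3 * a * rho ^+ 3 = 0.
    (* The cubes of tau n^m and rho n^m carry n^(3m), while their expressions in r4 and r0 combine
       to n^3 (r4^3 + beta r0^3). The exponent 3m - 3 is positive because m >= 2. *)
    apply: (@negative_vanishing _ (e %/ l * (3 * m - 3))%N).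
      by apply: nn_pos; lia.
    move=> R CR; have [b [al hd]] := local_data_exists CR; exists b, al; split=> //.
    have [f hf] := obstruction_exists CR hd; have [b0 _ _ Rb] := hd.
    have hR := curve_subring CR.
    have [r0 [r4 [Rr0 Rr4 _ h1 h2]]] := key _ _ _ _ CR hd hf.
    have n0 : nn b != 0 by rewrite expf_neq0.
    suff -> : (tau ^+ 3 + h ^+ 3 * a * rho ^+ 3) * b ^+ (e %/ l * (3 * m - 3)) =
        r4 ^+ 3 + beta b al * r0 ^+ 3.
      by apply: (subringD hR); [exact: subringX|apply: (subringM hR) => //; exact: subringX].
    have be : b ^+ e = nn b ^+ 4 by rewrite -l4 -exprM divnK.
    apply: (mulIf (expf_neq0 3 n0)).
    transitivity ((tau * nn b ^+ m) ^+ 3 + h ^+ 3 * a * (rho * nn b ^+ m) ^+ 3).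
      have gen (x : K) : (x ^+ m) ^+ 3 = x ^+ (3 * m - 3) * x ^+ 3.
        by rewrite -exprM -exprD; congr (_ ^+ _); lia.
      by rewrite exprM [(tau * _) ^+ 3]exprMn [(rho * _) ^+ 3]exprMn gen; ring.
    rewrite -h1 -h2 /beta be.
    have -> : (h * nn b ^+ 4) ^+ p * (a - al ^+ p) = (h * nn b ^+ 4) ^+ 3 * (a - al ^+ 3).
      by rewrite p3.
    apply/eqP; rewrite -subr_eq0; apply/eqP.
    (* With 5 = -1 in characteristic 3, the cube of X + 5 Y is X^3 - Y^3 up to 15 X^2 Y + 75 X Y^2 +
       126 Y^3; the coefficients 5, 25, 42 are these divided by 3. *)
    rewrite -[RHS](mul0r (r4 ^+ 2 * nn b ^+ 2 * 5%:R * (h * al) * (r0 * nn b ^+ 5) +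
       25%:R * r4 * nn b * (h * al) ^+ 2 * (r0 * nn b ^+ 5) ^+ 2 +
       42%:R * (h * al) ^+ 3 * (r0 * nn b ^+ 5) ^+ 3)) -three0.
    by ring.
  apply/eqP; apply: contraT => rho0; exfalso.
  (* With rho <> 0, the vanishing of tau^3 + h^3 a rho^3 displays this cube root of a. *)
  move/eqP: (noncube (- (tau / (h * rho)))); apply.
  apply: (mulfI (expf_neq0 3 (mulf_neq0 hh rho0))).
  rewrite -exprMn mulrN mulrCA divff ?mulf_neq0 // mulr1.
  by apply/eqP; rewrite -subr_eq0 -[X in _ == X]kappa0; apply/eqP; ring.
move=> R b al f CR hd hf; have [b0 _ _ _] := hd.
have [r0 [r4 [_ _ hr0 h1 _]]] := key _ _ _ _ CR hd hf; apply: hr0.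
apply/eqP; move/eqP: h1; rewrite rho0 mul0r mulf_eq0 expf_eq0 /= expf_eq0.
by rewrite (negPf b0) andbF orbF.
Qed.

End Special.

Lemma step_upto (n0 n1 : int) : n0 <= n1 -> obstruction_ge n0 ->
  (forall n, n0 <= n -> n < n1 -> obstruction_ge n -> obstruction_ge (n + 1)) -> obstruction_ge n1.
Proof.
move=> n01 h0 hs; have [N eN] : exists N : nat, n1 = n0 + N%:Z by exists `|n1 - n0|%N; lia.
have aux M : (M <= N)%N -> obstruction_ge (n0 + M%:Z).
  elim: M => [|M IH] MN; first by rewrite addr0.
  have -> : n0 + M.+1%:Z = n0 + M%:Z + 1 by lia.
  by apply: hs; [lia|lia|apply: IH; lia].
by rewrite eN; exact: aux.
Qed.

(** Positive orders are never poles on the affine chart. For n = -d <= 0, either d lies in the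
    semigroup or it is a gap; gaps are at most 2 except 5 for (3, 4), and the lower bounds on m give
    m + n > 0 except possibly there. *)
Lemma step_final : ((p == 2) && (l == 3) && (2 <= m))%N || ((p == 3) && (l == 2) && (2 <= m))%N ||
  ((p == 3) && (l == 4) && (3 <= m))%N -> (p = 3%N -> forall u, a != u ^+ 3) -> obstruction_ge m%:Z.
Proof.
move=> hcase noncube.
have l1 : (1 < l)%N by lia.
have m0 : (0 < m)%N by lia.
apply: (step_upto _ (step_start l1)) => [|n hn0 hn1 hst]; first by lia.
have [n_neg|n_pos] := leP n 0; last first.
  apply: step_gap => //; first by lia.
  by move=> d _; apply/eqP; lia.
have [d ed] : exists d : nat, n = - d%:Z by exists `|n|%N; lia.
have [hd|hd] := boolP (p * ((l.-1 * d) %% l) <= d)%N.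
  rewrite ed; apply: step_semig; first exact: semig_large.
  by rewrite -ed.
have gap d' : semig d' -> n != - d'%:Z.
  move=> [i [c [il ed']]]; apply/eqP => en; have edd : d = d' by lia.
  move/negP: hd; apply; rewrite edd ed'.
  move: hcase il => /orP[/orP[]|] /andP[/andP[/eqP-> /eqP->] _]; lia.
have [mn|mn] := ltP 0 (m%:Z + n); first exact: step_gap.
have [p3 l4] : p = 3%N /\ l = 4%N.
  move: hcase hd; rewrite -ltnNge.
  move=> /orP[/orP[]|] /andP[/andP[/eqP-> /eqP->] hm]; lia.
have d5 : d = 5%N.
  move: hcase hd; rewrite -ltnNge p3 l4; lia.
rewrite ed d5; apply: step_special => //.
- by lia.
- exact: noncube.
- by rewrite -d5 -ed.
Qed.

End Descent.

Section Splitting.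
Hypotheses (p3 : p = 3%N) (hf0 : forall u, f0 <> u ^+ p).

(* If a were a cube, so would be the local lifts of df0, hence df0 = 0. *)
Lemma splitting_noncube u : a != u ^+ 3.
Proof.
apply/eqP => ea.
have [I [U [x [[hU hcov] [lift [hl1 hl2 hl3]] [al [hal halx]]]]]] := hE.
have [i0 _ Ui0] : (\bigcup_i U i) setT by rewrite -hcov.
have pcharK : p \in [pchar K] by rewrite (fmorph_pchar iota).
have subX (z z' : K) : (z - z') ^+ p = z ^+ p - z' ^+ p.
  by have := pFrobenius_autB_comm pcharK (mulrC z z'); rewrite !pFrobenius_autE.
(* Both alpha_i^p and the lifts of df0 have the p-th powers of the extension cocycle as differences,
   so alpha_i^p minus the lift is independent of i. *)
have glob i : al i ^+ p - lift i = al i0 ^+ p - lift i0.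
  have := hl3 i0 i; rewrite halx subX => e1.
  by apply/eqP; rewrite -subr_eq0; apply/eqP; move/eqP: e1; rewrite -subr_eq0 => /eqP <-; ring.
have egamma : a = al i0 ^+ p - lift i0.
  apply/eqP; rewrite -subr_eq0; apply/eqP; apply: (mulIf (expf_neq0 p hh)); rewrite mul0r.
  (* That common value also defines a splitting, and two splittings differ by a section of L^-p,
     which is zero. *)
  apply: (@negative_vanishing _ (e * p)%N); first by rewrite muln_gt0 e0.
  move=> R CR; have [b b0 eB] := line_O_ CR; have hR := curve_subring CR.
  have [i _ Ui] : (\bigcup_i U i) R by rewrite -hcov.
  have eE := extension_basis CR b0 eB (hal i R Ui).
  have hint := splitting_integral CR b0 eB eE.
  exists b, (al i); split=> //.
  have : tpow R (O_ D R) (- p%:Z) (lift i) by exact: hl1.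
  rewrite (O_D_line CR b0 eB) (tpow_line hR) ?tau_neq0 // => /lineP[r Rr er].
  rewrite -(glob i).
  have -> : (a - (al i ^+ p - lift i)) * h ^+ p * b ^+ (e * p) =
     (h * b ^+ e) ^+ p * (a - al i ^+ p) + r.
    have -> : r = lift i * (h * b ^+ e) ^+ p.
      by rewrite er -invr_expz -exprnP divfK // expf_neq0 // tau_neq0.
    by rewrite exprMn exprM; ring.
  exact: subringD.
have hf3 v : f0 <> v ^+ 3 by rewrite -p3; exact: hf0.
have char3 : 3%N \in [pchar k] by rewrite -p3.
have [d hd] := derivation_of_noncube iota char3 hf3.
have [dD dM _] := hd.
have /= := hl2 i0 d hd; rewrite /adb !mul1r => <- /eqP; apply.
(* If a = u^3, the lift alpha^3 - a is the cube of alpha - u, which every derivation kills. *)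
have -> : lift i0 = (al i0 - u) * ((al i0 - u) * (al i0 - u)).
  transitivity ((al i0 - u) ^+ p); last by rewrite p3; ring.
  by rewrite subX [in u ^+ p]p3 -ea egamma; ring.
rewrite !dM; set z := al i0 - u.
transitivity (3%:R * (z * z * d z)); first by ring.
by rewrite -p3 -(rmorph_nat iota) (pcharf0 hp) rmorph0 mul0r.
Qed.

End Splitting.

(** * Gluing over the curve *)

Section Gluing.
Variables (m : nat) (m0 : (0 < m)%N).
Hypothesis hstep : forall F0, obstruction m F0 setT 1 0 F0 ->
  (forall R b alpha, C R -> local_data R b alpha -> exists f, obstruction m F0 R b alpha f) ->
  obstruction_ge m F0 m%:Z.
Local Notation X := (raynaud_surface j C p e l B E zeta).
Local Notation Z Q := (tpow Q (polarization j e l B E s Q) (- m%:Z)).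
Variables (I : Type) (U : I -> set (set Om)) (c : I -> Om).
Hypotheses (hU : forall i, zariski_open X (U i)) (hcov : X = \bigcup_i U i)
  (hc : forall i i' Q, U i Q -> U i' Q -> Z Q (c i' - c i)).

Let XU Q i : U i Q -> X Q. Proof. by have [h1 _] := hU i; exact: h1. Qed.
Let cov Q : X Q -> exists i, U i Q. Proof. by rewrite hcov => -[i _ h1]; exists i. Qed.
Let generization i (Q Q' : set Om) : U i Q -> X Q' -> Q `<=` Q' -> U i Q'.
Proof.
move=> UQ XQ' QQ'; have [_ /(_ Q UQ)[fs [fsQ fsU]]] := hU i.
by apply: fsU => // f hf; apply: QQ'; exact: fsQ.
Qed.

Lemma Z_chart1 R b alpha Q z : C R -> local_data R b alpha -> spec (chart1 R b alpha) Q ->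
  Z Q z <-> Q (j (nn b) ^+ m * z).
Proof.
move=> CR hd hQ; have [b0 _ _ _] := hd.
have jn0 : j (nn b) ^+ m != 0 by rewrite expf_neq0 // fmorph_eq0 expf_neq0.
have en : j (nn b ^ (- m%:Z)) = (j (nn b) ^+ m)^-1 by rewrite fmorphXz -invr_expz.
rewrite (polarization_chart1 CR hd) // en lineP; split=> [[r Qr ->]|h1].
  by rewrite mulrC divfK.
by exists (j (nn b) ^+ m * z) => //; field.
Qed.

Lemma Z_chart2 R b alpha Q z : C R -> local_data R b alpha -> spec (chart2 R b alpha) Q ->
  max_ideal Q (x2 b alpha) ->
  Z Q z <-> exists2 r, Q r & j (nn b) ^+ m * z = w2 b alpha ^ m%:Z * r.
Proof.
move=> CR hd hQ hx; have [b0 _ _ _] := hd.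
have jn0 : j (nn b) ^+ m != 0 by rewrite expf_neq0 // fmorph_eq0 expf_neq0.
have en : j (nn b ^ (- m%:Z)) = (j (nn b) ^+ m)^-1 by rewrite fmorphXz -invr_expz.
have ew : (w2 b alpha)^-1 ^ (- m%:Z) = w2 b alpha ^ m%:Z by rewrite exprz_inv opprK.
rewrite (polarization_chart2 CR hd) // en [_ ^- 1 ^ _]ew lineP; split=> [[r Qr ->]|[r Qr er]].
  by exists r => //; field.
exists r => //; apply: (mulfI jn0); rewrite er; field; exact: jn0.
Qed.

(** Here [c1] solves the problem on the affine chart over R, while [c i] solves it near the point at
    infinity over R; [c1 - c i] is the obstruction to joining them. *)
Definition glued R b alpha c1 i :=
  (forall i' Q, spec (chart1 R b alpha) Q -> U i' Q -> Z Q (c1 - c i')) /\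
  U i (infinity_ring R b alpha).

Lemma infinity_point R b alpha : C R -> local_data R b alpha ->
  [/\ spec (chart2 R b alpha) (infinity_ring R b alpha),
      max_ideal (infinity_ring R b alpha) (x2 b alpha) & X (infinity_ring R b alpha)].
Proof.
move=> CR hd; have [b0 _ _ Rb] := hd.
have [h1 h2] := infinity_ring_spec (curve_subring CR) b0 Rb (curve_local hC CR).
by split=> //; exact: (chart2_surface CR hd).
Qed.

Lemma glued_exists R b alpha : C R -> local_data R b alpha ->
  exists c1 i, glued R b alpha c1 i.
Proof.
move=> CR hd; have [_ _ XO] := infinity_point CR hd.
have [b0 _ _ Rb] := hd.
have jn0 : j (nn b) ^+ m != 0 by rewrite expf_neq0 // fmorph_eq0 expf_neq0.
have [i Ui] := cov XO.
have hA : is_subring (chart1 R b alpha) by exact: chart_subring.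
have [|i1 Q hQ Ui1|i1 i2 Q hQ U1 U2|c0 hc0] :=
    @affine_H1_vanishes _ _ hA I U (fun i => j (nn b) ^+ m * c i).
- by move=> Q hQ; apply: cov; exact: (chart1_surface CR hd).
- have [_ /(_ Q Ui1)[fs [fsQ fsU]]] := hU i1; exists fs; split=> // Q' hQ' hfs.
  by apply: fsU => //; exact: (chart1_surface CR hd).
- by rewrite -mulrBr; apply/(Z_chart1 _ CR hd hQ); exact: hc.
exists ((j (nn b) ^+ m)^-1 * c0), i; split=> // i' Q hQ UQ.
by apply/(Z_chart1 _ CR hd hQ); rewrite mulrBr mulVKf //; exact: hc0.
Qed.

(** Where x is invertible, a point of the spectrum of the local ring at infinity lies in the affine
    chart, so both solutions apply and their difference, suitably scaled, is regular. Hence its pole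
    along x = 0 is bounded. *)
Lemma glued_regular R b alpha c1 i : C R -> local_data R b alpha -> glued R b alpha c1 i ->
  exists N, infinity_ring R b alpha (x2 b alpha ^+ N * (j (nn b) ^+ m * (c1 - c i))).
Proof.
move=> CR hd [h1 h2]; have [b0 _ _ Rb] := hd.
have [s2 mx XO] := infinity_point CR hd.
have hA2 := chart2_subring R b alpha.
have hO : is_subring (infinity_ring R b alpha) := infinity_ring_subring R alpha b0.
have x0 := transcendental_neq0 (x2_transcendental alpha b0).
apply: (sections_basic_open hO _ x0); first by case: mx.
move=> Q /(spec_local_over hO) loc Qx; have [hQ hl OQ _] := loc.
have sQ2 : spec (chart2 R b alpha) Q.
  apply: local_over_spec => //; apply: local_over_change loc _ => //.
    by move=> z hz; apply: OQ; exact: infinity_ring_chart.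
  have [_ _ _ hf] := spec_local_over hA2 s2.
  by move=> z /hf[u [v [hu hv v0' Ov ->]]]; exists u, v; split=> //; exact: OQ.
have sQ1 : spec (chart1 R b alpha) Q.
  by apply: (spec_chart1_of_v1 hd) => //; rewrite -[v1 _ _]invrK -x2_v1.
have UQ : U i Q by apply: (generization h2) => //; exact: (chart1_surface CR hd).
by apply/(Z_chart1 _ CR hd sQ1); exact: h1.
Qed.

Lemma glued_compare R b alpha c1 i c1' i' : C R -> local_data R b alpha ->
  glued R b alpha c1 i -> glued setT 1 0 c1' i' ->
  A0 (c1 - c1') /\ fil O0 om m%:Z (c i - c i').
Proof.
move=> CR hd [h1 h2] [h1' h2']; have [b0 _ _ Rb] := hd.
have [s2 mx XO] := infinity_point CT d0.
split.
  apply: (sections_affine hA0) => Q sQ.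
  have sQ1 := spec_chart1_generic CR hd sQ.
  have [hQ _ AQ _] := spec_local_over hA0 sQ.
  have [i2 U2] := cov (chart1_surface CT d0 sQ).
  have := h1 i2 Q sQ1 U2; have := h1' i2 Q sQ U2.
  rewrite (Z_chart1 _ CT d0 sQ) (Z_chart1 _ CR hd sQ1).
  rewrite reference_normalization expr1n mul1r => q1 q2.
  have n0 : nn b ^+ m != 0 by rewrite !expf_neq0.
  have -> : c1 - c1' = j (nn b ^- m) * (j (nn b) ^+ m * (c1 - c i2)) - (c1' - c i2).
    have -> : j (nn b ^- m) = (j (nn b) ^+ m)^-1 by rewrite fmorphV [j (_ ^+ m)]rmorphXn.
    by rewrite mulKf ?expf_neq0 ?fmorph_eq0 ?expf_neq0 //; ring.
  by apply: (subringB hQ) => //; apply: (subringM hQ) => //; apply: AQ.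
have UO : U i O0 by apply: (generization h2) => //; exact: infinity_ring_compare.
have := hc h2' UO; rewrite (Z_chart2 _ CT d0 s2 mx).
rewrite reference_normalization expr1n mul1r => -[r Or ->].
exact: fil_mem.
Qed.

Lemma sections_glue : exists c0, forall i Q, U i Q -> Z Q (c i - c0).
Proof.
have [c10 [i0 g00]] := glued_exists CT d0.
pose F0 := c10 - c i0.
have obstruction_glued R b al c1 i : C R -> local_data R b al -> glued R b al c1 i ->
    obstruction m F0 R b al (c1 - c i).
  move=> CR hd hg1; split; first exact: (glued_regular CR hd hg1).
  have [h1 /lineP[r Or er]] := glued_compare CR hd hg1 g00.
  exists (c1 - c10), (- r); split=> //; first exact: (subringN hO0).
  by rewrite /F0; transitivity ((c1 - c10) - (c i - c i0)); [ring|rewrite er; ring].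
have stp : obstruction_ge m F0 m%:Z.
  apply: hstep; first exact: obstruction_glued.
  by move=> R b al CR hd; have [c1 [i hg1]] := glued_exists CR hd;
    exists (c1 - c i); exact: obstruction_glued.
have key R b al : C R -> local_data R b al -> exists c1 i d o, [/\ glued R b al c1 i,
    chart1 R b al d, infinity_ring R b al o
    & j (nn b) ^+ m * (c1 - c i) = d + w2 b al ^ m%:Z * o].
  move=> CR hd; have [c1 [i hg1]] := glued_exists CR hd.
  have [d [o [h1 h2 h3]]] := stp _ _ _ _ CR hd (obstruction_glued _ _ _ _ _ CR hd hg1).
  by exists c1, i, d, o.
have [d00 [o00 [Ad00 Oo00]]] := stp _ _ _ _ CT d0 (obstruction_glued _ _ _ _ _ CT d0 g00).
rewrite reference_normalization expr1n mul1r => e00.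
(* Subtracting [d00], regular on the affine chart, keeps a solution there; at infinity c0 differs
   from [c i0] by om^m o00, which is a section of the sheaf. *)
pose c0 := c10 - d00.
(* Once each is corrected by its regular part, the solution over R and the generic one differ by an
   element of [A0] of order at least m > 0 at infinity, hence by 0. So the single c0 solves the
   problem over every R. *)
have same R b al c1 i d o : C R -> local_data R b al -> glued R b al c1 i ->
    chart1 R b al d -> infinity_ring R b al o ->
    j (nn b) ^+ m * (c1 - c i) = d + w2 b al ^ m%:Z * o ->
    j (nn b) ^+ m * (c1 - c0) = d.
  move=> CR hd hg1 Ad Oo eq1; have [b0 _ _ _] := hd.
  have n0 : nn b != 0 by rewrite expf_neq0.
  have jn0 : j (nn b) ^+ m != 0 by rewrite expf_neq0 // fmorph_eq0.
  have jnV : j (nn b ^- m) = (j (nn b) ^+ m)^-1 by rewrite fmorphV [j (_ ^+ m)]rmorphXn.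
  have [h1 h2] := glued_compare CR hd hg1 g00.
  suff e1 : c1 - j (nn b ^- m) * d - c0 = 0.
    transitivity (j (nn b) ^+ m * (c1 - j (nn b ^- m) * d - c0) + d).
      by rewrite jnV; field.
    by rewrite e1 mulr0 add0r.
  apply: (@chart1_vanishing m%:Z) => //.
    have -> : c1 - j (nn b ^- m) * d - c0 = (c1 - c10) - j (nn b ^- m) * d + d00.
      by rewrite /c0; ring.
    apply: (subringD hA0) => //; apply: (subringB hA0) => //; apply: (subringM hA0) => //.
    exact: (chart1_compare Ad).
  have -> : c1 - j (nn b ^- m) * d - c0 =
      (c i - c i0) + j (nn b ^- m) * (w2 b al ^ m%:Z * o) - om ^ m%:Z * o00.
    have -> : d = j (nn b) ^+ m * (c1 - c i) - w2 b al ^ m%:Z * o by rewrite eq1; ring.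
    have -> : c0 = c i0 + om ^ m%:Z * o00.
      by rewrite /c0; apply/eqP; rewrite subr_eq -addrA [_ * _ + _]addrC -e00; apply/eqP; ring.
    by rewrite jnV; field.
  apply: filB => //; last exact: fil_mem.
  apply: filD => //; apply: filMl => //.
  have he1 : punit O0 om (eps al ^- q).
    by apply: (punitV hO0 (@hinv0)); apply: (punitX hO0 Oom); exact: eps_punit.
  have gen (z1 z2 z3 : Om) : (z1 * (z2 * z3)) ^ m%:Z * o = z2 ^ m%:Z * (z1 ^+ m * z3 ^+ m * o).
    by rewrite -!exprnP !exprMn; ring.
  rewrite (w2_compare hd) gen; apply: fil_mem.
  apply: (subringM hO0); last exact: (infinity_ring_compare hd).
  apply: (subringM hO0); apply: (subringX hO0); last exact: (punit_mem hO0 Oom he1).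
  by rewrite -fmorphV; exact: Oj.
exists c0 => i' Q UQ.
have [R CR hpts] := surface_points (XU UQ).
have [b [al hd]] := local_data_exists CR; have [b0 _ _ Rb] := hd.
have [c1 [i [d [o [hg1 Ad Oo eq1]]]]] := key _ _ _ CR hd.
have e1 := same _ _ _ _ _ _ _ CR hd hg1 Ad Oo eq1.
have [hQ1|[hQ2 hx]] := hpts _ _ hd.
  have hA1 : is_subring (chart1 R b al) by exact: chart_subring.
  have [hQ _ AQ _] := spec_local_over hA1 hQ1.
  have [h1 _] := hg1; have := h1 _ _ hQ1 UQ.
  rewrite !(Z_chart1 _ CR hd hQ1) => h2.
  have -> : j (nn b) ^+ m * (c i' - c0) = d - j (nn b) ^+ m * (c1 - c i').
    by rewrite -e1; ring.
  by apply: (subringB hQ) => //; exact: AQ.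
have [hQ _ _ _] := spec_local_over (chart2_subring R b al) hQ2.
have OQ := infinity_ring_point b0 Rb hQ2 hx.
have [_ hUO] := hg1.
have UiQ : U i Q by apply: (generization hUO) => //; exact: XU UQ.
have := hc UiQ UQ; rewrite !(Z_chart2 _ CR hd hQ2 hx) => -[r Qr er].
exists (r - o); first by apply: (subringB hQ) => //; exact: OQ.
transitivity (j (nn b) ^+ m * (c i' - c i) + j (nn b) ^+ m * (c1 - c0) - j (nn b) ^+ m * (c1 - c
  i)).
  by ring.
by rewrite er e1 eq1; ring.
Qed.

End Gluing.

Lemma H1_polarization_power m : (0 < m)%N ->
  (forall F0, obstruction m F0 setT 1 0 F0 ->
    (forall R b alpha, C R -> local_data R b alpha -> exists f, obstruction m F0 R b alpha f) ->
    obstruction_ge m F0 m%:Z) ->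
  H1_vanishes (raynaud_surface j C p e l B E zeta)
    (fun Q => tpow Q (polarization j e l B E s Q) (- m%:Z)).
Proof.
move=> m0 hst I U co [hU hcov] hco hcoc.
(* An empty index type leaves nothing to prove. Otherwise the a i0 i form a cochain in the function
   field whose coboundary is the cocycle. *)
have [[i0]|noI] := pselect (inhabited I); last first.
  exists I, U, id, (fun=> 0); split=> // i; case: noI; exact: inhabits i.
have [i i' Q UQ UQ'|c0 hc0] := @sections_glue m m0 hst I U (co i0) (fun i => (hU i).1) hcov.
  have -> : co i0 i' - co i0 i = co i i' by rewrite -(hcoc i0 i i'); ring.
  by apply: hco; split.
exists I, U, id, (fun i => co i0 i - c0); split=> [|i Q //|i Q UQ|i i']; first by split.
  exact: hc0 UQ.
by rewrite -(hcoc i0 i i'); ring.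
Qed.

End Surface.

(** * The numerical range and the conclusion *)

Lemma ceil_quotient (x d c : nat) : (0 < d)%N -> x = (c * d)%N ->
  Num.ceil (x%:R / d%:R : rat) = c%:Z.
Proof.
move=> dpos ->; have -> : (c * d)%N%:R / d%:R = c%:Z%:~R :> rat.
  by rewrite natrM mulfK // pnatr_eq0 -lt0n.
exact: intrKceil.
Qed.

(** The divisors l >= 2 of p + 1 are 3 for p = 2, and 2, 4 for p = 3. In each case 2 l / (p + 1) is
    an integer, namely 2, 1, 2, so the bound reads m > 1, 1, 2. *)
Lemma admissible_triples (p l : nat) (n : int) : (p = 2 \/ p = 3)%N -> (2 <= l)%N ->
  (l %| p.+1)%N -> n < - (l%:Z - Num.ceil ((2 * l)%N%:R / p.+1%:R : rat)) ->
  exists2 m : nat, n = - m%:Z &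
  ((p == 2) && (l == 3) && (2 <= m))%N || ((p == 3) && (l == 2) && (2 <= m))%N ||
  ((p == 3) && (l == 4) && (3 <= m))%N.
Proof.
move=> hp hl hlp hn.
have lp : (l <= p.+1)%N by exact: dvdn_leq.
have case3 c : (2 * l = c * p.+1)%N -> n < - (l%:Z - c%:Z).
  by move=> h; move: hn; rewrite (ceil_quotient (c := c)).
have [ep|ep] := hp; subst p.
- have [el|el] : l = 2%N \/ l = 3%N by lia.
    by rewrite el in hlp.
  by exists `|n|%N; have := case3 2%N; rewrite el => /(_ erefl); lia.
- have [el|[el|el]] : l = 2%N \/ l = 3%N \/ l = 4%N by lia.
  + by exists `|n|%N; have := case3 1%N; rewrite el => /(_ erefl); lia.
  + by rewrite el in hlp.
  + by exists `|n|%N; have := case3 2%N; rewrite el => /(_ erefl); lia.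
Qed.

Theorem corollary24
  (k : closedFieldType) (p : nat) (hp : p \in [pchar k])
  (* the curve C, its function field K, and its genus *)
  (K : fieldType) (iota : {rmorphism k -> K}) (C : set (set K))
  (hC : smooth_projective_curve iota C)
  (g : nat) (hg : has_genus iota C g) (hg2 : (2 <= g)%N)
  (* the pre-Tango structure L = O_C(D), with (df0) >= pD *)
  (D : set K -> int) (f0 : K) (hD : pre_tango iota C p D f0)
  (* N = O_C(B) ample, and an isomorphism N^e -> L, multiplication by h *)
  (e : nat) (he2 : (2 <= e)%N) (hep : coprime e p)
  (hedeg : (e%:Z %| degree C D)%Z)
  (B : set K -> int) (hB : is_divisor C B) (hBample : 0 < degree C B)
  (h : K) (hh : h != 0)
  (hN : forall R, C R -> O_ D R = [set h * a | a in tpow R (O_ B R) e%:Z])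
  (l : nat) (hl2 : (2 <= l)%N) (hlp : (l %| p.+1)%N) (hle : (l %| e)%N)
  (* the extension E of L by O_C with class eta(df0) *)
  (Om : fieldType) (j : {rmorphism K -> Om}) (s y : Om)
  (hsy : alg_indep2 j s y)
  (E : set K -> set Om) (hE : tango_extension iota j C p D f0 s y E)
  (* theta is the equation of C'', and zeta^l is the section s theta of
     O_P(p+1) (x) L^-p transported to M^-l = O_P(p+1) (x) N^(-ep) by h^p *)
  (theta : Om) (htheta : frobenius_splitting j C p D E s y theta)
  (zeta : Om) (hzeta : zeta ^+ l = j h ^+ p * (s * theta))
  (hp23 : p = 2%N \/ p = 3%N)
  (n : int)
  (hn : n < - (l%:Z - Num.ceil ((2 * l)%N%:R / p.+1%:R : rat))) :
  H1_vanishes (raynaud_surface j C p e l B E zeta)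
              (fun R => tpow R (polarization j e l B E s R) n).
Proof.
have [m -> hm] := admissible_triples hp23 hl2 hlp hn.
have [[a etheta] hsplit] := htheta.
have l0 : (0 < l)%N by exact: ltnW.
have e0 : (0 < e)%N by exact: ltnW.
have g0 : (0 < g)%N by exact: ltnW.
have m0 : (0 < m)%N by lia.
have [_ _ hf0 _] := hD.
apply: H1_polarization_power; try eassumption.
move=> F0 obstructionF0 obstruction_exists; apply: step_final; try eassumption.
by move=> p3 u; apply: splitting_noncube; eassumption.
Qed.
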